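(* Let $E$ be a complex Banach space, $A$ a closed linear operator on $E$, and $C\in L(E)$ injective with $CA\subset AC$. Let $K\in L^1_{loc}([0,\infty))$ be not identically zero and assume that for some $M>0$ and $\beta>0$: $|K(t)|\le Me^{\beta t}$, $t\ge0$. Let $A$ be a subgenerator of an exponentially bounded $K$-convoluted $C$-cosine function $(C_K(t))_{t\ge0}$. Then $A$ is a subgenerator of an exponentially bounded analytic $K_1$-convoluted $C$-semigroup $(S(t))_{t\ge0}$ of angle $\frac\pi2$, where $$K_1(t):=\int_0^\infty\frac{s\,e^{-s^2/4t}}{2\sqrt\pi\,t^{3/2}}K(s)\,ds\quad\text{and}\quad S(t)x:=\frac1{\sqrt{\pi t}}\int_0^\infty e^{-s^2/4t}C_K(s)x\,ds,\qquad t>0,\ x\in E.$$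
   Context: For $K\in L^1_{loc}([0,\infty))$ put $\Theta(t)=\int_0^tK(s)ds$. $A$ is a subgenerator of a $K$-convoluted $C$-cosine function $(C_K(t))_{t\ge0}$ if $(C_K(t))_{t\ge0}\subset L(E)$ is a strongly continuous operator family such that $C_K(t)A\subset AC_K(t)$, $C_K(t)C=CC_K(t)$, and for all $x\in E$, $t\ge0$: $\int_0^t(t-s)C_K(s)x\,ds\in D(A)$ and $A\int_0^t(t-s)C_K(s)x\,ds=C_K(t)x-\Theta(t)Cx$. It is exponentially bounded if $\|C_K(t)\|\le M'e^{\omega t}$, $t\ge0$, for some $M'>0$, $\omega\in\mathbb R$. $A$ is a subgenerator of a $K$-convoluted $C$-semigroup $(S_K(t))_{t\ge0}$ if $(S_K(t))_{t\ge0}\subset L(E)$ is strongly continuous, $S_K(t)C=CS_K(t)$, $S_K(t)A\subset AS_K(t)$, and for all $x\in E$, $t\ge0$: $\int_0^tS_K(s)x\,ds\in D(A)$ and $A\int_0^tS_K(s)x\,ds=S_K(t)x-\Theta(t)Cx$. Let $\Sigma_\alpha=\{re^{i\theta}:r>0,|\theta|<\alpha\}$. $(S_K(t))_{t\ge0}$ is an exponentially bounded, analytic $K$-convoluted $C$-semigroup of angle $\alpha\in(0,\frac\pi2]$ if there is an analytic function $\mathbf S_K:\Sigma_\alpha\to L(E)$ with $\mathbf S_K(t)=S_K(t)$ for $t>0$, $\lim_{z\to0,z\in\Sigma_\gamma}\mathbf S_K(z)x=0$ for all $\gamma\in(0,\alpha)$, $x\in E$, and for every $\gamma\in(0,\alpha)$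 there are $M_\gamma>0$, $\omega_\gamma>0$ with $\|\mathbf S_K(z)\|\le M_\gamma e^{\omega_\gamma\operatorname{Re}z}$, $z\in\Sigma_\gamma$. *)

(* Defs.v *)
From Stdlib Require Import Reals Lra.
From Coquelicot Require Import Coquelicot.
From mathcomp Require all_boot all_order all_algebra.
From mathcomp Require all_classical all_reals all_analysis.
From mathcomp Require Rstruct Rstruct_topology.

Local Open Scope R_scope.

Module Lebesgue.

Import all_boot all_order all_algebra all_classical all_reals all_analysis.
Import Rstruct Rstruct_topology.
Local Open Scope classical_set_scope.
Local Open Scope ring_scope.

Definition segment (t : R) : set R := `[0, t].

Definition half_line : set R := `[0, +oo[.

(* Complex-valued functions are integrated componentwise. *)
Definition integrableC (D : set R) (f : R -> C) : Prop :=
  lebesgue_measure.-integrable D (fun s => (Re (f s))%:E) /\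
  lebesgue_measure.-integrable D (fun s => (Im (f s))%:E).

Definition integralC (D : set R) (f : R -> C) : C :=
  (\int[lebesgue_measure]_(s in D) Re (f s),
   \int[lebesgue_measure]_(s in D) Im (f s)).

Definition ae_nonneg (P : R -> Prop) : Prop :=
  {ae lebesgue_measure, forall s : R, 0 <= s -> P s}.

End Lebesgue.

(* K represents an element of L^1_loc([0,oo)); its values on (-oo,0) are
   never used. *)
Definition L1_loc (K : R -> C) : Prop :=
  forall t : R, 0 <= t -> Lebesgue.integrableC (Lebesgue.segment t) K.

(* Equality to zero in L^1_loc is equality almost everywhere. *)
Definition zero_L1_loc (K : R -> C) : Prop :=
  Lebesgue.ae_nonneg (fun s => K s = RtoC 0).

Definition Theta (K : R -> C) (t : R) : C :=
  Lebesgue.integralC (Lebesgue.segment t) K.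

(* Restriction of scalars: the integral of Coquelicot is defined for modules
   over R only, so a complex Banach space E is also regarded as a real one,
   with the same carrier, uniform structure and norm. *)
Section RealScalars.

Variable E : CompleteNormedModule C_AbsRing.

Definition real_scal (r : R) (x : E) : E := scal (RtoC r) x.

Lemma real_scal_assoc (r s : R) (x : E) :
  real_scal r (real_scal s x) = real_scal (mult r s) x.
Proof.
  unfold real_scal; rewrite scal_assoc; f_equal.
  symmetry; exact (RtoC_mult r s).
Qed.

Lemma real_scal_one (x : E) : real_scal one x = x.
Proof. exact (scal_one x). Qed.

Lemma real_scal_distr_l (r : R) (x y : E) :
  real_scal r (plus x y) = plus (real_scal r x) (real_scal r y).
Proof. exact (scal_distr_l (RtoC r) x y). Qed.

Lemma real_scal_distr_r (r s : R) (x : E) :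
  real_scal (plus r s) x = plus (real_scal r x) (real_scal s x).
Proof.
  unfold real_scal; change (plus r s) with (Rplus r s); rewrite RtoC_plus.
  exact (@scal_distr_r C_Ring _ (RtoC r) (RtoC s) x).
Qed.

Definition real_ModuleSpace_mixin :=
  ModuleSpace.Mixin R_Ring (CompleteNormedModule.AbelianGroup C_AbsRing E)
    real_scal real_scal_assoc real_scal_one real_scal_distr_l
    real_scal_distr_r.

Definition real_NormedModuleAux :=
  NormedModuleAux.Pack R_AbsRing E
    (NormedModuleAux.Class R_AbsRing E
       (ModuleSpace.Class R_Ring E _ real_ModuleSpace_mixin)
       (UniformSpace.class (CompleteNormedModule.UniformSpace C_AbsRing E)))
    E.

Lemma real_norm_scal (r : R) (x : E) : norm (real_scal r x) <= abs r * norm x.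
Proof.
  apply Rle_trans with (1 := norm_scal (RtoC r) x).
  right; f_equal; exact (Cmod_R r).
Qed.

Definition real_NormedModule_mixin :=
  NormedModule.Mixin R_AbsRing real_NormedModuleAux
    (@norm C_AbsRing E) (@norm_factor C_AbsRing E)
    (@norm_triangle C_AbsRing E) real_norm_scal
    (@norm_compat1 C_AbsRing E) (@norm_compat2 C_AbsRing E)
    (@norm_eq_zero C_AbsRing E).

Definition real_CompleteNormedModule : CompleteNormedModule R_AbsRing :=
  CompleteNormedModule.Pack R_AbsRing E
    (CompleteNormedModule.Class R_AbsRing E
       (NormedModule.Class R_AbsRing E _ real_NormedModule_mixin)
       (CompleteNormedModule.mixin C_AbsRing E
          (CompleteNormedModule.class C_AbsRing E)))
    E.

End RealScalars.

Section Operators.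

Variable E : CompleteNormedModule C_AbsRing.

(* A partially defined operator; the values of app outside dom are
   irrelevant. *)
Record partial_operator := PartialOperator {
  dom : E -> Prop;
  app : E -> E }.

Definition linear_operator (A : partial_operator) : Prop :=
  dom A zero /\
  (forall x y, dom A x -> dom A y ->
     dom A (plus x y) /\ app A (plus x y) = plus (app A x) (app A y)) /\
  (forall (c : C) x, dom A x ->
     dom A (scal c x) /\ app A (scal c x) = scal c (app A x)).

Definition closed_operator (A : partial_operator) : Prop :=
  forall (u : nat -> E) (x y : E),
    (forall n, dom A (u n)) ->
    filterlim u eventually (locally x) ->
    filterlim (fun n => app A (u n)) eventually (locally y) ->
    dom A x /\ app A x = y.

Definition bounded_operator (T : E -> E) : Prop := is_linear T.

(* T A is contained in A T, for T everywhere defined *)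
Definition commutes_with (T : E -> E) (A : partial_operator) : Prop :=
  forall x, dom A x -> dom A (T x) /\ app A (T x) = T (app A x).

Definition opnorm (T : E -> E) : Rbar :=
  Lub_Rbar (fun r => exists x : E, norm x <= 1 /\ r = norm (T x)).

(* An operator family indexed by [0,oo) is a function on R whose values on
   (-oo,0) are never used. *)
Definition strongly_continuous (T : R -> E -> E) : Prop :=
  (forall t, 0 <= t -> bounded_operator (T t)) /\
  (forall x, continuous_on (fun t => 0 <= t) (fun t => T t x)).

Definition exponentially_bounded (T : R -> E -> E) : Prop :=
  exists M w : R, 0 < M /\
    forall t, 0 <= t -> Rbar_le (opnorm (T t)) (M * exp (w * t)).

Definition integral (f : R -> E) (a b : R) : E :=
  @RInt (real_CompleteNormedModule E) f a b.

Definition is_integral_half_line (f : R -> E) (v : E) : Prop :=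
  @is_RInt_gen (real_CompleteNormedModule E) f
    (at_point 0) (Rbar_locally p_infty) v.

Definition subgenerator_cosine (A : partial_operator) (K : R -> C)
    (Cop : E -> E) (CK : R -> E -> E) : Prop :=
  L1_loc K /\
  strongly_continuous CK /\
  (forall t, 0 <= t -> commutes_with (CK t) A) /\
  (forall t x, 0 <= t -> CK t (Cop x) = Cop (CK t x)) /\
  (forall t x, 0 <= t ->
     let J := integral (fun s => scal (RtoC (t - s)) (CK s x)) 0 t in
     dom A J /\ app A J = minus (CK t x) (scal (Theta K t) (Cop x))).

Definition subgenerator_semigroup (A : partial_operator) (K : R -> C)
    (Cop : E -> E) (SK : R -> E -> E) : Prop :=
  L1_loc K /\
  strongly_continuous SK /\
  (forall t x, 0 <= t -> SK t (Cop x) = Cop (SK t x)) /\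
  (forall t, 0 <= t -> commutes_with (SK t) A) /\
  (forall t x, 0 <= t ->
     let J := integral (fun s => SK s x) 0 t in
     dom A J /\ app A J = minus (SK t x) (scal (Theta K t) (Cop x))).

Definition sector (alpha : R) (z : C) : Prop :=
  exists r theta : R, 0 < r /\ Rabs theta < alpha /\
    z = (r * cos theta, r * sin theta).

(* For U open: complex differentiability in operator norm. *)
Definition analytic_on (U : C -> Prop) (F : C -> E -> E) : Prop :=
  (forall z, U z -> bounded_operator (F z)) /\
  (forall z, U z -> exists F' : E -> E, bounded_operator F' /\
     forall eps : posreal, locally' z (fun w : C =>
       Rbar_lt
         (opnorm (fun x =>
            minus (scal (/ (w - z))%C (minus (F w x) (F z x))) (F' x)))
         eps)).

Definition exp_bounded_analytic (alpha : R) (SK : R -> E -> E) : Prop :=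
  0 < alpha <= PI / 2 /\
  exists F : C -> E -> E,
    analytic_on (sector alpha) F /\
    (forall t x, 0 < t -> F (RtoC t) x = SK t x) /\
    (forall gamma x, 0 < gamma < alpha ->
       filterlim (fun z => F z x)
         (within (sector gamma) (locally (RtoC 0))) (locally (zero : E))) /\
    (forall gamma, 0 < gamma < alpha ->
       exists M w : R, 0 < M /\ 0 < w /\
         forall z, sector gamma z ->
           Rbar_le (opnorm (F z)) (M * exp (w * Re z))).

End Operators.

Arguments PartialOperator {E}.
Arguments dom {E}.
Arguments app {E}.
Arguments linear_operator {E}.
Arguments closed_operator {E}.
Arguments bounded_operator {E}.
Arguments commutes_with {E}.
Arguments opnorm {E}.
Arguments strongly_continuous {E}.
Arguments exponentially_bounded {E}.
Arguments integral {E}.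
Arguments is_integral_half_line {E}.
Arguments subgenerator_cosine {E}.
Arguments subgenerator_semigroup {E}.
Arguments analytic_on {E}.
Arguments exp_bounded_analytic {E}.

Definition K1 (K : R -> C) (t : R) : C :=
  Lebesgue.integralC Lebesgue.half_line (fun s =>
    (RtoC (s * exp (- (s ^ 2 / (4 * t))) /
           (2 * sqrt PI * Rpower t (3 / 2))) * K s)%C).

(* v = (PI t)^(-1/2) * int_0^oo exp(-s^2/(4t)) CK(s)x ds, the improper
   integral being convergent. *)
Definition is_gauss_transform {E : CompleteNormedModule C_AbsRing}
    (CK : R -> E -> E) (t : R) (x v : E) : Prop :=
  exists I : E,
    is_integral_half_line
      (fun s => scal (RtoC (exp (- (s ^ 2 / (4 * t))))) (CK s x)) I /\
    v = scal (RtoC (1 / sqrt (PI * t))) I.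

(* Main.v *)
(* Write g(z, s) = (pi z)^(-1/2) e^(-s^2/(4z)) and, for a continuous exponentially
   bounded c, let G_c(z) be the integral of g(z, s) c(s) over s >= 0.  The
   candidate is S(z)x = G_c(z) with c(s) = C_K(s)x.  A second order Taylor estimate
   of g in z, uniform against every exponential weight e^(ls), gives analyticity in
   operator norm; bounding a Gaussian by an exponential with rate sqrt(Re(1/(4z)))
   gives the sectorial bounds, and the limit 0 at the origin because C_K(0) = 0.

   For the generator equation let c2 be the second primitive of c vanishing to
   second order at 0.  The heat equation g_t = g_ss and two integrations by parts
   give (G_c2)' = G_c, hence the integral of S over [0, t] is G_c2(t).  Integrating
   A c2(s) = C_K(s)x - Theta(s)Cx against g and using that A is closed,
   A G_c2(t) = S(t)x - G_Theta(t) Cx.  Finally G_Theta is the primitive of K_1: one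
   integration by parts against the locally integrable K shows
   K_1(t) = int g_ss(t, s) Theta(s) ds = (G_Theta)'(t), and |K_1(t)| = O(t^(-1/2)). *)

Require Import Defs.
From Stdlib Require Import Reals Lra Psatz FunctionalExtensionality.
From Corelib Require ssreflect.
From Coquelicot Require Import Coquelicot.
From mathcomp Require all_boot all_order all_algebra.
From mathcomp Require all_classical all_reals all_analysis measurable_realfun.
From mathcomp Require Rstruct Rstruct_topology.

Local Open Scope R_scope.

(** * Integrals over the half-line *)

(** Two integrals coexist. Vector-valued integrals are Riemann integrals of continuous functions,
    whereas [K] is only Lebesgue integrable and bounded almost everywhere. Work with [K] is
    therefore moved onto [Theta K], which is locally Lipschitz; [parts_segment] is where the two
    integrals are compared. The Riemann side asks for two-sided continuity, so functions on the
    half-line are extended to the left by their value at 0.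

    One kind of majorant, [B * exp (- k * s)], serves throughout: a kernel that decays faster than
    every exponential pairs with any exponentially bounded function, and polynomial factors are paid
    for by a change of rate. Bounds stay linear in the constant [N] of the integrated function; with
    [N] proportional to the norm of the vector, this is what makes them operator-norm bounds.

    Moving a closed operator, a bounded operator or a component of a complex number through an
    integral is one and the same fact: integration preserves closed linear relations. *)

Module VectorAlgebra.

Import ssreflect.

Lemma minus_plus_l {G : AbelianGroup} (x y : G) : minus (plus x y) x = y.
Proof.
  unfold minus.
  rewrite plus_comm plus_assoc plus_opp_l; apply plus_zero_l.
Qed.

(** What two integrations by parts from 0 leave when a function and its derivative vanish there; the
    two sign changes cancel in front of the remaining integral [l]. *)
Lemma boundary_terms {V : ModuleSpace R_Ring} (x y l : V) (a b : R) :
  minus (minus x (scal a zero)) (minus (minus y (scal b zero)) l) =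
  plus (minus x y) l.
Proof.
  rewrite /minus !scal_zero_r !opp_zero !plus_zero_r !opp_plus !opp_opp.
  apply plus_assoc.
Qed.

Lemma plus_minus_zero {G : AbelianGroup} (x : G) : plus (minus zero zero) x = x.
Proof. rewrite minus_eq_zero; apply plus_zero_l. Qed.

(** The terms of one integration by parts against [t - s]: the weight vanishes at the upper end, the
    primitive at the lower end, and the weight has derivative -1. *)
Lemma convolution_terms {V : ModuleSpace R_Ring} (x y : V) (b : R) :
  minus (minus (scal 0 x) (scal b zero)) (scal (-1) y) = y.
Proof.
  rewrite (scal_zero_l x : scal 0 x = zero) scal_zero_r minus_eq_zero.
  rewrite (scal_opp_one y : scal (-1) y = opp y) /minus opp_opp.
  apply plus_zero_l.
Qed.

End VectorAlgebra.

Import VectorAlgebra.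

Section HalfLine.

Variable V : CompleteNormedModule R_AbsRing.

Definition half_line_integral (f : R -> V) (v : V) : Prop :=
  is_RInt_gen f (at_point 0) (Rbar_locally p_infty) v.

Lemma is_RInt_exp_neg (k a b : R) : 0 < k ->
  is_RInt (fun s => exp (- k * s)) a b ((exp (- k * a) - exp (- k * b)) / k).
Proof.
  intros hk.
  replace ((exp (- k * a) - exp (- k * b)) / k)
    with (minus (- exp (- k * b) / k) (- exp (- k * a) / k))
    by (unfold minus, plus, opp; simpl; field; lra).
  apply (is_RInt_derive (fun s => - exp (- k * s) / k)).
  - intros x _; auto_derive; [exact I | field; lra].
  - intros x _; apply (ex_derive_continuous (V := R_NormedModule));
      auto_derive; exact I.
Qed.

Lemma half_line_integral_filterlim (f : R -> V) (v : V) :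
  (forall s, continuous f s) ->
  half_line_integral f v <->
  filterlim (fun b => RInt f 0 b) (Rbar_locally p_infty) (locally v).
Proof.
  intros hf.
  assert (hI : forall b, is_RInt f 0 b (RInt f 0 b)).
  { intros b; apply (RInt_correct (V := V)), (ex_RInt_continuous (V := V)).
    intros z _; apply hf. }
  split.
  - intros h P hP.
    destruct (h P hP) as [Q T hQ hT hQT].
    unfold filtermap.
    apply filter_imp with (2 := hT).
    intros b hb.
    destruct (hQT 0 b hQ hb) as [y [hy hPy]].
    simpl in hy.
    rewrite (is_RInt_unique (V := V) _ _ _ _ hy); exact hPy.
  - intros h P hP.
    specialize (h P hP); unfold filtermap in h.
    exists (fun a => a = 0) (fun b => P (RInt f 0 b)); [reflexivity | exact h |].
    intros a b -> hb; exists (RInt f 0 b); split; [apply hI | exact hb].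
Qed.

Lemma norm_RInt_exp_neg (f : R -> V) (B k a b : R) :
  (forall s, continuous f s) -> 0 < k -> 0 <= a <= b ->
  (forall s, 0 <= s -> norm (f s) <= B * exp (- k * s)) ->
  norm (RInt f a b) <= B * ((exp (- k * a) - exp (- k * b)) / k).
Proof.
  intros hf hk hab hB.
  apply (norm_RInt_le f (fun s => B * exp (- k * s)) a b); [lra | | |].
  - intros x hx; apply hB; lra.
  - apply (RInt_correct (V := V)), (ex_RInt_continuous (V := V)).
    intros z _; apply hf.
  - exact (is_RInt_scal _ a b B _ (is_RInt_exp_neg k a b hk)).
Qed.

(** Cauchy criterion: the tail beyond [a] is at most [B / k * exp (- k * a)]. *)
Lemma half_line_integral_exists (f : R -> V) (B k : R) :
  (forall s, continuous f s) -> 0 < k ->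
  (forall s, 0 <= s -> norm (f s) <= B * exp (- k * s)) ->
  exists v, half_line_integral f v.
Proof.
  intros hf hk hB.
  assert (hB0 : 0 <= B).
  { specialize (hB 0 (Rle_refl 0)); rewrite Rmult_0_r, exp_0 in hB.
    pose proof (norm_ge_0 (f 0)); lra. }
  assert (hcauchy : forall a b, 0 <= a <= b ->
            norm (minus (RInt f 0 b) (RInt f 0 a)) <= B / k * exp (- k * a)).
  { intros a b hab.
    rewrite <- (RInt_Chasles (V := V) f 0 a b);
      try (apply (ex_RInt_continuous (V := V)); intros z _; apply hf).
    replace (minus (plus (RInt f 0 a) (RInt f a b)) (RInt f 0 a))
      with (RInt f a b).
    2: exact (eq_sym (minus_plus_l (G := CompleteNormedModule.AbelianGroup _ V) _ _)).
    apply Rle_trans with (1 := norm_RInt_exp_neg f B k a b hf hk hab hB).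
    pose proof (exp_pos (- k * b)).
    unfold Rdiv; rewrite (Rmult_comm _ (/ k)), <- Rmult_assoc.
    apply Rmult_le_compat_l; [| lra].
    apply Rmult_le_pos; [lra | apply Rlt_le, Rinv_0_lt_compat, hk]. }
  destruct (proj1 (@filterlim_locally_cauchy R V (Rbar_locally p_infty) _
                     (fun b => RInt f 0 b))) as [v hv].
  2: { exists v; apply half_line_integral_filterlim; assumption. }
  intros eps.
  assert (hpos : 0 < eps / (B / k + 1)).
  { apply Rdiv_lt_0_compat; [apply cond_pos |].
    assert (0 <= B / k) by (apply Rdiv_le_0_compat; lra); lra. }
  (* The inequality x < exp x gives an explicit threshold. Adding 1 to [B / k] avoids a division by
     zero when [B = 0], and [1 <= a] makes [k * a] positive. *)
  assert (hsmall : forall a, 1 <= a -> / (k * (eps / (B / k + 1))) < a ->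
            B / k * exp (- k * a) < eps).
  { intros a ha1 ha.
    assert (hBk : 0 <= B / k) by (apply Rdiv_le_0_compat; lra).
    assert (hka : k * a < exp (k * a)).
    { assert (0 < k * a) by nra.
      pose proof (exp_ineq1 (k * a)); lra. }
    assert (he : exp (- k * a) < eps / (B / k + 1)).
    { replace (- k * a) with (- (k * a)) by ring.
      rewrite exp_Ropp.
      rewrite <- (Rinv_inv (eps / (B / k + 1))).
      apply Rinv_lt_contravar.
      - apply Rmult_lt_0_compat; [apply Rinv_0_lt_compat, hpos | apply exp_pos].
      - apply Rlt_trans with (2 := hka).
        rewrite Rinv_mult in ha.
        apply (Rmult_lt_compat_l k) in ha; [| exact hk].
        rewrite <- Rmult_assoc, Rinv_r, Rmult_1_l in ha; [exact ha | lra]. }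
    apply Rle_lt_trans with (B / k * (eps / (B / k + 1))).
    - apply Rmult_le_compat_l; lra.
    - apply Rlt_le_trans with ((B / k + 1) * (eps / (B / k + 1))).
      + apply Rmult_lt_compat_r; lra.
      + right; field; split; [lra |]. 
        intros h0; assert (hh : k * (B / k + 1) = B + k) by (field; lra). nra. }
  set (a0 := Rmax 1 (/ (k * (eps / (B / k + 1))))).
  exists (fun a => a0 < a); split.
  - exists a0; auto.
  - assert (hw : forall u v, a0 < u -> u <= v ->
              norm (minus (RInt f 0 v) (RInt f 0 u)) < eps).
    { intros u v hu huv.
      pose proof (Rmax_l 1 (/ (k * (eps / (B / k + 1))))).
      pose proof (Rmax_r 1 (/ (k * (eps / (B / k + 1))))).
      unfold a0 in hu.
      assert (hu0 : 0 <= u) by lra.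
      apply Rle_lt_trans with (1 := hcauchy u v (conj hu0 huv)).
      apply hsmall; lra. }
    intros u v hu hv.
    destruct (Rle_dec u v) as [huv | huv].
    + apply (norm_compat1 (V := V)), hw; assumption.
    + apply ball_sym, (norm_compat1 (V := V)), hw; [assumption | lra].
Qed.

Lemma half_line_integral_norm (f : R -> V) (v : V) (B k : R) :
  (forall s, continuous f s) -> 0 < k ->
  (forall s, 0 <= s -> norm (f s) <= B * exp (- k * s)) ->
  half_line_integral f v -> norm v <= B / k.
Proof.
  intros hf hk hB hv.
  apply half_line_integral_filterlim in hv; [| exact hf].
  assert (hB0 : 0 <= B).
  { specialize (hB 0 (Rle_refl 0)); rewrite Rmult_0_r, exp_0 in hB.
    pose proof (norm_ge_0 (f 0)); lra. }
  assert (hn : filterlim (fun b => norm (RInt f 0 b)) (Rbar_locally p_infty)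
                 (locally (norm v))).
  { apply filterlim_comp with (1 := hv).
    exact (filterlim_norm (V := CompleteNormedModule.NormedModule _ V) v). }
  apply (@filterlim_le R (Rbar_locally p_infty) _
           (fun b => norm (RInt f 0 b)) (fun _ => B / k) (norm v) (B / k)).
  - exists 0; intros b hb.
    apply Rle_trans with (1 := norm_RInt_exp_neg f B k 0 b hf hk
                                 (conj (Rle_refl 0) (Rlt_le _ _ hb)) hB).
    rewrite Rmult_0_r, exp_0; unfold Rdiv.
    apply Rmult_le_compat_l; [exact hB0 |].
    pose proof (exp_pos (- k * b)).
    pose proof (Rinv_0_lt_compat k hk).
    nra.
  - exact hn.
  - apply filterlim_const.
Qed.

End HalfLine.

(** * Integration preserves closed linear relations *)

Section ClosedRelation.

Variables V W : CompleteNormedModule R_AbsRing.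

(** A sequentially closed real subspace of the product. A relation, unlike a map, also covers the
    graph of a partially defined operator. *)
Definition closed_linear_relation (D : V -> W -> Prop) : Prop :=
  D zero zero /\
  (forall x y x' y', D x y -> D x' y' -> D (plus x x') (plus y y')) /\
  (forall (r : R) x y, D x y -> D (scal r x) (scal r y)) /\
  (forall (u : nat -> V) (v : nat -> W) x y,
     (forall n, D (u n) (v n)) ->
     filterlim u eventually (locally x) -> filterlim v eventually (locally y) ->
     D x y).

(** A Riemann sum is a finite linear combination of values. Starting the subdivision at a
    nonnegative point keeps its tags where the relation is known. *)
Lemma Riemann_sum_relation (D : V -> W -> Prop) (f : R -> V) (g : R -> W)
    (l : SF_seq) :
  closed_linear_relation D -> (forall s, 0 <= s -> D (f s) (g s)) ->
  pointed_subdiv l -> 0 <= SF_h l -> D (Riemann_sum f l) (Riemann_sum g l).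
Proof.
  intros (D0 & Dp & Ds & _) hD.
  apply (SF_cons_ind (fun l => pointed_subdiv l -> 0 <= SF_h l ->
           D (Riemann_sum f l) (Riemann_sum g l))).
  - intros x0 _ _; exact D0.
  - intros x0 s IH hs ha.
    rewrite !Riemann_sum_cons.
    assert (h0 := hs 0%nat (Nat.lt_0_succ _)); simpl in h0.
    change (SF_h (SF_cons x0 s)) with (fst x0) in ha.
    apply Dp.
    + apply Ds, hD; lra.
    + apply IH; [exact (ptd_cons _ _ hs) | lra].
Qed.

(** The closedness of the relation is sequential, whereas Riemann sums converge along a filter;
    uniform partitions tagged at their left ends supply a sequence. *)
Lemma unif_part_fine (b : R) : 0 <= b ->
  filterlim (fun n => SF_seq_f2 (fun x _ => x) (unif_part 0 b n))
    eventually (Riemann_fine 0 b).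
Proof.
  intros hb P [d hd].
  destruct (nfloor_ex (b / d)) as [N [_ hN]].
  { apply Rdiv_le_0_compat; [exact hb | apply cond_pos]. }
  exists N; intros n hn.
  destruct (Riemann_fine_unif_part (fun x _ => x) 0 b n) as (h1 & h2 & h3 & h4);
    [intros; lra | exact hb |].
  apply hd.
  - apply Rle_lt_trans with (1 := h1).
    apply le_INR in hn.
    pose proof (cond_pos d) as hdpos.
    pose proof (pos_INR N).
    apply (Rmult_lt_compat_r d) in hN; [| exact hdpos].
    unfold Rdiv in hN; rewrite Rmult_assoc, Rinv_l, Rmult_1_r in hN; [| lra].
    apply (Rmult_lt_reg_r (INR n + 1)); [lra |].
    unfold Rdiv; rewrite Rmult_assoc, Rinv_l by lra.
    nra.
  - rewrite Rmin_left, Rmax_right by exact hb; auto.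
Qed.

Lemma half_line_integral_relation (D : V -> W -> Prop) (f : R -> V)
    (g : R -> W) (v : V) (w : W) :
  closed_linear_relation D ->
  (forall s, continuous f s) -> (forall s, continuous g s) ->
  (forall s, 0 <= s -> D (f s) (g s)) ->
  half_line_integral V f v -> half_line_integral W g w -> D v w.
Proof.
  intros hrel hf hg hD hv hw.
  apply half_line_integral_filterlim in hv; [| exact hf].
  apply half_line_integral_filterlim in hw; [| exact hg].
  assert (hn : filterlim INR eventually (Rbar_locally p_infty))
    by exact is_lim_seq_INR.
  pose proof (filterlim_comp _ _ _ _ _ _ _ _ hn hv) as hv'.
  pose proof (filterlim_comp _ _ _ _ _ _ _ _ hn hw) as hw'.
  (* Closedness is used twice: here for the upper limit tending to infinity, below for the Riemann
     sums over a fixed segment. *)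
  refine (proj2 (proj2 (proj2 hrel)) _ _ _ _ _ hv' hw').
  intros n.
  pose proof (pos_INR n) as hn0.
  assert (hI : is_RInt f 0 (INR n) (RInt f 0 (INR n)))
    by (apply (RInt_correct (V := V)), (ex_RInt_continuous (V := V));
        intros z _; apply hf).
  assert (hJ : is_RInt g 0 (INR n) (RInt g 0 (INR n)))
    by (apply (RInt_correct (V := W)), (ex_RInt_continuous (V := W));
        intros z _; apply hg).
  pose proof (filterlim_comp _ _ _ _ _ _ _ _ (unif_part_fine _ hn0) hI) as hI'.
  pose proof (filterlim_comp _ _ _ _ _ _ _ _ (unif_part_fine _ hn0) hJ) as hJ'.
  refine (proj2 (proj2 (proj2 hrel)) _ _ _ _ _ hI' hJ').
  intros m.
  (* In [is_RInt] each Riemann sum carries the factor [sign (b - a)], which stability under scalars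
     absorbs. *)
  apply (proj1 (proj2 (proj2 hrel))).
  destruct (Riemann_fine_unif_part (fun x _ => x) 0 (INR n) m)
    as (_ & h2 & h3 & _); [intros; lra | exact hn0 |].
  apply Riemann_sum_relation; [exact hrel | exact hD | exact h2 | rewrite h3; lra].
Qed.

End ClosedRelation.

Lemma half_line_integral_by_parts (V : CompleteNormedModule R_AbsRing)
    (p p1 p2 : R -> R) (J J1 J2 : R -> V) (v w : V) :
  (forall s, is_derive p s (p1 s)) -> (forall s, is_derive p1 s (p2 s)) ->
  (forall s, continuous p2 s) ->
  (forall s, is_derive J s (J1 s)) -> (forall s, is_derive J1 s (J2 s)) ->
  (forall s, continuous J2 s) -> J 0 = zero -> J1 0 = zero ->
  filterlim (fun s => scal (p1 s) (J s)) (Rbar_locally p_infty) (locally (zero : V)) ->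
  filterlim (fun s => scal (p s) (J1 s)) (Rbar_locally p_infty) (locally (zero : V)) ->
  half_line_integral V (fun s => scal (p2 s) (J s)) v ->
  half_line_integral V (fun s => scal (p s) (J2 s)) w ->
  v = w.
Proof.
  intros hp hp1 hp2 hJ hJ1 hJ2 J0 J10 hl1 hl2 hv hw.
  assert (cJ : forall s, continuous J s)
    by (intros s; apply (ex_derive_continuous J); eexists; apply hJ).
  assert (cJ1 : forall s, continuous J1 s)
    by (intros s; apply (ex_derive_continuous J1); eexists; apply hJ1).
  assert (cp : forall s, continuous p s)
    by (intros s; apply (ex_derive_continuous p); eexists; apply hp).
  assert (cp1 : forall s, continuous p1 s)
    by (intros s; apply (ex_derive_continuous p1); eexists; apply hp1).
  assert (c1 : forall s, continuous (fun s => scal (p2 s) (J s)) s)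
    by (intros s; apply (continuous_scal p2 J); auto).
  assert (c2 : forall s, continuous (fun s => scal (p s) (J2 s)) s)
    by (intros s; apply (continuous_scal p J2); auto).
  apply half_line_integral_filterlim in hv; [| exact c1].
  apply half_line_integral_filterlim in hw; [| exact c2].
  assert (hparts : forall b, RInt (fun s => scal (p2 s) (J s)) 0 b =
     plus (minus (scal (p1 b) (J b)) (scal (p b) (J1 b)))
          (RInt (fun s => scal (p s) (J2 s)) 0 b)).
  { intros b.
    apply (is_RInt_unique (V := V)).
    assert (hI : is_RInt (fun s => scal (p s) (J2 s)) 0 b
                   (RInt (fun s => scal (p s) (J2 s)) 0 b))
      by (apply (RInt_correct (V := V)), (ex_RInt_continuous (V := V));
          intros z _; apply c2).
    (* The rule deduces the integral of the differentiated weight from the other one, so the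
       computation runs from [p J2] through [p1 J1] to [p2 J]. *)
    pose proof (is_RInt_scal_derive_l p J1 p1 J2 0 b _ (fun t _ => hp t)
      (fun t _ => hJ1 t) (fun t _ => cp1 t) (fun t _ => hJ2 t) hI) as h1.
    pose proof (is_RInt_scal_derive_l p1 J p2 J1 0 b _ (fun t _ => hp1 t)
      (fun t _ => hJ t) (fun t _ => hp2 t) (fun t _ => cJ1 t) h1) as h2.
    rewrite J0, J10 in h2.
    eapply eq_rect with (P := fun z => is_RInt _ 0 b z) (1 := h2).
    exact (boundary_terms (V := CompleteNormedModule.ModuleSpace _ V) _ _ _ _ _). }
  assert (hlim : filterlim (fun b => RInt (fun s => scal (p2 s) (J s)) 0 b)
            (Rbar_locally p_infty) (locally (plus (minus zero zero) w : V))).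
  { apply filterlim_ext with (1 := fun b => eq_sym (hparts b)).
    apply (filterlim_comp_2 (G := locally (minus zero zero : V)) (H := locally w)).
    - apply (filterlim_comp_2 (G := locally (zero : V)) (H := locally (opp zero : V))
               (fun s => scal (p1 s) (J s)) (fun s => opp (scal (p s) (J1 s))) plus).
      + exact hl1.
      + exact (filterlim_comp _ _ _ _ (@opp V) _ _ _ hl2
                 (filterlim_opp (V := CompleteNormedModule.NormedModule _ V) zero)).
      + exact (filterlim_plus (V := CompleteNormedModule.NormedModule _ V)
                 zero (opp zero)).
    - exact hw.
    - exact (filterlim_plus (V := CompleteNormedModule.NormedModule _ V) _ w). }
  assert (e : v = plus (minus zero zero) w).
  { exact (@filterlim_locally_unique _ _ (CompleteNormedModule.NormedModule _ V)
             (Rbar_locally p_infty) _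
             (fun b => RInt (fun s => scal (p2 s) (J s)) 0 b) _ _ hv hlim). }
  rewrite e; exact (plus_minus_zero (G := CompleteNormedModule.AbelianGroup _ V) w).
Qed.

(** * The complex Gaussian kernel *)

Lemma exp_le_exp (x y : R) : x <= y -> exp x <= exp y.
Proof.
  intros [h | ->]; [left; apply exp_increasing, h | right; reflexivity].
Qed.

Lemma le_exp (s : R) : 0 <= s -> s <= exp s.
Proof.
  intros [hs | <-]; [| rewrite exp_0; lra].
  pose proof (exp_ineq1 s); lra.
Qed.

Definition cexp (z : C) : C := (exp (Re z) * cos (Im z), exp (Re z) * sin (Im z)).

Lemma cexp_plus (z w : C) : cexp (z + w) = (cexp z * cexp w)%C.
Proof.
  destruct z as [x y], w as [x' y']; unfold cexp, Cplus, Cmult; simpl.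
  rewrite exp_plus, cos_plus, sin_plus; f_equal; ring.
Qed.

Lemma Cmod_cexp (z : C) : Cmod (cexp z) = exp (Re z).
Proof.
  destruct z as [x y]; unfold Cmod, cexp; simpl.
  replace (exp x * cos y * (exp x * cos y * 1) + exp x * sin y * (exp x * sin y * 1))
    with (exp x * exp x * (Rsqr (sin y) + Rsqr (cos y))) by (unfold Rsqr; ring).
  rewrite sin2_cos2, Rmult_1_r.
  apply sqrt_square, Rlt_le, exp_pos.
Qed.

Lemma cexp_RtoC (r : R) : cexp (RtoC r) = RtoC (exp r).
Proof.
  unfold cexp, RtoC; simpl; rewrite cos_0, sin_0; f_equal; ring.
Qed.

Lemma Cmod_le_Re_Im (z : C) : Cmod z <= Rabs (Re z) + Rabs (Im z).
Proof.
  destruct z as [x y]; simpl.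
  replace ((x, y) : C) with (RtoC x + RtoC y * Ci)%C
    by (unfold Ci, RtoC, Cplus, Cmult; simpl; f_equal; ring).
  apply Rle_trans with (1 := Cmod_triangle _ _).
  rewrite Cmod_mult, Cmod_Ci, !Cmod_R; lra.
Qed.

Lemma Rabs_Re_le (z : C) : Rabs (Re z) <= Cmod z.
Proof. apply re_le_Cmod. Qed.

Lemma Rabs_Im_le (z : C) : Rabs (Im z) <= Cmod z.
Proof.
  apply Rle_trans with (2 := Rmax_Cmod z).
  apply Rmax_r.
Qed.

Lemma Re_le_Cmod (z : C) : Re z <= Cmod z.
Proof. apply Rle_trans with (1 := Rle_abs _), Rabs_Re_le. Qed.

Lemma Cmod_cexp_scaled (u : C) (t : R) : 0 <= t <= 1 ->
  Cmod (cexp (RtoC t * u)) <= exp (Cmod u).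
Proof.
  intros ht; rewrite Cmod_cexp; apply exp_le_exp.
  replace (Re (RtoC t * u)) with (t * Re u)
    by (destruct u; unfold Cmult, RtoC; simpl; ring).
  pose proof (Rabs_Re_le u); pose proof (Rle_abs (Re u)).
  pose proof (Cmod_ge_0 u).
  destruct (Rle_dec 0 (Re u)); nra.
Qed.

(* The mean value theorem is applied to each component, whence the factor 2. *)
Lemma curve_increment (f f' : R -> C) (D : R) :
  (forall t, is_derive (fun t => Re (f t)) t (Re (f' t))) ->
  (forall t, is_derive (fun t => Im (f t)) t (Im (f' t))) ->
  (forall t, 0 <= t <= 1 -> Cmod (f' t) <= D) ->
  Cmod (f 1 - f 0) <= 2 * D.
Proof.
  intros hre him hD.
  assert (hmv : forall g g' : R -> R, (forall t, is_derive g t (g' t)) ->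
            (forall t, 0 <= t <= 1 -> Rabs (g' t) <= D) ->
            Rabs (g 1 - g 0) <= D).
  { intros g g' hg hg'.
    destruct (MVT_gen g 0 1 g') as [c [hc e]].
    - intros x _; apply hg.
    - intros x _; apply continuity_pt_filterlim.
      apply (ex_derive_continuous g); eexists; apply hg.
    - rewrite Rmin_left, Rmax_right in hc by lra.
      rewrite e; replace (g' c * (1 - 0)) with (g' c) by ring.
      apply hg', hc. }
  apply Rle_trans with (1 := Cmod_le_Re_Im _).
  assert (h1 := hmv _ _ hre
    (fun t ht => Rle_trans _ _ _ (Rabs_Re_le (f' t)) (hD t ht))).
  assert (h2 := hmv _ _ him
    (fun t ht => Rle_trans _ _ _ (Rabs_Im_le (f' t)) (hD t ht))).
  unfold Cminus, Cplus, Copp; simpl in *.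
  unfold Rminus in *; unfold Re, Im in *; lra.
Qed.

(** Along the segment from 0 to [u] the derivative is [u * cexp (t * u)], of modulus at most
    [Cmod u * exp (Cmod u)]. *)
Lemma cexp_lipschitz (u : C) : Cmod (cexp u - 1) <= 2 * (Cmod u * exp (Cmod u)).
Proof.
  assert (h := curve_increment (fun t => cexp (RtoC t * u))
    (fun t => (u * cexp (RtoC t * u))%C) (Cmod u * exp (Cmod u))).
  cbv beta in h; replace (RtoC 1 * u)%C with u in h by ring.
  replace (cexp (RtoC 0 * u)) with (RtoC 1) in h.
  2: { replace (RtoC 0 * u)%C with (RtoC 0) by ring.
       rewrite cexp_RtoC, exp_0; reflexivity. }
  apply h.
  - intros t; destruct u as [x y]; unfold cexp, Cmult, RtoC; simpl.
    auto_derive; [exact I |].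
    replace (t * x + - (0 * y)) with (t * x - 0 * y) by ring; ring.
  - intros t; destruct u as [x y]; unfold cexp, Cmult, RtoC; simpl.
    auto_derive; [exact I |].
    replace (t * x + - (0 * y)) with (t * x - 0 * y) by ring; ring.
  - intros t ht; rewrite Cmod_mult.
    apply Rmult_le_compat_l; [apply Cmod_ge_0 | apply Cmod_cexp_scaled, ht].
Qed.

(** The same argument once more: the remainder has derivative [u * (cexp (t * u) - 1)], bounded by
    [cexp_lipschitz]. Each use of [curve_increment] costs a factor 2. *)
Lemma cexp_taylor (u : C) :
  Cmod (cexp u - 1 - u) <= 4 * (Cmod u ^ 2 * exp (Cmod u)).
Proof.
  assert (h := curve_increment (fun t => (cexp (RtoC t * u) - 1 - RtoC t * u)%C)
    (fun t => (u * (cexp (RtoC t * u) - 1))%C) (2 * (Cmod u ^ 2 * exp (Cmod u)))).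
  cbv beta in h; replace (RtoC 1 * u)%C with u in h by ring.
  replace (cexp (RtoC 0 * u) - 1 - RtoC 0 * u)%C with (RtoC 0) in h.
  2: { replace (RtoC 0 * u)%C with (RtoC 0) by ring.
       rewrite cexp_RtoC, exp_0; ring. }
  replace (cexp u - 1 - u - RtoC 0)%C with (cexp u - 1 - u)%C in h by ring.
  replace (4 * (Cmod u ^ 2 * exp (Cmod u)))
    with (2 * (2 * (Cmod u ^ 2 * exp (Cmod u)))) by ring.
  apply h.
  - intros t; destruct u as [x y]; unfold cexp, Cmult, RtoC; simpl.
    auto_derive; [exact I |].
    replace (t * x + - (0 * y)) with (t * x - 0 * y) by ring; ring.
  - intros t; destruct u as [x y]; unfold cexp, Cmult, RtoC; simpl.
    auto_derive; [exact I |].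
    replace (t * x + - (0 * y)) with (t * x - 0 * y) by ring; ring.
  - intros t ht; rewrite Cmod_mult.
    pose proof (cexp_lipschitz (RtoC t * u)) as hl.
    assert (e : Cmod (RtoC t * u) = t * Cmod u)
      by (rewrite Cmod_mult, Cmod_R, Rabs_pos_eq; lra).
    rewrite e in hl.
    pose proof (Cmod_ge_0 u) as h0.
    assert (hx : exp (t * Cmod u) <= exp (Cmod u)) by (apply exp_le_exp; nra).
    pose proof (exp_pos (t * Cmod u)).
    assert (h2 : t * Cmod u * exp (t * Cmod u) <= Cmod u * exp (Cmod u)).
    { apply Rmult_le_compat; nra. }
    replace (2 * (Cmod u ^ 2 * exp (Cmod u)))
      with (Cmod u * (2 * (Cmod u * exp (Cmod u)))) by ring.
    apply Rmult_le_compat_l; lra.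
Qed.

(** The principal square root on the right half-plane, in Cartesian form by the half-angle formula,
    so that no argument function is involved. *)
Definition csqrt (z : C) : C :=
  (sqrt ((Cmod z + Re z) / 2), Im z / (2 * sqrt ((Cmod z + Re z) / 2))).

Lemma Re_csqrt_pos (z : C) : 0 < Re z -> 0 < Re (csqrt z).
Proof.
  intros hz; unfold csqrt; simpl; apply sqrt_lt_R0.
  pose proof (Cmod_ge_0 z); lra.
Qed.

Lemma Cmod_sqr (z : C) : Cmod z ^ 2 = Re z ^ 2 + Im z ^ 2.
Proof. apply Cmod2_alt. Qed.

Lemma csqrt_sqr (z : C) : 0 < Re z -> (csqrt z * csqrt z)%C = z.
Proof.
  intros hz.
  pose proof (Cmod_ge_0 z) as h0.
  assert (hm : 0 < (Cmod z + Re z) / 2) by lra.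
  pose proof (sqrt_lt_R0 _ hm) as hs.
  pose proof (sqrt_sqrt _ (Rlt_le _ _ hm)) as e.
  pose proof (Cmod_sqr z) as e2.
  unfold csqrt, Cmult.
  set (m := sqrt ((Cmod z + Re z) / 2)) in *.
  transitivity (Re z, Im z); [| symmetry; apply surjective_pairing].
  simpl; f_equal; [| field; lra].
  apply (Rmult_eq_reg_r (4 * (m * m))); [| nra].
  replace ((m * m - Im z / (2 * m) * (Im z / (2 * m))) * (4 * (m * m)))
    with (4 * (m * m) * (m * m) - Im z ^ 2) by (field; lra).
  rewrite e; nra.
Qed.

Lemma Cmod_csqrt (z : C) : 0 < Re z -> Cmod (csqrt z) = sqrt (Cmod z).
Proof.
  intros hz.
  rewrite <- (csqrt_sqr z hz) at 2.
  rewrite Cmod_mult, sqrt_square; [reflexivity | apply Cmod_ge_0].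
Qed.

Lemma csqrt_RtoC (t : R) : 0 < t -> csqrt (RtoC t) = RtoC (sqrt t).
Proof.
  intros ht; unfold csqrt; rewrite Cmod_R, Rabs_pos_eq by lra; simpl.
  replace ((t + t) / 2) with t by field.
  unfold RtoC; f_equal; unfold Rdiv; ring.
Qed.

Lemma Re_pos_neq_0 (z : C) : 0 < Re z -> z <> 0.
Proof. intros hz e; rewrite e in hz; simpl in hz; lra. Qed.

(** First and second order estimates of [z^(-1/2)], whose derivative is [- z^(-1/2) / (2 z)]. With
    [p] and [q] the roots of [z] and [w], the factorization [w - z = (q - p) (q + p)] turns both
    differences into explicit fractions. Their denominators stay away from 0 because [q] has
    positive real part, whence [|p + q| >= Re p], and [|q| >= |p| / 2]. *)
Lemma inv_csqrt_diff (z : C) : 0 < Re z ->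
  exists D, 0 <= D /\ forall w, Cmod (w - z) <= Cmod z / 2 -> 0 < Re w ->
    Cmod (/ csqrt w - / csqrt z) <= D * Cmod (w - z) /\
    Cmod (/ csqrt w - / csqrt z + (w - z) * (/ csqrt z / (2 * z)))
      <= D * Cmod (w - z) ^ 2.
Proof.
  intros hz.
  pose proof (Re_csqrt_pos z hz) as hp.
  set (p := csqrt z) in *; set (m := Re p) in *.
  assert (hpz : (p * p)%C = z) by (apply csqrt_sqr, hz).
  assert (hp0 : p <> 0) by (apply Re_pos_neq_0, hp).
  assert (hpp : 0 < Cmod p) by (apply Cmod_gt_0, hp0).
  set (P := Cmod p) in *.
  (* The first summand serves the first order estimate, the second one the second order estimate. *)
  exists (/ (m * P * (P / 2)) + 4 * P / (2 * P ^ 3 * m ^ 2 * (P / 2))).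
  assert (hD1 : 0 <= / (m * P * (P / 2)))
    by (apply Rlt_le, Rinv_0_lt_compat; repeat apply Rmult_lt_0_compat; lra).
  assert (hD2 : 0 <= 4 * P / (2 * P ^ 3 * m ^ 2 * (P / 2))).
  { apply Rlt_le, Rdiv_lt_0_compat; [lra |].
    repeat apply Rmult_lt_0_compat; try lra. }
  split; [lra |].
  intros w hw hw0.
  pose proof (Re_csqrt_pos w hw0) as hq.
  assert (hqw : (csqrt w * csqrt w)%C = w) by (apply csqrt_sqr, hw0).
  set (q := csqrt w) in *.
  assert (hq0 : q <> 0) by (apply Re_pos_neq_0, hq).
  assert (hpq0 : (p + q)%C <> 0)
    by (apply Re_pos_neq_0; destruct p, q; unfold m in *; simpl in *; lra).
  assert (hzP : Cmod z = P * P) by (rewrite <- hpz; apply Cmod_mult).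
  assert (hwQ : Cmod w = Cmod q * Cmod q) by (rewrite <- hqw; apply Cmod_mult).
  set (Q := Cmod q) in *.
  assert (hQ : 0 <= Q) by apply Cmod_ge_0.
  assert (t1 : Cmod z <= Cmod w + Cmod (w - z)).
  { replace z with (w - (w - z))%C at 1 by ring.
    unfold Cminus at 1; apply Rle_trans with (1 := Cmod_triangle _ _).
    rewrite Cmod_opp; lra. }
  assert (t2 : Cmod w <= Cmod z + Cmod (w - z)).
  { replace w with (z + (w - z))%C at 1 by ring; apply Cmod_triangle. }
  assert (hQl : P / 2 <= Q) by nra.
  assert (hQu : Q <= 2 * P) by nra.
  assert (hS : m <= Cmod (p + q)).
  { apply Rle_trans with (2 := Re_le_Cmod _).
    unfold m; destruct p, q; simpl in *; lra. }
  assert (h2pq : Cmod (2 * p + q) <= 4 * P).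
  { apply Rle_trans with (1 := Cmod_triangle _ _).
    rewrite Cmod_mult.
    rewrite Cmod_R, Rabs_pos_eq by lra.
    fold P Q; lra. }
  assert (hd : (w - z)%C = ((q - p) * (q + p))%C).
  { rewrite <- hpz, <- hqw; ring. }
  set (S := Cmod (p + q)) in *.
  set (d := Cmod (w - z)) in *.
  assert (hd0 : 0 <= d) by apply Cmod_ge_0.
  assert (e1 : (/ q - / p)%C = (- ((w - z) / ((p + q) * p * q)))%C).
  { rewrite hd; field; repeat split; assumption. }
  assert (e2 : (/ q - / p + (w - z) * (/ p / (2 * z)))%C
     = ((w - z) * (w - z) * (2 * p + q) / (2 * (p * p * p) * ((p + q) * (p + q)) * q))%C).
  { rewrite <- hpz at 2; rewrite hd; field; repeat split; assumption. }
  assert (hSpos : 0 < S) by lra.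
  split.
  - rewrite e1, Cmod_opp, Cmod_div, !Cmod_mult
      by (repeat apply Cmult_neq_0; assumption).
    fold P Q S d.
    apply Rle_trans with (/ (m * P * (P / 2)) * d).
    + unfold Rdiv at 1; rewrite Rmult_comm.
      apply Rmult_le_compat_r; [exact hd0 |].
      apply Rinv_le_contravar.
      * repeat apply Rmult_lt_0_compat; lra.
      * apply Rmult_le_compat; try nra.
    + nra.
  - rewrite e2, Cmod_div, !Cmod_mult.
    2: { repeat apply Cmult_neq_0; try assumption.
         intros h; apply (f_equal Re) in h; simpl in h; lra. }
    rewrite Cmod_R, Rabs_pos_eq by lra.
    fold P Q S d.
    apply Rle_trans with (4 * P / (2 * P ^ 3 * m ^ 2 * (P / 2)) * d ^ 2).
    + replace (4 * P / (2 * P ^ 3 * m ^ 2 * (P / 2)) * d ^ 2)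
        with (d * d * (4 * P) * / (2 * P ^ 3 * m ^ 2 * (P / 2)))
        by (unfold Rdiv; ring).
      unfold Rdiv at 1.
      apply Rmult_le_compat.
      * repeat apply Rmult_le_pos; try lra; apply Cmod_ge_0.
      * apply Rlt_le, Rinv_0_lt_compat; repeat apply Rmult_lt_0_compat; lra.
      * apply Rmult_le_compat_l; nra.
      * apply Rinv_le_contravar.
        -- repeat apply Rmult_lt_0_compat; try lra.
        -- apply Rmult_le_compat; try nra.
           ++ repeat apply Rmult_le_pos; lra.
           ++ replace (2 * P ^ 3) with (2 * (P * P * P)) by ring.
              apply Rmult_le_compat_l.
              ** repeat apply Rmult_le_pos; lra.
              ** nra.
    + assert (0 <= d ^ 2) by nra. nra.
Qed.

(** The rate [a] for which [e^(-s^2/(4z))] has modulus [e^(-a s^2)]. *)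
Definition decay_rate (z : C) : R := Re z / (4 * Cmod z ^ 2).

Lemma decay_rate_eq (z : C) : 0 < Re z -> decay_rate z = Re (/ (4 * z)).
Proof.
  intros hz; unfold decay_rate; rewrite Cmod_sqr.
  destruct z as [x y]; unfold Cinv, Cmult, RtoC in *; simpl in *.
  assert (0 < x * x) by nra; assert (0 <= y * y) by nra.
  field; split; nra.
Qed.

Lemma decay_rate_pos (z : C) : 0 < Re z -> 0 < decay_rate z.
Proof.
  intros hz; apply Rdiv_lt_0_compat; [exact hz |].
  pose proof (proj1 (Cmod_gt_0 z) (Re_pos_neq_0 z hz)); nra.
Qed.

Definition gauss (z : C) (s : R) : C :=
  (RtoC (/ sqrt PI) * / csqrt z * cexp (RtoC (- s ^ 2) * / (4 * z)))%C.

(* The derivative of [gauss z s] in [z]. *)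
Definition dgauss (z : C) (s : R) : C :=
  (gauss z s * (RtoC (s ^ 2) / (4 * (z * z)) - 1 / (2 * z)))%C.

Lemma Cmod_gauss (z : C) (s : R) : 0 < Re z ->
  Cmod (gauss z s)
  = / sqrt PI * / sqrt (Cmod z) * exp (- decay_rate z * s ^ 2).
Proof.
  intros hz.
  assert (hp : csqrt z <> 0) by (apply Re_pos_neq_0, Re_csqrt_pos, hz).
  pose proof (sqrt_lt_R0 _ PI_RGT_0) as hpi.
  unfold gauss; rewrite !Cmod_mult, Cmod_inv, Cmod_csqrt, Cmod_R, Cmod_cexp by assumption.
  rewrite Rabs_pos_eq by (apply Rlt_le, Rinv_0_lt_compat, hpi).
  do 2 f_equal; rewrite decay_rate_eq by exact hz.
  destruct (/ (4 * z))%C; unfold Cmult, RtoC; simpl; ring.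
Qed.

(** Half of the Gaussian exponent absorbs the polynomial and the other half beats the exponential.
    Degree four is what the second order remainder in [gauss_taylor] requires, as it contains
    [s^4]. *)
Lemma gauss_poly_decay (a l : R) : 0 < a ->
  exists B, 0 <= B /\ forall s, 0 <= s ->
    (1 + s ^ 2) ^ 2 * exp (- a * s ^ 2) <= B * exp (- l * s).
Proof.
  intros ha.
  (* The bound [1 + s^2 <= (1 + / m) * exp (m * s^2)] gets squared, so [a / 4] spends exactly half
     of the exponent [a]. *)
  set (m := a / 4).
  assert (hm : 0 < m) by (unfold m; lra).
  exists ((1 + / m) ^ 2 * exp (l ^ 2 / (2 * a))).
  split.
  { apply Rmult_le_pos; [apply pow2_ge_0 | apply Rlt_le, exp_pos]. }
  intros s hs.
  assert (h1 : 1 + s ^ 2 <= (1 + / m) * exp (m * s ^ 2)).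
  { assert (h0 : 0 <= m * s ^ 2) by (apply Rmult_le_pos; [lra | apply pow2_ge_0]).
    assert (h2 : 1 + m * s ^ 2 <= exp (m * s ^ 2)).
    { destruct (Req_dec (m * s ^ 2) 0) as [-> | hn].
      - rewrite exp_0; lra.
      - left; apply exp_ineq1; exact hn. }
    assert (h3 : s ^ 2 = / m * (m * s ^ 2)) by (field; lra).
    pose proof (Rinv_0_lt_compat m hm).
    rewrite h3 at 1.
    assert (/ m * (m * s ^ 2) <= / m * exp (m * s ^ 2))
      by (apply Rmult_le_compat_l; lra).
    lra. }
  assert (h2 : (1 + s ^ 2) ^ 2 <= ((1 + / m) * exp (m * s ^ 2)) ^ 2).
  { apply pow_incr; split; [nra | exact h1]. }
  apply Rle_trans with (((1 + / m) * exp (m * s ^ 2)) ^ 2 * exp (- a * s ^ 2)).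
  { apply Rmult_le_compat_r; [apply Rlt_le, exp_pos | exact h2]. }
  rewrite Rpow_mult_distr, !Rmult_assoc.
  apply Rmult_le_compat_l; [apply pow2_ge_0 |].
  replace (exp (m * s ^ 2) ^ 2) with (exp (m * s ^ 2) * exp (m * s ^ 2)) by ring.
  rewrite <- !exp_plus.
  apply exp_le_exp.
  (* Completing the square: [-a s^2/2 + l s <= l^2 / (2 a)]. *)
  assert (h : 0 <= (a * s - l) ^ 2 / (2 * a)).
  { apply Rdiv_le_0_compat; [apply pow2_ge_0 | lra]. }
  replace ((a * s - l) ^ 2 / (2 * a)) with (a * s ^ 2 / 2 - l * s + l ^ 2 / (2 * a))
    in h by (field; lra).
  unfold m; nra.
Qed.

(** Decay against every exponential rate, so that one kernel can be integrated against exponentially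
    bounded functions of any type. *)
Definition rapidly_decreasing (k : R -> C) : Prop :=
  forall l, exists B, 0 <= B /\
    forall s, 0 <= s -> Cmod (k s) <= B * exp (- l * s).

Lemma rapidly_decreasing_gauss_poly (k : R -> C) (a B : R) : 0 < a -> 0 <= B ->
  (forall s, 0 <= s -> Cmod (k s) <= B * ((1 + s ^ 2) ^ 2 * exp (- a * s ^ 2))) ->
  rapidly_decreasing k.
Proof.
  intros ha hB hk l.
  destruct (gauss_poly_decay a l ha) as [B' [hB' h]].
  exists (B * B'); split; [apply Rmult_le_pos; assumption |].
  intros s hs; apply Rle_trans with (1 := hk s hs).
  rewrite Rmult_assoc; apply Rmult_le_compat_l; auto.
Qed.

Lemma gauss_rapidly_decreasing (z : C) : 0 < Re z -> rapidly_decreasing (gauss z).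
Proof.
  intros hz.
  assert (hc : 0 <= / sqrt PI * / sqrt (Cmod z)).
  { apply Rmult_le_pos; apply Rlt_le, Rinv_0_lt_compat, sqrt_lt_R0;
      [apply PI_RGT_0 | apply Cmod_gt_0, Re_pos_neq_0, hz]. }
  apply (rapidly_decreasing_gauss_poly _ (decay_rate z) _ (decay_rate_pos z hz) hc).
  intros s _; rewrite Cmod_gauss by exact hz.
  apply Rmult_le_compat_l; [exact hc |].
  pose proof (exp_pos (- decay_rate z * s ^ 2)).
  assert (1 <= (1 + s ^ 2) ^ 2) by nra.
  nra.
Qed.

Lemma dgauss_rapidly_decreasing (z : C) : 0 < Re z -> rapidly_decreasing (dgauss z).
Proof.
  intros hz.
  assert (hc : 0 <= / sqrt PI * / sqrt (Cmod z)).
  { apply Rmult_le_pos; apply Rlt_le, Rinv_0_lt_compat, sqrt_lt_R0;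
      [apply PI_RGT_0 | apply Cmod_gt_0, Re_pos_neq_0, hz]. }
  set (b := Cmod (/ (4 * (z * z))) + Cmod (1 / (2 * z))).
  assert (h1 := Cmod_ge_0 (/ (4 * (z * z)))); assert (h2 := Cmod_ge_0 (1 / (2 * z))).
  apply (rapidly_decreasing_gauss_poly _ (decay_rate z)
           (/ sqrt PI * / sqrt (Cmod z) * b) (decay_rate_pos z hz)).
  { apply Rmult_le_pos; unfold b; lra. }
  intros s _; unfold dgauss; rewrite Cmod_mult, Cmod_gauss by exact hz.
  pose proof (exp_pos (- decay_rate z * s ^ 2)).
  rewrite (Rmult_assoc (/ sqrt PI * / sqrt (Cmod z))),
    (Rmult_assoc (/ sqrt PI * / sqrt (Cmod z))).
  apply Rmult_le_compat_l; [exact hc |].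
  rewrite Rmult_comm, <- Rmult_assoc.
  apply Rmult_le_compat_r; [lra |].
  unfold Cminus; apply Rle_trans with (1 := Cmod_triangle _ _).
  unfold Cdiv at 1; rewrite Cmod_opp, Cmod_mult, Cmod_R, Rabs_pos_eq
    by apply pow2_ge_0.
  assert (0 <= s ^ 2) by apply pow2_ge_0.
  assert (0 <= (1 + s ^ 2) ^ 2 - s ^ 2) by nra.
  assert (0 <= (1 + s ^ 2) ^ 2 - 1) by nra.
  unfold b; nra.
Qed.

(** Neither [D] nor [r] depends on [s], so the pointwise remainder can be integrated and stays
    quadratic in [w - z]. *)
Lemma gauss_taylor (z : C) (l : R) : 0 < Re z ->
  exists D r, 0 <= D /\ 0 < r /\ forall w, Cmod (w - z) < r ->
    0 < Re w /\
    forall s, 0 <= s ->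
      Cmod (gauss w s - gauss z s - (w - z) * dgauss z s)
        <= D * Cmod (w - z) ^ 2 * exp (- l * s).
Proof.
  intros hz.
  set (a := decay_rate z).
  assert (ha : 0 < a) by (apply decay_rate_pos, hz).
  destruct (inv_csqrt_diff z hz) as [D1 [hD1 hD]].
  destruct (gauss_poly_decay (a / 2) l) as [B [hB hpoly]]; [lra |].
  assert (hz0 : z <> 0) by (apply Re_pos_neq_0, hz).
  assert (hZ : 0 < Cmod z) by (apply Cmod_gt_0, hz0).
  set (Z := Cmod z) in *.
  set (H := Cmod (/ csqrt z)).
  assert (hH : 0 <= H) by apply Cmod_ge_0.
  assert (hpi : 0 < / sqrt PI)
    by (apply Rinv_0_lt_compat, sqrt_lt_R0, PI_RGT_0).
  set (k := / (2 * Z ^ 2)).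
  assert (hk : 0 < k) by (apply Rinv_0_lt_compat; nra).
  set (k' := / (2 * Z ^ 3)).
  assert (hk' : 0 < k') by (apply Rinv_0_lt_compat; pose proof (pow_lt Z 3 hZ); lra).
  set (H' := H + D1 * (Z / 2)).
  assert (hH' : 0 <= H') by (unfold H'; nra).
  exists (/ sqrt PI * (H' * 4 * k ^ 2 + D1 + D1 * k + H * k') * B).
  (* The three radii keep [w] in the half-plane, keep [|w| >= Z / 2], and keep the exponent [u]
     below [a / 2 * s^2], so that [exp (Cmod u)] uses only half of the Gaussian decay. *)
  exists (Rmin (Re z / 2) (Rmin (Z / 2) (a * Z ^ 2))).
  assert (hc : 0 <= H' * 4 * k ^ 2 + D1 + D1 * k + H * k').
  { assert (0 <= H' * 4 * k ^ 2) by (apply Rmult_le_pos; [lra | apply pow2_ge_0]).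
    assert (0 <= D1 * k) by nra. assert (0 <= H * k') by nra. lra. }
  split; [repeat apply Rmult_le_pos; lra |].
  split.
  { repeat apply Rmin_pos; try lra. apply Rmult_lt_0_compat; nra. }
  intros w hw.
  pose proof (Rmin_l (Re z / 2) (Rmin (Z / 2) (a * Z ^ 2))) as m1.
  pose proof (Rmin_r (Re z / 2) (Rmin (Z / 2) (a * Z ^ 2))) as m2.
  pose proof (Rmin_l (Z / 2) (a * Z ^ 2)) as m3.
  pose proof (Rmin_r (Z / 2) (a * Z ^ 2)) as m4.
  set (d := Cmod (w - z)) in *.
  assert (hd0 : 0 <= d) by apply Cmod_ge_0.
  assert (hw0 : 0 < Re w).
  { pose proof (Rabs_Re_le (w - z)) as h; fold d in h.
    assert (e : Re (w - z) = Re w - Re z)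
      by (destruct w, z; unfold Cminus, Cplus, Copp; simpl; ring).
    rewrite e in h; apply Rabs_le_between in h; lra. }
  split; [exact hw0 |].
  assert (hwn : w <> 0) by (apply Re_pos_neq_0, hw0).
  destruct (hD w) as [b1 b2]; [fold d Z; lra | exact hw0 |].
  fold d in b1, b2.
  assert (hWl : Z / 2 <= Cmod w).
  { assert (t1 : Z <= Cmod w + d).
    { unfold Z; replace z with (w - (w - z))%C at 1 by ring.
      unfold Cminus at 1; apply Rle_trans with (1 := Cmod_triangle _ _).
      rewrite Cmod_opp; fold d; lra. }
    lra. }
  intros s hs.
  assert (hs2 : 0 <= s ^ 2) by apply pow2_ge_0.
  (* The exponent at [w] is the exponent at [z] plus [u]. *)
  set (u := (RtoC (s ^ 2) * ((w - z) / (4 * w * z)))%C).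
  set (e := cexp (RtoC (- s ^ 2) * / (4 * z))).
  assert (ee : cexp (RtoC (- s ^ 2) * / (4 * w)) = (e * cexp u)%C).
  { unfold e; rewrite <- cexp_plus; f_equal; unfold u.
    rewrite RtoC_opp; field; split; assumption. }
  assert (he : Cmod e = exp (- a * s ^ 2)).
  { unfold e, a; rewrite Cmod_cexp, decay_rate_eq by exact hz; f_equal.
    destruct (/ (4 * z))%C; unfold Cmult, RtoC; simpl; ring. }
  set (hwz := (/ csqrt w - / csqrt z)%C) in *.
  (* The four terms are the Taylor remainder of the exponential, that of the inverse root, the
     product of the two first order variations, and the error of replacing [u] by its linear part.
     Each is quadratic in [w - z]. *)
  assert (dec : (gauss w s - gauss z s - (w - z) * dgauss z s)%C =
    (RtoC (/ sqrt PI) * e * (/ csqrt w * (cexp u - 1 - u)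
       + (hwz + (w - z) * (/ csqrt z / (2 * z)))
       + hwz * u
       + / csqrt z * (u - (w - z) * (RtoC (s ^ 2) / (4 * (z * z))))))%C).
  { unfold dgauss, gauss; rewrite ee; fold e; unfold hwz; field.
    repeat split; try assumption; apply Re_pos_neq_0, Re_csqrt_pos; assumption. }
  assert (hu : Cmod u <= k * d * s ^ 2).
  { unfold u; rewrite Cmod_mult, Cmod_div, !Cmod_mult, !Cmod_R, !Rabs_pos_eq
      by (try lra; repeat apply Cmult_neq_0; try assumption;
          intros h; apply (f_equal Re) in h; simpl in h; lra).
    fold Z d.
    rewrite Rmult_comm; apply Rmult_le_compat_r; [exact hs2 |].
    unfold Rdiv; rewrite (Rmult_comm k); apply Rmult_le_compat_l; [exact hd0 |].
    apply Rinv_le_contravar; nra. }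
  assert (hu2 : Cmod (u - (w - z) * (RtoC (s ^ 2) / (4 * (z * z))))
                <= k' * d ^ 2 * s ^ 2).
  { replace (u - (w - z) * (RtoC (s ^ 2) / (4 * (z * z))))%C
      with (- (RtoC (s ^ 2) * ((w - z) * (w - z)) / (4 * (z * z) * w)))%C
      by (unfold u; field; split; assumption).
    rewrite Cmod_opp, Cmod_div, !Cmod_mult, !Cmod_R, !Rabs_pos_eq
      by (try lra; repeat apply Cmult_neq_0; try assumption;
          intros h; apply (f_equal Re) in h; simpl in h; lra).
    fold Z d.
    replace (k' * d ^ 2 * s ^ 2) with (s ^ 2 * (d * d) * k') by ring.
    unfold Rdiv; apply Rmult_le_compat_l; [apply Rmult_le_pos; nra |].
    assert (0 < Z * Z) by nra.
    apply Rinv_le_contravar; [pose proof (pow_lt Z 3 hZ); lra |].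
    replace (2 * Z ^ 3) with (4 * (Z * Z) * (Z / 2)) by field.
    apply Rmult_le_compat_l; lra. }
  assert (hu3 : Cmod u <= a / 2 * s ^ 2).
  { apply Rle_trans with (1 := hu); apply Rmult_le_compat_r; [exact hs2 |].
    apply Rle_trans with (k * (a * Z ^ 2)).
    - apply Rmult_le_compat_l; lra.
    - right; unfold k; field; lra. }
  assert (hhw : Cmod (/ csqrt w) <= H').
  { replace (/ csqrt w)%C with (/ csqrt z + hwz)%C by (unfold hwz; ring).
    apply Rle_trans with (1 := Cmod_triangle _ _).
    unfold H'; fold H.
    assert (D1 * d <= D1 * (Z / 2)) by (apply Rmult_le_compat_l; lra).
    lra. }
  set (x := exp (a / 2 * s ^ 2)).
  assert (hx1 : 1 <= x).
  { unfold x; rewrite <- exp_0; apply exp_le_exp.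
    apply Rmult_le_pos; lra. }
  assert (ht : Cmod (cexp u - 1 - u) <= 4 * (k ^ 2 * d ^ 2 * (s ^ 2) ^ 2 * x)).
  { apply Rle_trans with (1 := cexp_taylor u).
    apply Rmult_le_compat_l; [lra |].
    pose proof (Cmod_ge_0 u).
    apply Rmult_le_compat; [apply pow2_ge_0 | apply Rlt_le, exp_pos | |].
    - replace (k ^ 2 * d ^ 2 * (s ^ 2) ^ 2) with ((k * d * s ^ 2) ^ 2) by ring.
      apply pow_incr; lra.
    - apply exp_le_exp, hu3. }
  rewrite dec, !Cmod_mult, Cmod_R, Rabs_pos_eq, he by lra.
  set (q := (1 + s ^ 2) ^ 2).
  assert (hq1 : 1 <= q) by (unfold q; nra).
  assert (hq2 : s ^ 2 <= q) by (unfold q; nra).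
  assert (hq3 : (s ^ 2) ^ 2 <= q) by (unfold q; nra).
  assert (hd2 : 0 <= d ^ 2) by apply pow2_ge_0.
  assert (hbig : Cmod (/ csqrt w * (cexp u - 1 - u)
       + (hwz + (w - z) * (/ csqrt z / (2 * z)))
       + hwz * u
       + / csqrt z * (u - (w - z) * (RtoC (s ^ 2) / (4 * (z * z)))))
     <= (H' * 4 * k ^ 2 + D1 + D1 * k + H * k') * (d ^ 2 * (q * x))).
  { assert (hqx1 : q <= q * x) by nra.
    assert (c1 : Cmod (/ csqrt w * (cexp u - 1 - u))
                 <= H' * 4 * k ^ 2 * (d ^ 2 * (q * x))).
    { rewrite Cmod_mult.
      apply Rle_trans with (H' * (4 * (k ^ 2 * d ^ 2 * (s ^ 2) ^ 2 * x))).
      - apply Rmult_le_compat; try assumption; apply Cmod_ge_0.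
      - replace (H' * 4 * k ^ 2 * (d ^ 2 * (q * x)))
          with (H' * (4 * (k ^ 2 * d ^ 2 * q * x))) by ring.
        apply Rmult_le_compat_l; [exact hH' |].
        apply Rmult_le_compat_l; [lra |].
        apply Rmult_le_compat_r; [lra |].
        apply Rmult_le_compat_l; [| exact hq3].
        apply Rmult_le_pos; [apply pow2_ge_0 | exact hd2]. }
    assert (c2 : Cmod (hwz + (w - z) * (/ csqrt z / (2 * z)))
                 <= D1 * (d ^ 2 * (q * x))).
    { apply Rle_trans with (1 := b2).
      apply Rmult_le_compat_l; [exact hD1 |].
      rewrite <- (Rmult_1_r (d ^ 2)) at 1.
      apply Rmult_le_compat_l; lra. }
    assert (c3 : Cmod (hwz * u) <= D1 * k * (d ^ 2 * (q * x))).
    { rewrite Cmod_mult.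
      apply Rle_trans with (D1 * d * (k * d * s ^ 2)).
      - apply Rmult_le_compat; try assumption; apply Cmod_ge_0.
      - replace (D1 * d * (k * d * s ^ 2)) with (D1 * k * (d ^ 2 * s ^ 2)) by ring.
        apply Rmult_le_compat_l; [nra |].
        apply Rmult_le_compat_l; lra. }
    assert (c4 : Cmod (/ csqrt z * (u - (w - z) * (RtoC (s ^ 2) / (4 * (z * z)))))
                 <= H * k' * (d ^ 2 * (q * x))).
    { rewrite Cmod_mult; fold H.
      apply Rle_trans with (H * (k' * d ^ 2 * s ^ 2)).
      - apply Rmult_le_compat_l; assumption.
      - replace (H * (k' * d ^ 2 * s ^ 2)) with (H * k' * (d ^ 2 * s ^ 2)) by ring.
        apply Rmult_le_compat_l; [nra |].
        apply Rmult_le_compat_l; lra. }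
    apply Rle_trans with (1 := Cmod_triangle _ _).
    pose proof (Cmod_triangle (/ csqrt w * (cexp u - 1 - u)
       + (hwz + (w - z) * (/ csqrt z / (2 * z)))) (hwz * u)).
    pose proof (Cmod_triangle (/ csqrt w * (cexp u - 1 - u))
       (hwz + (w - z) * (/ csqrt z / (2 * z)))).
    lra. }
  pose proof (exp_pos (- a * s ^ 2)) as hexp.
  apply Rle_trans with (/ sqrt PI * exp (- a * s ^ 2) *
    ((H' * 4 * k ^ 2 + D1 + D1 * k + H * k') * (d ^ 2 * (q * x)))).
  { apply Rmult_le_compat_l; [apply Rmult_le_pos; lra | exact hbig]. }
  assert (hex : exp (- a * s ^ 2) * x = exp (- (a / 2) * s ^ 2)).
  { unfold x; rewrite <- exp_plus; f_equal; field. }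
  replace (/ sqrt PI * exp (- a * s ^ 2) *
    ((H' * 4 * k ^ 2 + D1 + D1 * k + H * k') * (d ^ 2 * (q * x))))
    with (/ sqrt PI * (H' * 4 * k ^ 2 + D1 + D1 * k + H * k') * d ^ 2 *
          (q * (exp (- a * s ^ 2) * x))) by ring.
  rewrite hex.
  replace (/ sqrt PI * (H' * 4 * k ^ 2 + D1 + D1 * k + H * k') * B * d ^ 2 * exp (- l * s))
    with (/ sqrt PI * (H' * 4 * k ^ 2 + D1 + D1 * k + H * k') * d ^ 2 *
          (B * exp (- l * s))) by ring.
  apply Rmult_le_compat_l.
  { repeat apply Rmult_le_pos; lra. }
  apply hpoly, hs.
Qed.

(** * Gauss transforms of vector-valued functions *)

Definition continuous_components (k : R -> C) : Prop :=
  (forall s, continuous (fun s => Re (k s)) s) /\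
  (forall s, continuous (fun s => Im (k s)) s).

(** Two uniform structures live on the complex numbers, the product one and that of the modulus.
    Componentwise continuity is what real calculus proves; continuity of [scal] asks for the
    modulus. *)
Lemma continuous_components_AbsRing (k : R -> C) (s : R) :
  continuous_components k ->
  @continuous R_UniformSpace (AbsRing_UniformSpace C_AbsRing) k s.
Proof.
  intros [hre him].
  apply (filterlim_locally (U := AbsRing_UniformSpace C_AbsRing)); intros eps.
  pose proof (proj1 (filterlim_locally _ _) (hre s) (pos_div_2 eps)) as h1.
  pose proof (proj1 (filterlim_locally _ _) (him s) (pos_div_2 eps)) as h2.
  apply filter_imp with (2 := filter_and _ _ h1 h2).
  intros t [b1 b2].
  change (Cmod (k t - k s) < eps).
  apply Rle_lt_trans with (1 := Cmod_le_Re_Im _).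
  change (Rabs (Re (k t) - Re (k s)) < eps / 2) in b1.
  change (Rabs (Im (k t) - Im (k s)) < eps / 2) in b2.
  destruct (k t), (k s); unfold Cminus, Cplus, Copp; simpl in *.
  unfold Rminus in *; lra.
Qed.

Lemma continuous_components_const_cexp (b d : C) :
  continuous_components (fun s => b * cexp (RtoC (- s ^ 2) * d))%C.
Proof.
  split; intros s; destruct b, d; unfold cexp, Cmult, RtoC; simpl;
    apply (ex_derive_continuous (V := R_NormedModule)); auto_derive; exact I.
Qed.

Lemma gauss_continuous (z : C) : continuous_components (gauss z).
Proof. apply continuous_components_const_cexp. Qed.

Lemma continuous_components_mult (k k' : R -> C) :
  continuous_components k -> continuous_components k' ->
  continuous_components (fun s => k s * k' s)%C.
Proof.
  intros [h1 h2] [h1' h2']; split; intros s; unfold Cmult; simpl.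
  - apply (continuous_minus (V := R_NormedModule));
      apply (continuous_mult (K := R_AbsRing)); auto.
  - apply (continuous_plus (V := R_NormedModule));
      apply (continuous_mult (K := R_AbsRing)); auto.
Qed.

Lemma dgauss_continuous (z : C) : continuous_components (dgauss z).
Proof.
  apply continuous_components_mult; [apply gauss_continuous |].
  unfold Cdiv.
  split; intros s; destruct (/ (4 * (z * z)))%C, (1 * / (2 * z))%C;
    unfold Cminus, Cplus, Copp, Cmult, RtoC; simpl;
    apply (ex_derive_continuous (V := R_NormedModule)); auto_derive; exact I.
Qed.

Section Transform.

Variable E : CompleteNormedModule C_AbsRing.

Let ER := real_CompleteNormedModule E.

Definition transform (k : R -> C) (c : R -> E) : E :=
  @RInt_gen ER (fun s => scal (k s) (c s)) (at_point 0) (Rbar_locally p_infty).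

(** [N] and [w] are explicit because later bounds use their exact dependence on them: linear in [N],
    and with [w] adapted to the point [z]. *)
Definition exp_growth (c : R -> E) (N w : R) : Prop :=
  (forall s, continuous c s) /\ (forall s, 0 <= s -> norm (c s) <= N * exp (w * s)).

Lemma exp_growth_nonneg (c : R -> E) (N w : R) : exp_growth c N w -> 0 <= N.
Proof.
  intros [_ h]; specialize (h 0 (Rle_refl 0)).
  rewrite Rmult_0_r, exp_0, Rmult_1_r in h.
  apply Rle_trans with (2 := h), norm_ge_0.
Qed.

Lemma norm_scal_Cmod (a : C) (x : E) : norm (scal a x) <= Cmod a * norm x.
Proof. exact (norm_scal (V := CompleteNormedModule.NormedModule _ E) a x). Qed.

Lemma scal_RtoC_0 (x : E) : scal (RtoC 0) x = zero.
Proof. exact (scal_zero_l (V := CompleteNormedModule.ModuleSpace _ E) x). Qed.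

Lemma continuous_kernel (k : R -> C) (c : R -> E) (s : R) :
  continuous_components k -> continuous c s ->
  continuous (fun s => scal (k s) (c s) : E) s.
Proof.
  intros hk hc.
  exact (continuous_scal (K := C_AbsRing) (V := CompleteNormedModule.NormedModule _ E)
           k c s (continuous_components_AbsRing k s hk) hc).
Qed.

(** Of the decay rate [l + w], the growth of [c] consumes [w]. *)
Lemma norm_kernel (k : R -> C) (c : R -> E) (N w B l s : R) :
  exp_growth c N w -> 0 <= s -> Cmod (k s) <= B * exp (- (l + w) * s) ->
  norm (scal (k s) (c s)) <= B * N * exp (- l * s).
Proof.
  intros [_ hc] hs hk.
  apply Rle_trans with (1 := norm_scal_Cmod (k s) (c s)).
  apply Rle_trans with (B * exp (- (l + w) * s) * (N * exp (w * s))).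
  - apply Rmult_le_compat; auto using Cmod_ge_0; apply norm_ge_0.
  - right.
    replace (- l * s) with (- (l + w) * s + w * s) by ring.
    rewrite exp_plus; ring.
Qed.

Definition admissible_kernel (k : R -> C) : Prop :=
  continuous_components k /\ rapidly_decreasing k.

Lemma transform_correct (k : R -> C) (c : R -> E) (N w : R) :
  admissible_kernel k -> exp_growth c N w ->
  is_integral_half_line (fun s => scal (k s) (c s)) (transform k c).
Proof.
  intros [hk hd] hc.
  destruct (hd (1 + w)) as [B [_ hB]].
  destruct (half_line_integral_exists ER (fun s => scal (k s) (c s) : E) (B * N) 1)
    as [v hv].
  - intros s; apply (continuous_kernel k c s hk), hc.
  - lra.
  - intros s hs; apply (norm_kernel k c N w B 1 s hc hs), hB, hs.
  - apply RInt_gen_correct; exists v; exact hv.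
Qed.

Lemma transform_unique (k : R -> C) (c : R -> E) (v : E) :
  is_integral_half_line (fun s => scal (k s) (c s)) v -> transform k c = v.
Proof. exact (is_RInt_gen_unique (V := ER) _ v). Qed.

Lemma transform_norm (k : R -> C) (c : R -> E) (N w B l : R) :
  continuous_components k -> exp_growth c N w -> 0 < l ->
  (forall s, 0 <= s -> Cmod (k s) <= B * exp (- (l + w) * s)) ->
  norm (transform k c) <= B * N / l.
Proof.
  intros hk hc hl hB.
  assert (hcont : forall s, continuous (fun s => scal (k s) (c s) : E) s)
    by (intros s; apply (continuous_kernel k c s hk), hc).
  assert (hbd : forall s, 0 <= s ->
            norm (scal (k s) (c s)) <= B * N * exp (- l * s))
    by (intros s hs; apply (norm_kernel k c N w B l s hc hs), hB, hs).
  destruct (half_line_integral_exists ER (fun s => scal (k s) (c s) : E)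
              (B * N) l hcont hl hbd) as [v hv].
  rewrite (transform_unique k c v hv).
  exact (half_line_integral_norm ER _ v (B * N) l hcont hl hbd hv).
Qed.

Lemma transform_ext (k k' : R -> C) (c c' : R -> E) (N w : R) :
  admissible_kernel k -> exp_growth c N w ->
  (forall s, 0 <= s -> scal (k s) (c s) = scal (k' s) (c' s)) ->
  transform k' c' = transform k c.
Proof.
  intros hk hc h; apply transform_unique.
  refine (is_RInt_gen_ext (V := ER) _ _ _ _ (transform_correct k c N w hk hc)).
  exists (fun a => a = 0) (fun b => 0 < b); [reflexivity | exists 0; auto |].
  intros a b -> hb t; simpl; rewrite Rmin_left, Rmax_right by lra.
  intros ht; apply h; lra.
Qed.

Lemma transform_minus (k k' : R -> C) (c : R -> E) (N w : R) :
  admissible_kernel k -> admissible_kernel k' -> exp_growth c N w ->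
  transform (fun s => k s - k' s)%C c = minus (transform k c) (transform k' c).
Proof.
  intros hk hk' hc; apply transform_unique.
  pose proof (is_RInt_gen_minus (V := ER) _ _ _ _ (transform_correct k c N w hk hc)
    (transform_correct k' c N w hk' hc)) as h.
  refine (is_RInt_gen_ext (V := ER) _ _ _ _ h).
  exists (fun _ => True) (fun _ => True); try apply filter_true.
  intros a b _ _ t _; simpl.
  exact (eq_sym (scal_minus_distr_r (V := CompleteNormedModule.ModuleSpace _ E)
                   (k t) (k' t) (c t))).
Qed.

End Transform.

Arguments transform {E}.
Arguments exp_growth {E}.

(** * Closed and bounded operators under a transform *)

Section TransformRelation.

Variables E F : CompleteNormedModule C_AbsRing.

(** Complex scalars are required since a complex kernel multiplies both components before
    integration. *)
Definition closed_complex_relation (D : E -> F -> Prop) : Prop :=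
  D zero zero /\
  (forall x y x' y', D x y -> D x' y' -> D (plus x x') (plus y y')) /\
  (forall (a : C) x y, D x y -> D (scal a x) (scal a y)) /\
  (forall (u : nat -> E) (v : nat -> F) x y,
     (forall n, D (u n) (v n)) ->
     filterlim u eventually (locally x) -> filterlim v eventually (locally y) ->
     D x y).

(** Applied to the graph of a bounded operator it gives [transform_linear]; applied to the graph of
    [A] it gives both the commutation with [A] and the generator equation. *)
Lemma transform_relation (D : E -> F -> Prop) (k : R -> C)
    (c : R -> E) (c' : R -> F) (N w N' w' : R) :
  closed_complex_relation D -> admissible_kernel k ->
  exp_growth c N w -> exp_growth c' N' w' ->
  (forall s, 0 <= s -> D (c s) (c' s)) ->
  D (transform k c) (transform k c').
Proof.
  intros (D0 & Dp & Ds & Dc) hk hc hc' hD.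
  refine (half_line_integral_relation (real_CompleteNormedModule E)
    (real_CompleteNormedModule F) D (fun s => scal (k s) (c s))
    (fun s => scal (k s) (c' s)) _ _ _ _ _ _
    (transform_correct E k c N w hk hc) (transform_correct F k c' N' w' hk hc')).
  - repeat split; [exact D0 | exact Dp | intros r; exact (Ds (RtoC r)) | exact Dc].
  - intros s; apply (continuous_kernel E k c s (proj1 hk)), hc.
  - intros s; apply (continuous_kernel F k c' s (proj1 hk)), hc'.
  - intros s hs; apply Ds, hD, hs.
Qed.

Lemma graph_closed_relation (T : E -> F) :
  is_linear T -> closed_complex_relation (fun x y => y = T x).
Proof.
  intros hT; repeat split.
  - symmetry; exact (linear_zero T hT).
  - intros x y x' y' -> ->; symmetry; apply hT.
  - intros a x y ->; symmetry; apply hT.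
  - intros u v x y huv hu hv.
    apply (filterlim_locally_unique (V := CompleteNormedModule.NormedModule _ F)
             (F := eventually) v); [exact hv |].
    apply filterlim_ext with (fun n => T (u n)); [intros n; symmetry; apply huv |].
    apply filterlim_comp with (1 := hu).
    exact (linear_cont T x hT).
Qed.

Lemma exp_growth_linear (T : E -> F) (c : R -> E) (N w : R) :
  is_linear T -> exp_growth c N w ->
  exists N', exp_growth (fun s => T (c s)) N' w.
Proof.
  intros hT hc; destruct (linear_norm T hT) as [M [hM hTM]].
  exists (M * N); split.
  - intros s; exact (filterlim_comp _ _ _ c T _ _ _ (proj1 hc s)
                       (linear_cont T (c s) hT)).
  - intros s hs; apply Rle_trans with (1 := hTM (c s)).
    rewrite Rmult_assoc; apply Rmult_le_compat_l; [lra | apply hc, hs].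
Qed.

Lemma transform_linear (T : E -> F) (k : R -> C) (c : R -> E) (N w : R) :
  is_linear T -> admissible_kernel k -> exp_growth c N w ->
  transform k (fun s => T (c s)) = T (transform k c).
Proof.
  intros hT hk hc.
  destruct (exp_growth_linear T c N w hT hc) as [N' hTc].
  exact (transform_relation (fun x y => y = T x) k c (fun s => T (c s)) N w N' w
           (graph_closed_relation T hT) hk hc hTc (fun s _ => eq_refl)).
Qed.

End TransformRelation.

Lemma is_linear_scal_C (E : CompleteNormedModule C_AbsRing) (a : C) :
  is_linear (fun x : E => scal a x).
Proof.
  exact (is_linear_scal_r (V := CompleteNormedModule.NormedModule _ E) a Cmult_comm).
Qed.

(** Serves to take the fixed vector [y] out of the transform of [s -> Theta(s) y]. *)
Lemma is_linear_scal_vector (E : CompleteNormedModule C_AbsRing) (y : E) :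
  is_linear (fun a : C_CompleteNormedModule => scal a y : E).
Proof.
  destruct (is_linear_scal_l (V := CompleteNormedModule.NormedModule _ E) y)
    as [hp hs hn].
  split; [exact hp | exact hs | exact hn].
Qed.

Lemma gauss_admissible (z : C) : 0 < Re z -> admissible_kernel (gauss z).
Proof.
  intros hz; split; [apply gauss_continuous | apply gauss_rapidly_decreasing, hz].
Qed.

Lemma dgauss_admissible (z : C) : 0 < Re z -> admissible_kernel (dgauss z).
Proof.
  intros hz; split; [apply dgauss_continuous | apply dgauss_rapidly_decreasing, hz].
Qed.

Lemma continuous_components_minus (k k' : R -> C) :
  continuous_components k -> continuous_components k' ->
  continuous_components (fun s => k s - k' s)%C.
Proof.
  intros [h1 h2] [h1' h2']; split; intros s; unfold Cminus, Cplus, Copp; simpl;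
    apply (continuous_minus (V := R_NormedModule)); auto.
Qed.

Lemma continuous_components_const (a : C) : continuous_components (fun _ => a).
Proof. split; intros s; apply continuous_const. Qed.

Lemma admissible_kernel_minus (k k' : R -> C) :
  admissible_kernel k -> admissible_kernel k' ->
  admissible_kernel (fun s => k s - k' s)%C.
Proof.
  intros [hk hd] [hk' hd']; split; [apply continuous_components_minus; assumption |].
  intros l; destruct (hd l) as [B [hB h]], (hd' l) as [B' [hB' h']].
  exists (B + B'); split; [lra |].
  intros s hs; unfold Cminus; apply Rle_trans with (1 := Cmod_triangle _ _).
  rewrite Cmod_opp; specialize (h s hs); specialize (h' s hs); lra.
Qed.

Lemma admissible_kernel_scal (a : C) (k : R -> C) :
  admissible_kernel k -> admissible_kernel (fun s => a * k s)%C.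
Proof.
  intros [hk hd]; split.
  - apply (continuous_components_mult (fun _ => a) k);
      [apply continuous_components_const | exact hk].
  - intros l; destruct (hd l) as [B [hB h]].
    pose proof (Cmod_ge_0 a).
    exists (Cmod a * B); split; [apply Rmult_le_pos; assumption |].
    intros s hs; rewrite Cmod_mult, Rmult_assoc.
    apply Rmult_le_compat_l; auto.
Qed.

(** * Differentiability and size of Gauss transforms *)

Section GaussTransform.

Variable E : CompleteNormedModule C_AbsRing.

(** The function [c] is quantified after [D] and [r]: the estimate is uniform over all functions of
    growth rate [w], which yields differentiability in operator norm. *)
Lemma gauss_transform_taylor (z : C) (w : R) : 0 < Re z ->
  exists D r, 0 <= D /\ 0 < r /\ forall z', Cmod (z' - z) < r ->
    0 < Re z' /\
    forall (c : R -> E) (N : R), exp_growth c N w ->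
      norm (minus (minus (transform (gauss z') c) (transform (gauss z) c))
                  (scal (z' - z)%C (transform (dgauss z) c)))
        <= D * Cmod (z' - z) ^ 2 * N.
Proof.
  intros hz.
  (* The rate [w] cancels the growth of [c]; the extra 1 leaves [exp (- s)], of integral 1. *)
  destruct (gauss_taylor z (1 + w) hz) as (D & r & hD & hr & h).
  exists D, r; split; [exact hD |]; split; [exact hr |].
  intros z' hz'; destruct (h z' hz') as [hre hest]; split; [exact hre |].
  intros c N hc.
  set (d := (z' - z)%C) in *.
  assert (k1 : admissible_kernel (fun s => gauss z' s - gauss z s)%C).
  { apply admissible_kernel_minus; apply gauss_admissible; assumption. }
  assert (k2 : admissible_kernel (fun s => d * dgauss z s)%C).
  { apply admissible_kernel_scal, dgauss_admissible, hz. }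
  assert (e : scal d (transform (dgauss z) c)
              = transform (fun s => d * dgauss z s)%C c).
  { rewrite <- (transform_linear E E _ _ c N w (is_linear_scal_C E d)
                  (dgauss_admissible z hz) hc).
    apply (transform_ext E _ _ _ _ N w k2 hc).
    intros s _; rewrite (Cmult_comm d).
    exact (eq_sym (scal_assoc (V := CompleteNormedModule.ModuleSpace _ E) _ _ _)). }
  rewrite e.
  rewrite <- (transform_minus E _ _ c N w (gauss_admissible z' hre)
                (gauss_admissible z hz) hc).
  rewrite <- (transform_minus E _ _ c N w k1 k2 hc).
  replace (D * Cmod d ^ 2 * N) with (D * Cmod d ^ 2 * N / 1) by field.
  apply (transform_norm E _ c N w (D * Cmod d ^ 2) 1);
    [| exact hc | lra | exact hest].
  apply continuous_components_minus; [apply k1 | apply k2].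
Qed.

(** The remaining rate is chosen as the root of [decay_rate z]. In a sector that root is of order
    [|z|^(-1/2)], so its inverse compensates the prefactor of the Gaussian. *)
Lemma gauss_transform_norm (z : C) (c : R -> E) (N w : R) :
  0 < Re z -> exp_growth c N w ->
  norm (transform (gauss z) c)
    <= / sqrt PI * / sqrt (Cmod z) * / sqrt (decay_rate z)
       * exp (w ^ 2 / (2 * decay_rate z) + 1 / 2) * N.
Proof.
  intros hz hc.
  set (a := decay_rate z).
  assert (ha : 0 < a) by (apply decay_rate_pos, hz).
  pose proof (sqrt_lt_R0 a ha) as hsa.
  assert (hcst : 0 <= / sqrt PI * / sqrt (Cmod z)).
  { apply Rmult_le_pos; apply Rlt_le, Rinv_0_lt_compat, sqrt_lt_R0;
      [apply PI_RGT_0 | apply Cmod_gt_0, Re_pos_neq_0, hz]. }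
  replace (/ sqrt PI * / sqrt (Cmod z) * / sqrt a * exp (w ^ 2 / (2 * a) + 1 / 2) * N)
    with (/ sqrt PI * / sqrt (Cmod z) * exp (w ^ 2 / (2 * a) + 1 / 2) * N / sqrt a)
    by (field; repeat split; try lra; apply Rgt_not_eq, sqrt_lt_R0;
        [apply Cmod_gt_0, Re_pos_neq_0, hz | apply PI_RGT_0]).
  apply (transform_norm E _ c N w); [apply gauss_continuous | exact hc | exact hsa |].
  intros s hs; rewrite Cmod_gauss by exact hz; fold a.
  rewrite (Rmult_assoc (/ sqrt PI * / sqrt (Cmod z))).
  apply Rmult_le_compat_l; [exact hcst |].
  rewrite <- exp_plus; apply exp_le_exp.
  (* Completing the square, with [(w + sqrt a)^2 <= 2 w^2 + 2 a]. *)
  pose proof (sqrt_sqrt a (Rlt_le _ _ ha)) as e.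
  set (q := sqrt a) in *.
  assert (h : 0 <= (2 * a * s - (w + q)) ^ 2 / (4 * a) + (w - q) ^ 2 / (4 * a)).
  { apply Rplus_le_le_0_compat; apply Rdiv_le_0_compat;
      try apply pow2_ge_0; lra. }
  replace ((2 * a * s - (w + q)) ^ 2 / (4 * a) + (w - q) ^ 2 / (4 * a))
    with (a * s ^ 2 - (q + w) * s + (w ^ 2 / (2 * a) + (q * q) / (2 * a))) in h
    by (field; lra).
  rewrite e in h.
  replace (a / (2 * a)) with (1 / 2) in h by (field; lra).
  lra.
Qed.

End GaussTransform.

(** * Behaviour of Gauss transforms in a sector and at the origin *)

Section GaussTransformLimits.

Variable E : CompleteNormedModule C_AbsRing.

Let ER := real_CompleteNormedModule E.

Lemma decay_rate_sector (z : C) (k : R) : 0 < k -> 0 < Re z ->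
  k * Cmod z <= Re z -> k / (4 * Cmod z) <= decay_rate z.
Proof.
  intros hk hz h; unfold decay_rate.
  assert (hZ : 0 < Cmod z) by apply Cmod_gt_0, Re_pos_neq_0, hz.
  replace (k / (4 * Cmod z)) with (k * Cmod z * / (4 * Cmod z ^ 2)) by (field; lra).
  apply Rmult_le_compat_r; [apply Rlt_le, Rinv_0_lt_compat; nra | exact h].
Qed.

Lemma inv_sqrt_decay_rate (z : C) (k : R) : 0 < k -> 0 < Re z ->
  k * Cmod z <= Re z -> / sqrt (decay_rate z) <= 2 * sqrt (Cmod z) / sqrt k.
Proof.
  intros hk hz h.
  assert (hZ : 0 < Cmod z) by apply Cmod_gt_0, Re_pos_neq_0, hz.
  pose proof (decay_rate_sector z k hk hz h) as ha.
  pose proof (sqrt_lt_R0 k hk); pose proof (sqrt_lt_R0 _ hZ).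
  assert (e : 2 * sqrt (Cmod z) / sqrt k = / sqrt (k / (4 * Cmod z))).
  { rewrite sqrt_div_alt by lra.
    rewrite sqrt_mult by lra.
    replace 4 with (2 * 2) by ring; rewrite sqrt_square by lra.
    field; lra. }
  rewrite e; apply Rinv_le_contravar.
  - apply sqrt_lt_R0, Rdiv_lt_0_compat; lra.
  - apply sqrt_le_1_alt, ha.
Qed.

(** By [inv_sqrt_decay_rate] the singular factor [|z|^(-1/2)] cancels, so the bound does not
    degenerate as [z] approaches 0 inside the sector. *)
Lemma gauss_transform_sector (z : C) (c : R -> E) (N w k : R) :
  0 < k -> 0 < Re z -> k * Cmod z <= Re z -> exp_growth c N w ->
  norm (transform (gauss z) c)
    <= / sqrt PI * (2 / sqrt k) * exp (2 * w ^ 2 / k * Cmod z + 1 / 2) * N.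
Proof.
  intros hk hz h hc.
  apply Rle_trans with (1 := gauss_transform_norm E z c N w hz hc).
  apply Rmult_le_compat_r; [exact (exp_growth_nonneg E c N w hc) |].
  assert (hZ : 0 < Cmod z) by apply Cmod_gt_0, Re_pos_neq_0, hz.
  pose proof (decay_rate_sector z k hk hz h) as ha.
  pose proof (decay_rate_pos z hz) as ha0.
  pose proof (sqrt_lt_R0 k hk); pose proof (sqrt_lt_R0 _ hZ) as hsz.
  assert (hpi : 0 < / sqrt PI) by (apply Rinv_0_lt_compat, sqrt_lt_R0, PI_RGT_0).
  pose proof (Rinv_0_lt_compat _ hsz).
  apply Rmult_le_compat.
  - repeat apply Rmult_le_pos; try lra.
    apply Rlt_le, Rinv_0_lt_compat, sqrt_lt_R0, ha0.
  - apply Rlt_le, exp_pos.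
  - rewrite Rmult_assoc; apply Rmult_le_compat_l; [lra |].
    apply Rle_trans with (/ sqrt (Cmod z) * (2 * sqrt (Cmod z) / sqrt k)).
    + apply Rmult_le_compat_l; [lra |].
      apply inv_sqrt_decay_rate; assumption.
    + right; field; lra.
  - apply exp_le_exp, Rplus_le_compat_r.
    assert (hi : / decay_rate z <= 4 * Cmod z / k).
    { replace (4 * Cmod z / k) with (/ (k / (4 * Cmod z))) by (field; lra).
      apply Rinv_le_contravar; [apply Rdiv_lt_0_compat; lra | exact ha]. }
    replace (w ^ 2 / (2 * decay_rate z)) with (w ^ 2 / 2 * / decay_rate z)
      by (field; lra).
    replace (2 * w ^ 2 / k * Cmod z) with (w ^ 2 / 2 * (4 * Cmod z / k))
      by (field; lra).
    apply Rmult_le_compat_l; [pose proof (pow2_ge_0 w); lra | exact hi].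
Qed.

(** The Gaussian concentrates at scale [|z|^(1/2)], where [c] is small. This is expressed by
    changing the growth data of [c]: for [s >= d0] one has [1 <= exp (q * s) / (q * d0)], so raising
    the rate by [q] lowers the constant to nearly [e1]. The price stays bounded, as
    [(w + q)^2 / (2 a) <= w^2 / a + 1] when [q^2 = a]. *)
Lemma gauss_transform_vanishes (c : R -> E) (N w k : R) :
  0 < k -> 0 <= w -> exp_growth c N w -> c 0 = zero ->
  forall eps, 0 < eps -> exists d, 0 < d /\
    forall z, 0 < Re z -> k * Cmod z <= Re z -> Cmod z < d ->
      norm (transform (gauss z) c) < eps.
Proof.
  intros hk hw hc hc0 eps heps.
  pose proof (exp_growth_nonneg E c N w hc) as hN.
  (* The exponent collects [w^2 / a <= 4 w^2 / k], valid for [|z| < 1], then 1 from the added rate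
     and 1/2 from [gauss_transform_norm]. *)
  set (B := / sqrt PI * (2 / sqrt k) * exp (4 * w ^ 2 / k + 3 / 2)).
  assert (hsk : 0 < sqrt k) by (apply sqrt_lt_R0, hk).
  assert (hpi : 0 < / sqrt PI) by (apply Rinv_0_lt_compat, sqrt_lt_R0, PI_RGT_0).
  assert (hB : 0 < B).
  { repeat apply Rmult_lt_0_compat; try lra;
      [apply Rinv_0_lt_compat, hsk | apply exp_pos]. }
  set (e1 := eps / (3 * B)).
  assert (he1 : 0 < e1) by (apply Rdiv_lt_0_compat; lra).
  assert (hcont : exists d0, 0 < d0 /\ forall s, 0 <= s < d0 -> norm (c s) <= e1).
  { pose proof (filterlim_comp _ _ _ c norm _ _ _ (proj1 hc 0)
      (filterlim_norm (V := CompleteNormedModule.NormedModule _ E) (c 0))) as hn.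
    destruct (proj1 (filterlim_locally _ _) hn (mkposreal e1 he1)) as [d0 hd0].
    exists d0; split; [apply cond_pos |].
    intros s hs.
    assert (hball : ball 0 d0 s).
    { change (Rabs (s - 0) < d0); rewrite Rminus_0_r, Rabs_pos_eq; apply hs. }
    specialize (hd0 s hball).
    change (Rabs (norm (c s) - norm (c 0)) < e1) in hd0.
    assert (e0 : norm (c 0) = 0).
    { rewrite hc0; exact (norm_zero (V := CompleteNormedModule.NormedModule _ E)). }
    rewrite e0, Rminus_0_r in hd0; apply Rabs_lt_between in hd0; lra. }
  destruct hcont as (d0 & hd0 & hcd).
  (* [N / (d0 * q)] is at most [L] times the root of [|z|]; the summand 1 keeps [L] positive when
     [N = 0]. With [e1] and [q0] each contributing [eps / 3], the total is below [eps]. *)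
  set (L := 2 * N / (d0 * sqrt k) + 1).
  assert (hL : 0 < L).
  { assert (0 <= 2 * N / (d0 * sqrt k))
      by (apply Rdiv_le_0_compat; [lra | apply Rmult_lt_0_compat; assumption]).
    unfold L; lra. }
  set (q0 := eps / (3 * B * L)).
  assert (hq0 : 0 < q0).
  { apply Rdiv_lt_0_compat; [lra |].
    apply Rmult_lt_0_compat; [lra | exact hL]. }
  exists (Rmin 1 (q0 ^ 2)); split.
  { apply Rmin_pos; [lra | apply pow_lt, hq0]. }
  intros z hz hsec hzd.
  assert (hZ : 0 < Cmod z) by apply Cmod_gt_0, Re_pos_neq_0, hz.
  assert (hz1 : Cmod z < 1) by (apply Rlt_le_trans with (1 := hzd), Rmin_l).
  assert (hz2 : Cmod z < q0 ^ 2) by (apply Rlt_le_trans with (1 := hzd), Rmin_r).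
  assert (hsz : sqrt (Cmod z) < q0).
  { rewrite <- (sqrt_pow2 q0) by lra; apply sqrt_lt_1_alt; lra. }
  pose proof (decay_rate_pos z hz) as ha0.
  set (a := decay_rate z) in *.
  pose proof (sqrt_lt_R0 a ha0) as hq.
  pose proof (sqrt_sqrt a (Rlt_le _ _ ha0)) as hqq.
  set (q := sqrt a) in *.
  pose proof (Rinv_0_lt_compat q hq) as hiq.
  (* As [z] tends to 0, [q] tends to infinity and the constant tends to [e1]. *)
  assert (hgrow : exp_growth c (e1 + N / d0 * / q) (w + q)).
  { split; [apply hc |].
    intros s hs.
    assert (hNd : 0 <= N / d0) by (apply Rdiv_le_0_compat; lra).
    assert (hwq : 1 <= exp ((w + q) * s)).
    { rewrite <- exp_0; apply exp_le_exp; apply Rmult_le_pos; lra. }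
    destruct (Rlt_dec s d0) as [hsd | hsd].
    - apply Rle_trans with e1; [apply hcd; lra |].
      assert (0 <= N / d0 * / q) by (apply Rmult_le_pos; lra).
      nra.
    - apply Rle_trans with (1 := proj2 hc s hs).
      apply Rle_trans with (N / d0 * / q * exp ((w + q) * s)).
      2: { apply Rmult_le_compat_r; lra. }
      replace ((w + q) * s) with (w * s + q * s) by ring.
      rewrite exp_plus.
      assert (hqs : q * s <= exp (q * s)).
      { assert (0 < q * s) by nra.
        pose proof (exp_ineq1 (q * s)); lra. }
      replace (N * exp (w * s)) with (N / d0 * / q * (exp (w * s) * (q * d0)))
        by (field; lra).
      apply Rmult_le_compat_l; [apply Rmult_le_pos; lra |].
      apply Rmult_le_compat_l; [apply Rlt_le, exp_pos |].
      apply Rle_trans with (2 := hqs).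
      apply Rmult_le_compat_l; lra. }
  apply Rle_lt_trans with (1 := gauss_transform_norm E z c _ _ hz hgrow).
  fold a q.
  pose proof (inv_sqrt_decay_rate z k hk hz hsec) as hinv; fold a q in hinv.
  assert (hsz0 : 0 < sqrt (Cmod z)) by (apply sqrt_lt_R0, hZ).
  assert (hfirst : / sqrt PI * / sqrt (Cmod z) * / q
            * exp ((w + q) ^ 2 / (2 * a) + 1 / 2) <= B).
  { apply Rmult_le_compat.
    - repeat apply Rmult_le_pos; try lra; apply Rlt_le, Rinv_0_lt_compat; lra.
    - apply Rlt_le, exp_pos.
    - rewrite Rmult_assoc; apply Rmult_le_compat_l; [lra |].
      apply Rle_trans with (/ sqrt (Cmod z) * (2 * sqrt (Cmod z) / sqrt k)).
      + apply Rmult_le_compat_l; [apply Rlt_le, Rinv_0_lt_compat; lra | exact hinv].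
      + right; field; lra.
    - apply exp_le_exp.
      assert (h1 : (w + q) ^ 2 / (2 * a) <= w ^ 2 / a + 1).
      { apply (Rmult_le_reg_r (2 * a)); [lra |].
        replace ((w + q) ^ 2 / (2 * a) * (2 * a)) with ((w + q) ^ 2) by (field; lra).
        replace ((w ^ 2 / a + 1) * (2 * a)) with (2 * w ^ 2 + 2 * a) by (field; lra).
        rewrite <- hqq; pose proof (pow2_ge_0 (w - q)); nra. }
      assert (h2 : w ^ 2 / a <= 4 * w ^ 2 / k).
      { pose proof (decay_rate_sector z k hk hz hsec) as ha; fold a in ha.
        assert (hka : k / 4 <= a).
        { apply Rle_trans with (2 := ha).
          apply Rmult_le_compat_l; [lra |].
          apply Rinv_le_contravar; lra. }
        replace (4 * w ^ 2 / k) with (w ^ 2 * / (k / 4)) by (field; lra).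
        unfold Rdiv at 1; apply Rmult_le_compat_l; [apply pow2_ge_0 |].
        apply Rinv_le_contravar; lra. }
      lra. }
  assert (hsecond : e1 + N / d0 * / q <= e1 + L * q0).
  { apply Rplus_le_compat_l.
    assert (hNd : 0 <= N / d0) by (apply Rdiv_le_0_compat; lra).
    apply Rle_trans with (N / d0 * (2 * q0 / sqrt k)).
    - apply Rmult_le_compat_l; [exact hNd |].
      apply Rle_trans with (1 := hinv).
      unfold Rdiv; apply Rmult_le_compat_r; [apply Rlt_le, Rinv_0_lt_compat, hsk |].
      lra.
    - replace (N / d0 * (2 * q0 / sqrt k)) with (2 * N / (d0 * sqrt k) * q0)
        by (field; lra).
      apply Rmult_le_compat_r; unfold L; lra. }
  apply Rle_lt_trans with (B * (e1 + L * q0)).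
  { apply Rmult_le_compat; try lra.
    - repeat apply Rmult_le_pos; try lra;
        [apply Rlt_le, Rinv_0_lt_compat; lra | apply Rlt_le, exp_pos].
    - assert (0 <= N / d0) by (apply Rdiv_le_0_compat; lra).
      assert (0 <= N / d0 * / q) by (apply Rmult_le_pos; lra).
      lra. }
  replace (B * (e1 + L * q0)) with (2 * eps / 3)
    by (unfold e1, q0; field; lra).
  lra.
Qed.

End GaussTransformLimits.

(** * Gauss transforms as functions of a real time *)

Section GaussFamily.

Variable E : CompleteNormedModule C_AbsRing.

Let ER := real_CompleteNormedModule E.

Lemma minus_zero_E (x : E) : minus x zero = x.
Proof. exact (minus_zero_r (G := CompleteNormedModule.AbelianGroup _ E) x). Qed.

Lemma norm_zero_E : norm (zero : E) = 0.
Proof. exact (norm_zero (V := CompleteNormedModule.NormedModule _ E)). Qed.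

(** Zero for [t <= 0]: this fixes the value at time 0 and, when [c 0 = zero], makes the family
    continuous on the whole line. *)
Definition gauss_family (c : R -> E) (t : R) : E :=
  if Rlt_dec 0 t then transform (gauss (RtoC t)) c else zero.

Lemma gauss_family_pos (c : R -> E) (t : R) : 0 < t ->
  gauss_family c t = transform (gauss (RtoC t)) c.
Proof. intros ht; unfold gauss_family; destruct (Rlt_dec 0 t); easy. Qed.

Lemma gauss_family_nonpos (c : R -> E) (t : R) : t <= 0 ->
  gauss_family c t = zero.
Proof. intros ht; unfold gauss_family; destruct (Rlt_dec 0 t); [lra | easy]. Qed.

Lemma gauss_family_derive (c : R -> E) (N w t : R) :
  0 < t -> exp_growth c N w ->
  @is_derive R_AbsRing ER (gauss_family c) t (transform (dgauss (RtoC t)) c).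
Proof.
  intros ht hc.
  destruct (gauss_transform_taylor E (RtoC t) w ht) as (D & r & hD & hr & h).
  pose proof (exp_growth_nonneg E c N w hc) as hN.
  split; [apply (is_linear_scal_l (V := ER)) |].
  intros x hx.
  apply (is_filter_lim_locally_unique (V := R_NormedModule)) in hx; subst x.
  intros eps.
  set (k := D * N + 1).
  assert (hk : 0 < k) by (unfold k; pose proof (Rmult_le_pos D N hD hN); lra).
  assert (hpos : 0 < Rmin r (eps / k)).
  { apply Rmin_pos; [exact hr | apply Rdiv_lt_0_compat; [apply cond_pos | exact hk]]. }
  exists (mkposreal _ hpos); intros y hy.
  change (Rabs (y - t) < Rmin r (eps / k)) in hy.
  assert (ey : (RtoC y - RtoC t)%C = RtoC (y - t)) by (symmetry; apply RtoC_minus).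
  destruct (h (RtoC y)) as [hy0 hest].
  { rewrite ey, Cmod_R; apply Rlt_le_trans with (1 := hy), Rmin_l. }
  rewrite (gauss_family_pos c y hy0), (gauss_family_pos c t ht).
  specialize (hest c N hc); rewrite ey, Cmod_R in hest.
  refine (Rle_trans _ _ _ hest _).
  change (norm (minus y t)) with (Rabs (y - t)).
  pose proof (Rabs_pos (y - t)) as h0.
  assert (h1 : k * Rabs (y - t) <= eps).
  { apply Rle_trans with (k * (eps / k)); [| right; field; lra].
    apply Rmult_le_compat_l; [lra |].
    apply Rlt_le, Rlt_le_trans with (1 := hy), Rmin_r. }
  replace (D * Rabs (y - t) ^ 2 * N) with (D * N * Rabs (y - t) * Rabs (y - t)) by ring.
  apply Rmult_le_compat_r; [exact h0 |].
  unfold k in h1; nra.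
Qed.

Lemma gauss_family_continuous (c : R -> E) (N w t : R) :
  0 <= w -> exp_growth c N w -> c 0 = zero ->
  @continuous R_UniformSpace E (gauss_family c) t.
Proof.
  intros hw hc hc0.
  destruct (Rlt_dec 0 t) as [ht | ht].
  - apply (ex_derive_continuous (V := ER)).
    eexists; exact (gauss_family_derive c N w t ht hc).
  (* For [t <= 0] a point [y] within [d] of [t] is either nonpositive or lies in [(0, d)], so time 0
     and negative times are handled together. On the real axis the sector constant is 1. *)
  - apply (filterlim_locally (U := CompleteNormedModule.UniformSpace _ E)).
    intros eps; rewrite (gauss_family_nonpos c t) by lra.
    destruct (gauss_transform_vanishes E c N w 1 Rlt_0_1 hw hc hc0 eps (cond_pos eps))
      as (d & hd & h).
    exists (mkposreal d hd); intros y hy.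
    change (Rabs (y - t) < d) in hy; apply Rabs_lt_between in hy.
    apply (norm_compat1 (V := CompleteNormedModule.NormedModule _ E)).
    destruct (Rlt_dec 0 y) as [hy0 | hy0].
    + rewrite gauss_family_pos by exact hy0.
      assert (e : Cmod (RtoC y) = y) by (rewrite Cmod_R, Rabs_pos_eq; lra).
      rewrite minus_zero_E; apply h; rewrite ?e; simpl; lra.
    + rewrite gauss_family_nonpos by lra.
      rewrite minus_zero_E.
      refine (eq_ind_r (fun x => x < eps) (cond_pos eps) norm_zero_E).
Qed.

Definition primitive (c : R -> E) (s : R) : E := integral c 0 s.

Lemma primitive_derive (c : R -> E) (s : R) :
  (forall s, continuous c s) -> @is_derive R_AbsRing ER (primitive c) s (c s).
Proof.
  intros hc; apply (is_derive_RInt (V := ER) c (primitive c) 0 s).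
  - apply filter_forall; intros b.
    apply (RInt_correct (V := ER)), (ex_RInt_continuous (V := ER)).
    intros z _; apply hc.
  - apply hc.
Qed.

Lemma primitive_0 (c : R -> E) : primitive c 0 = zero.
Proof. exact (RInt_point (V := ER) 0 c). Qed.

(** The length of the interval is paid for by one unit of rate, through [s <= exp s]. *)
Lemma primitive_growth (c : R -> E) (N w : R) : 0 <= w ->
  exp_growth c N w -> exp_growth (primitive c) N (w + 1).
Proof.
  intros hw hc.
  pose proof (exp_growth_nonneg E c N w hc) as hN.
  split.
  - intros s; apply (ex_derive_continuous (V := ER)).
    eexists; apply primitive_derive, hc.
  - intros s hs.
    assert (hI : @is_RInt ER c 0 s (primitive c s)).
    { apply (RInt_correct (V := ER)), (ex_RInt_continuous (V := ER)).
      intros z _; apply hc. }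
    apply Rle_trans with ((s - 0) * (N * exp (w * s))).
    + refine (norm_RInt_le_const (V := ER) c 0 s _ _ hs _ hI).
      intros x hx; apply Rle_trans with (1 := proj2 hc x (proj1 hx)).
      apply Rmult_le_compat_l; [exact hN |].
      apply exp_le_exp, Rmult_le_compat_l; lra.
    + replace ((w + 1) * s) with (s + w * s) by ring.
      rewrite exp_plus, Rminus_0_r.
      pose proof (le_exp s hs).
      pose proof (exp_pos (w * s)).
      replace (N * (exp s * exp (w * s))) with (exp s * (N * exp (w * s))) by ring.
      apply Rmult_le_compat_r; [apply Rmult_le_pos; lra | assumption].
Qed.

Definition real_gauss (t s : R) : R :=
  / sqrt PI * / sqrt t * exp (- (s ^ 2 / (4 * t))).

Lemma gauss_RtoC (t s : R) : 0 < t -> gauss (RtoC t) s = RtoC (real_gauss t s).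
Proof.
  intros ht; pose proof (sqrt_lt_R0 t ht).
  unfold gauss, real_gauss; rewrite csqrt_RtoC by exact ht.
  replace (RtoC (- s ^ 2) * / (4 * RtoC t))%C with (RtoC (- (s ^ 2 / (4 * t)))).
  - rewrite cexp_RtoC, <- (RtoC_inv (sqrt t)), <- !RtoC_mult by lra; reflexivity.
  - rewrite <- RtoC_mult, <- RtoC_inv, <- RtoC_mult by lra.
    f_equal; field; lra.
Qed.

Definition real_gauss1 (t s : R) : R := - s / (2 * t) * real_gauss t s.

(* By the heat equation, this is both the second derivative in [s] and the
   derivative in [t] of [real_gauss]. *)
Definition real_gauss2 (t s : R) : R :=
  real_gauss t s * (s ^ 2 / (4 * t ^ 2) - 1 / (2 * t)).

Lemma dgauss_RtoC (t s : R) : 0 < t -> dgauss (RtoC t) s = RtoC (real_gauss2 t s).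
Proof.
  intros ht; unfold dgauss; rewrite gauss_RtoC by exact ht; unfold real_gauss2.
  rewrite RtoC_mult, RtoC_minus, !RtoC_div by nra.
  rewrite !RtoC_mult, !RtoC_pow; do 2 f_equal; f_equal; ring.
Qed.

Lemma real_gauss_derive (t s : R) : 0 < t ->
  is_derive (real_gauss t) s (real_gauss1 t s).
Proof.
  intros ht; unfold real_gauss, real_gauss1, real_gauss.
  pose proof (sqrt_lt_R0 t ht); pose proof (sqrt_lt_R0 _ PI_RGT_0).
  auto_derive; [exact I |].
  replace (s * (s * 1)) with (s ^ 2) by ring.
  unfold Rdiv; field; lra.
Qed.

Lemma real_gauss1_derive (t s : R) : 0 < t ->
  is_derive (real_gauss1 t) s (real_gauss2 t s).
Proof.
  intros ht; unfold real_gauss2, real_gauss1, real_gauss.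
  pose proof (sqrt_lt_R0 t ht); pose proof (sqrt_lt_R0 _ PI_RGT_0).
  auto_derive; [exact I |].
  replace (s * (s * 1)) with (s ^ 2) by ring.
  unfold Rdiv; field; lra.
Qed.

Lemma real_gauss2_continuous (t s : R) : continuous (real_gauss2 t) s.
Proof.
  apply (ex_derive_continuous (V := R_NormedModule)).
  unfold real_gauss2, real_gauss; auto_derive; exact I.
Qed.

Lemma real_gauss_decay (t l : R) : 0 < t -> exists B, 0 <= B /\
  forall s, 0 <= s -> Rabs (real_gauss t s) <= B * exp (- l * s).
Proof.
  intros ht; destruct (gauss_rapidly_decreasing (RtoC t) ht l) as [B [hB h]].
  exists B; split; [exact hB |].
  intros s hs; specialize (h s hs).
  rewrite gauss_RtoC, Cmod_R in h by exact ht; exact h.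
Qed.

Lemma real_gauss1_decay (t l : R) : 0 < t -> exists B, 0 <= B /\
  forall s, 0 <= s -> Rabs (real_gauss1 t s) <= B * exp (- l * s).
Proof.
  intros ht; destruct (real_gauss_decay t (l + 1) ht) as [B [hB h]].
  assert (h2t : 0 < / (2 * t)) by (apply Rinv_0_lt_compat; lra).
  exists (/ (2 * t) * B); split; [apply Rmult_le_pos; lra |].
  intros s hs; specialize (h s hs).
  unfold real_gauss1, Rdiv; rewrite !Rabs_mult, Rabs_Ropp, (Rabs_pos_eq s),
    (Rabs_pos_eq (/ _)) by lra.
  replace (- l * s) with (s + - (l + 1) * s) by ring.
  rewrite exp_plus.
  pose proof (le_exp s hs).
  replace (s * / (2 * t) * Rabs (real_gauss t s))
    with (/ (2 * t) * (s * Rabs (real_gauss t s))) by ring.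
  replace (/ (2 * t) * B * (exp s * exp (- (l + 1) * s)))
    with (/ (2 * t) * (exp s * (B * exp (- (l + 1) * s)))) by ring.
  apply Rmult_le_compat_l; [lra |].
  apply Rmult_le_compat; [lra | apply Rabs_pos | lra | exact h].
Qed.

Lemma filterlim_zero_exp (f : R -> ER) (B : R) :
  (forall s, 0 <= s -> norm (f s) <= B * exp (- s)) ->
  filterlim f (Rbar_locally p_infty) (locally (zero : ER)).
Proof.
  intros h.
  apply (filterlim_norm_zero (V := CompleteNormedModule.NormedModule _ ER)).
  apply (filterlim_le_le (F := Rbar_locally p_infty) (fun _ => 0) _
           (fun s => B * exp (- s)) (Finite 0)).
  - exists 0; intros s hs; split; [apply norm_ge_0 | apply h; lra].
  - apply filterlim_const.
  - apply (filterlim_comp _ _ _ (fun s => exp (- s)) (fun y => B * y) _ (locally 0)).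
    + apply (filterlim_comp _ _ _ Ropp exp _ (Rbar_locally m_infty)).
      * apply (filterlim_Rbar_opp p_infty).
      * apply is_lim_exp_m.
    + pose proof (filterlim_scal_r (V := R_NormedModule) B 0) as hB.
      change (scal B 0) with (B * 0) in hB; rewrite Rmult_0_r in hB; exact hB.
Qed.

Lemma transform_dgauss_parts (c : R -> E) (N w t : R) :
  0 < t -> 0 <= w -> exp_growth c N w ->
  transform (dgauss (RtoC t)) (primitive (primitive c))
  = transform (gauss (RtoC t)) c.
Proof.
  intros ht hw hc.
  assert (hw1 : 0 <= w + 1) by lra.
  pose proof (primitive_growth c N w hw hc) as hc1.
  pose proof (primitive_growth _ N (w + 1) hw1 hc1) as hc2.
  pose proof (exp_growth_nonneg E c N w hc) as hN.
  apply (half_line_integral_by_parts ER (real_gauss t) (real_gauss1 t) (real_gauss2 t)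
    (primitive (primitive c)) (primitive c) c).
  - intros s; apply real_gauss_derive, ht.
  - intros s; apply real_gauss1_derive, ht.
  - intros s; apply real_gauss2_continuous.
  - intros s; apply primitive_derive, hc1.
  - intros s; apply primitive_derive, hc.
  - apply hc.
  - apply primitive_0.
  - apply primitive_0.
  (* Each of the two primitives raised the growth rate by 1; the third unit leaves the factor
     [exp (- s)] that makes the boundary term vanish at infinity. *)
  - destruct (real_gauss1_decay t (w + 1 + 1 + 1) ht) as [B [hB h]].
    apply (filterlim_zero_exp _ (B * N)); intros s hs.
    replace (- s) with (- 1 * s) by ring.
    apply (norm_kernel E (fun s => RtoC (real_gauss1 t s)) _ N (w + 1 + 1) B 1 s hc2 hs).
    rewrite Cmod_R; replace (1 + (w + 1 + 1)) with (w + 1 + 1 + 1) by ring.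
    apply h, hs.
  - destruct (real_gauss_decay t (w + 1 + 1) ht) as [B [hB h]].
    apply (filterlim_zero_exp _ (B * N)); intros s hs.
    replace (- s) with (- 1 * s) by ring.
    apply (norm_kernel E (fun s => RtoC (real_gauss t s)) _ N (w + 1) B 1 s hc1 hs).
    rewrite Cmod_R; replace (1 + (w + 1)) with (w + 1 + 1) by ring.
    apply h, hs.
  - refine (is_RInt_gen_ext (V := ER) _ _ _ _
      (transform_correct E _ _ N _ (dgauss_admissible (RtoC t) ht) hc2)).
    exists (fun _ => True) (fun _ => True); try apply filter_true.
    intros a b _ _ s _; rewrite dgauss_RtoC by exact ht; reflexivity.
  - refine (is_RInt_gen_ext (V := ER) _ _ _ _
      (transform_correct E _ _ N _ (gauss_admissible (RtoC t) ht) hc)).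
    exists (fun _ => True) (fun _ => True); try apply filter_true.
    intros a b _ _ s _; rewrite gauss_RtoC by exact ht; reflexivity.
Qed.

Lemma integral_gauss_family (c : R -> E) (N w t : R) :
  0 < t -> 0 <= w -> exp_growth c N w -> c 0 = zero ->
  integral (gauss_family c) 0 t
  = transform (gauss (RtoC t)) (primitive (primitive c)).
Proof.
  intros ht hw hc hc0.
  assert (hw1 : 0 <= w + 1) by lra.
  pose proof (primitive_growth c N w hw hc) as hc1.
  pose proof (primitive_growth _ N (w + 1) hw1 hc1) as hc2.
  assert (hcS : forall s, continuous (gauss_family c) s)
    by (intros s; apply (gauss_family_continuous c N w); assumption).
  assert (hcW : forall s, continuous (gauss_family (primitive (primitive c))) s)
    by (intros s; apply (gauss_family_continuous _ N (w + 1 + 1));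
        [lra | assumption | apply primitive_0]).
  rewrite <- gauss_family_pos by exact ht.
  set (W := gauss_family (primitive (primitive c))) in *.
  set (P := primitive (gauss_family c)).
  change (P t = W t).
  assert (hP : forall s, @is_derive R_AbsRing ER P s (gauss_family c s))
    by (intros s; apply primitive_derive, hcS).
  assert (hcP : forall s, continuous P s).
  { intros s; apply (ex_derive_continuous (V := ER)); eexists; apply hP. }
  (* [P - W] has zero derivative on [(0, t]] and tends to 0 at 0. *)
  assert (hdiff : forall e, 0 < e <= t -> minus (P t) (P e) = minus (W t) (W e)).
  { intros e he.
    assert (i1 : @is_RInt ER (gauss_family c) e t (minus (P t) (P e))).
    { apply (is_RInt_derive (V := ER)); intros; [apply hP | apply hcS]. }
    assert (i2 : @is_RInt ER (gauss_family c) e t (minus (W t) (W e))).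
    { apply (is_RInt_derive (V := ER)); rewrite Rmin_left, Rmax_right by lra;
        intros x hx; [| apply hcS].
      rewrite gauss_family_pos by lra.
      rewrite <- (transform_dgauss_parts c N w x) by (try assumption; lra).
      apply (gauss_family_derive _ N (w + 1 + 1)); [lra | exact hc2]. }
    rewrite <- (is_RInt_unique (V := ER) _ _ _ _ i1).
    exact (is_RInt_unique (V := ER) _ _ _ _ i2). }
  assert (hlim : forall f : R -> E, (forall s, continuous f s) -> f 0 = zero ->
    filterlim (fun e => minus (f t) (f e)) (at_right 0) (locally (f t))).
  { intros f hf hf0.
    assert (h : filterlim (fun e => minus (f t) (f e)) (locally 0)
                  (locally (minus (f t) (f 0)))).
    { exact (continuous_minus (V := CompleteNormedModule.NormedModule _ E)
               (fun _ => f t) f 0 (continuous_const (f t) 0) (hf 0)). }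
    rewrite hf0, minus_zero_E in h.
    apply filterlim_filter_le_1 with (2 := h), filter_le_within. }
  assert (h1 := hlim P hcP (primitive_0 _)).
  assert (h2 := hlim W hcW (gauss_family_nonpos _ 0 (Rle_refl 0))).
  assert (h3 : filterlim (fun e => minus (P t) (P e)) (at_right 0) (locally (W t))).
  { apply filterlim_ext_loc with (2 := h2).
    exists (mkposreal t ht); intros e he he0.
    change (Rabs (e - 0) < t) in he.
    rewrite Rminus_0_r, Rabs_pos_eq in he by lra.
    symmetry; apply hdiff; lra. }
  exact (filterlim_locally_unique (V := CompleteNormedModule.NormedModule _ E)
           _ _ _ h1 h3).
Qed.

(** Cauchy's formula for repeated integration, by one integration by parts. It turns the integral in
    the cosine axiom into the second primitive used for the semigroup. *)
Lemma integral_convolution (c : R -> E) (t : R) :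
  (forall s, continuous c s) ->
  integral (fun s => scal (RtoC (t - s)) (c s)) 0 t = primitive (primitive c) t.
Proof.
  intros hc; apply (is_RInt_unique (V := ER)).
  assert (hc1 : forall s, continuous (primitive c) s)
    by (intros s; apply (ex_derive_continuous (V := ER)); eexists;
        apply primitive_derive, hc).
  assert (hI : @is_RInt ER (fun s => scal (-1) (primitive c s : ER)) 0 t
                 (scal (-1) (primitive (primitive c) t : ER))).
  { apply (is_RInt_scal (V := ER)), (RInt_correct (V := ER)),
      (ex_RInt_continuous (V := ER)).
    intros z _; apply hc1. }
  pose proof (is_RInt_scal_derive_r (V := ER) (fun r => t - r) (primitive c)
    (fun _ => -1) c 0 t) as h.
  specialize (h (scal (-1) (primitive (primitive c) t : ER))).
  cbv beta in h.
  refine (eq_rect _ (fun z => @is_RInt ER _ 0 t z) (h _ _ _ _ hI) _ _).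
  - intros r _; auto_derive; [exact I | ring].
  - intros r _; apply primitive_derive, hc.
  - intros r _; apply continuous_const.
  - intros r _; apply hc.
  - rewrite primitive_0, Rminus_diag.
    exact (convolution_terms (V := CompleteNormedModule.ModuleSpace _ ER) _ _ _).
Qed.

End GaussFamily.

(** * Lebesgue integrals and the kernel K1 *)

Module LebesgueReal.

Import all_boot all_order all_algebra all_classical all_reals all_analysis.
Import measurable_realfun Rstruct Rstruct_topology.
Import Order.TTheory GRing.Theory Num.Theory.
Import numFieldNormedType.Exports.
Local Open Scope classical_set_scope.
Local Open Scope ring_scope.

Local Notation R := Rdefinitions.R.
Local Notation mR := (measurableTypeR R).
Local Notation mu := (@lebesgue_measure R).
Local Notation "x <=' y" := (Rle x y) (at level 70).
Local Notation "x <' y" := (Rlt x y) (at level 70).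

Definition Rint (D : set R) (f : R -> R) : R := \int[mu]_(s in D) f s.

Definition Rintegrable (D : set R) (f : R -> R) : Prop :=
  mu.-integrable D (EFin \o f).

Lemma integrable_segmentS (f : R -> R) (a b : R) : a <= b ->
  Rintegrable (Lebesgue.segment b) f -> Rintegrable (Lebesgue.segment a) f.
Proof.
move=> ab; apply: integrableS; rewrite /Lebesgue.segment //.
by apply: subset_itvl; rewrite bnd_simp.
Qed.

Lemma measurable_continuous (p : R -> R) (D : set mR) :
  (forall s, continuity_pt p s) -> measurable D ->
  measurable_fun D (p : mR -> mR).
Proof.
move=> cp mD; apply: measurable_funTS.
by apply: continuous_measurable_fun => s; apply/continuity_pt_cvg.
Qed.

Lemma integrable_mul_bounded (p k : R -> R) (D : set mR) (B : R) :
  measurable D -> (forall s, continuity_pt p s) ->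
  (forall s, D s -> `|p s| <= B) -> Rintegrable D k ->
  Rintegrable D (fun s => p s * k s).
Proof.
move=> mD cp pB ik.
have mp : measurable_fun D (p : mR -> mR) by exact: measurable_continuous.
apply: (@integrableMr _ _ _ mu _ mD p (EFin \o k)) => //.
exists B; split; first by rewrite num_real.
by move=> x Bx s Ds; apply: (le_trans (pB s Ds)); apply: ltW.
Qed.

(** The left side is the integral of [(p - q) k] over []a, b]]. With [q] a value of [p], this is the
    error of freezing a smooth factor against a merely bounded one. *)
Lemma Rint_diff_bound (p k : R -> R) (a b q B C1 C2 : R) :
  0 <= a -> a <= b -> (forall s, continuity_pt p s) ->
  (forall s, 0 <= s -> `|p s| <= B) ->
  Rintegrable (Lebesgue.segment b) k ->
  Lebesgue.ae_nonneg (fun s => s <= b -> `|k s| <= C2) ->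
  0 <= C1 -> 0 <= C2 ->
  (forall s, a <= s -> s <= b -> `|p s - q| <= C1) ->
  `|(Rint (Lebesgue.segment b) (fun s => p s * k s)
      - Rint (Lebesgue.segment a) (fun s => p s * k s))
    - q * (Rint (Lebesgue.segment b) k - Rint (Lebesgue.segment a) k)|
  <= C1 * C2 * (b - a).
Proof.
move=> a0 ab cp pB ik kC C10 C20 pC.
have b0 : 0 <= b by exact: le_trans ab.
have mseg t : measurable (Lebesgue.segment t : set mR) by rewrite /Lebesgue.segment.
have ipk : Rintegrable (Lebesgue.segment b) (fun s => p s * k s).
  apply: (@integrable_mul_bounded _ _ _ B) => // s.
  by rewrite /Lebesgue.segment /= in_itv /= => /andP[s0 _]; exact: pB.
pose I := `]a, b]%classic : set mR.
have sub : I `<=` Lebesgue.segment b.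
  by rewrite /I /Lebesgue.segment => s /=; rewrite !in_itv /= => /andP[/ltW as_ ->];
    rewrite andbT (le_trans a0).
have mI : measurable I by rewrite /I; exact: measurable_itv.
have iI (f : R -> R) : Rintegrable (Lebesgue.segment b) f -> Rintegrable I f.
  by apply: integrableS.
have diff (f : R -> R) : Rintegrable (Lebesgue.segment b) f ->
    Rint (Lebesgue.segment b) f - Rint (Lebesgue.segment a) f = Rint I f.
  move=> fi; rewrite /Rint /Lebesgue.segment Rintegral_itvB //.
rewrite !diff // /Rint -RintegralZl //; last exact: iI ik.
rewrite -RintegralB //; [|exact: iI ipk|]; last first.
  apply: iI; by apply: (@integrable_mul_bounded (fun=> q) _ _ `|q|) => //;
    move=> s; apply: continuity_pt_const.
have iq : Rintegrable I (fun s => p s * k s - q * k s).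
  apply: (@integrableB _ _ _ mu _ _ (fun s => (p s * k s)%:E) (fun s => (q * k s)%:E)) => //.
    exact: iI ipk.
  apply: iI; by apply: (@integrable_mul_bounded (fun=> q) _ _ `|q|) => //;
    move=> s; apply: continuity_pt_const.
rewrite -lee_fin EFin_normr_Rintegral //.
apply: (le_trans (le_abse_integral _ mI _)) => //.
  by case/integrableP: iq.
have -> : ((C1 * C2 * (b - a))%:E = (C1 * C2)%:E * mu I)%E.
  rewrite /I lebesgue_measure_itv /= lte_fin; move: ab; rewrite le_eqVlt.
  case/predU1P => [->|ab]; first by rewrite ltxx subrr mulr0 mule0.
  by rewrite ab EFinM EFinB.
apply: integral_le_bound => //.
- by case/integrableP: iq.
- by rewrite lee_fin mulr_ge0.
- move: kC; rewrite /Lebesgue.ae_nonneg; apply: (@filterS _ _ (ae_filter_ringOfSetsType mu)) => s kC.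
  rewrite /I /= in_itv /= => /andP[/ltW as_ sb].
  rewrite lee_fin -mulrBl normrM ler_pM //.
    exact: pC.
  by apply: kC => //; exact: le_trans as_.
Qed.

Lemma Rintegral_fineK (D : set mR) (f : R -> R) :
  measurable D -> Rintegrable D f ->
  (\int[mu]_(s in D) (f s)%:E = (Rint D f)%:E)%E.
Proof. by move=> mD fi; rewrite /Rint /Rintegral fineK //; exact: integrable_fin_num. Qed.

(** Monotone convergence applied to the absolute value gives integrability on the union. Signed
    convergence then follows from [f = (f + |f|) - |f|], a difference of nonnegative integrable
    functions. *)
Lemma increasing_union_integral (F : nat -> set mR) (f : R -> R) (B : R) :
  nondecreasing_seq F -> (forall i, measurable (F i)) ->
  (forall i, Rintegrable (F i) f) ->
  (forall i, Rint (F i) (fun s => `|f s|) <= B) ->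
  Rintegrable (\bigcup_i F i) f /\
  (Rint (F i) f @[i --> \oo] --> Rint (\bigcup_i F i) f).
Proof.
move=> ndF mF fi fB.
set U := \bigcup_i F i.
have mU : measurable U by exact: bigcupT_measurable.
have mfi i : measurable_fun (F i) (f : mR -> mR).
  by have /integrableP[/measurable_EFinP] := fi i.
have mf : measurable_fun U (f : mR -> mR) by apply/measurable_fun_bigcup.
have absi i : Rintegrable (F i) (fun s => `|f s|).
  by apply: integrable_norm; exact: fi.
have cvg_pos (g : R -> R) : (forall s, 0 <= g s) -> measurable_fun U (g : mR -> mR) ->
    (\int[mu]_(s in F i) (g s)%:E @[i --> \oo] --> \int[mu]_(s in U) (g s)%:E)%E.
  move=> g0 mg; apply: ge0_nondecreasing_set_cvg_integral => //.
  - move=> i; apply/measurable_EFinP; apply: measurable_funS mg => //.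
    exact: bigcup_sup.
  - by move=> i x _; rewrite lee_fin.
have mabs : measurable_fun U ((fun s => `|f s|) : mR -> mR).
  apply/measurable_fun_bigcup => // i.
  by have /integrableP[/measurable_EFinP] := absi i.
have absU : Rintegrable U f.
  apply/integrableP; split; first exact/measurable_EFinP.
  apply: (@le_lt_trans _ _ B%:E); last by rewrite ltry.
  have h := cvg_pos (fun s => `|f s|) (fun s => normr_ge0 _) mabs.
  rewrite -(cvg_lim _ h) //; apply: lime_le; first by apply/cvg_ex; eexists; exact: h.
  by apply: nearW => i; rewrite Rintegral_fineK // lee_fin.
split=> //.
have cvg_real (g : R -> R) : (forall s, 0 <= g s) -> Rintegrable U g ->
    Rint (F i) g @[i --> \oo] --> Rint U g.
  move=> g0 gi; apply: fine_cvg; rewrite -Rintegral_fineK //.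
  by apply: cvg_pos => //; have /integrableP[/measurable_EFinP] := gi.
have absU' : Rintegrable U (fun s => `|f s|) by exact: integrable_norm.
have fabsU : Rintegrable U (fun s => f s + `|f s|).
  exact: (@integrableD _ _ _ mu U mU (EFin \o f) (fun s => (`|f s|)%:E)).
have subF i : F i `<=` U by exact: bigcup_sup.
have splitD (D : set mR) : measurable D -> D `<=` U ->
    Rint D f = Rint D (fun s => f s + `|f s|) - Rint D (fun s => `|f s|).
  move=> mD DU; rewrite /Rint RintegralD //; [by rewrite addrK| |].
    exact: integrableS absU.
  exact: integrableS absU'.
rewrite splitD //.
rewrite (_ : (fun i => Rint (F i) f) = (fun i => Rint (F i) (fun s => f s + `|f s|)
   - Rint (F i) (fun s => `|f s|))); last by apply/funext => i; rewrite splitD.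
apply: (@cvgB _ R^o); apply: cvg_real => // s.
by rewrite -lerBlDr sub0r; apply: lerNnormlW.
Qed.

Lemma derivable_pt_lim_cvg (f : R -> R) (x l : R) : derivable_pt_lim f x l ->
  (h^-1 *: ((f : R^o -> R^o) (h *: (1 : R^o) + x) - f x)) @[h --> (0 : R^o)^'] --> l.
Proof.
move=> hf; apply/cvgrPdist_lt => e e0.
move/RltP: e0 => e0; have [d hd] := hf e e0.
have d0 : 0 < (d : R) by apply/RltP; case: d {hd}.
exists (d : R) => //= h; rewrite /ball_ /= sub0r normrN => hlt h0.
move/RltP: hlt; rewrite -RabsE => hlt; move/eqP: h0 => h0.
have := hd h h0 hlt; rewrite !RealsE => /RltP.
by rewrite distrC /GRing.scale /= mulr1 (addrC h) mulrC.
Qed.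

Lemma FTC (F f : R -> R) (a b : R) : a < b ->
  (forall x, a <= x -> x <= b -> derivable_pt_lim F x (f x)) ->
  (forall x, a <= x -> x <= b -> continuity_pt f x) ->
  Rintegrable (`[a, b]%classic : set mR) f /\
  Rint (`[a, b]%classic : set mR) f = F b - F a.
Proof.
move=> ab dF cf.
have wcf : {within `[a, b], continuous f}.
  apply/continuous_subspace_in_itv || apply: continuous_in_subspaceT => x.
  by rewrite inE /= in_itv /= => /andP[ax xb]; apply/continuity_pt_cvg; exact: cf.
have fi : Rintegrable (`[a, b]%classic : set mR) f.
  by apply: continuous_compact_integrable => //; exact: segment_compact.
split=> //.
have cF x : a <= x -> x <= b -> {for x, continuous F}.
  move=> ax xb; apply/continuity_pt_cvg.
  by apply: derivable_continuous_pt; exists (f x); exact: dF.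
rewrite /Rint /Rintegral (@continuous_FTC2 _ f F) //.
- split.
  + move=> x; rewrite in_itv /= => /andP[/ltW ax /ltW xb].
    by apply/cvg_ex; exists (f x); apply: derivable_pt_lim_cvg; exact: dF.
  + by apply: cvg_at_right_filter; apply: cF => //; exact: ltW.
  + by apply: cvg_at_left_filter; apply: cF => //; exact: ltW.
- move=> x; rewrite in_itv /= => /andP[/ltW ax /ltW xb].
  rewrite derive1E /derive; apply: (@cvg_lim R^o) => //.
  exact: (derivable_pt_lim_cvg _ _ _ (dF x ax xb)).
Qed.

Definition interval (a b : R) : set R := `[a, b].

Lemma Un_cv_cvg (u : nat -> R) (l : R) : u n @[n --> \oo] --> l -> Un_cv u l.
Proof.
move=> h e /RltP e0.
have [N _ hN] := @cvgr_dist_lt _ R^o _ _ _ _ _ h e e0.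
exists N => n /ssrnat.leP Nn; rewrite /R_dist !RealsE; apply/RltP.
by rewrite distrC; exact: hN.
Qed.

(** [Rint_diff_bound] phrased with the order and absolute value of the standard library, the form
    used outside this module. *)
Lemma Rint_increment (p k : R -> R) (a b q B C1 C2 : R) :
  0%coqR <=' a -> a <=' b -> (forall s, continuity_pt p s) ->
  (forall s, 0%coqR <=' s -> Rabs (p s) <=' B) ->
  Rintegrable (Lebesgue.segment b) k ->
  Lebesgue.ae_nonneg (fun s => s <=' b -> Rabs (k s) <=' C2) ->
  0%coqR <=' C1 -> 0%coqR <=' C2 ->
  (forall s, a <=' s -> s <=' b -> Rabs (Rminus (p s) q) <=' C1) ->
  Rabs (Rminus (Rminus (Rint (Lebesgue.segment b) (fun s => Rmult (p s) (k s)))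
      (Rint (Lebesgue.segment a) (fun s => Rmult (p s) (k s))))
    (Rmult q (Rminus (Rint (Lebesgue.segment b) k) (Rint (Lebesgue.segment a) k))))
  <=' Rmult (Rmult C1 C2) (Rminus b a).
Proof.
move=> /RleP a0 /RleP ab cp pB ik kC /RleP C10 /RleP C20 pC.
rewrite RabsE; apply/RleP; apply: (@Rint_diff_bound _ _ _ _ _ B) => //.
- by move=> s /RleP s0; rewrite -RabsE; apply/RleP; exact: pB.
- move: kC; rewrite /Lebesgue.ae_nonneg.
  apply: (@filterS _ _ (ae_filter_ringOfSetsType mu)) => s kC s0 sb.
  by rewrite -RabsE; apply/RleP; apply: kC => //; apply/RleP.
- move=> s /RleP as_ /RleP sb; rewrite -RminusE -RabsE.
  by apply/RleP; exact: pC.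
Qed.

Lemma Rint_abs_le (D : set mR) (f g : R -> R) :
  measurable D -> D `<=` Lebesgue.half_line ->
  Rintegrable D f -> Rintegrable D g ->
  (forall s, 0%coqR <=' g s) ->
  Lebesgue.ae_nonneg (fun s => D s -> Rabs (f s) <=' g s) ->
  Rint D (fun s => `|f s|) <= Rint D g.
Proof.
move=> mD sD fi gi g0 fg.
rewrite -lee_fin -!Rintegral_fineK //; last exact: integrable_norm.
apply: ae_ge0_le_integral => //.
- have : Rintegrable D (fun s => `|f s|) by exact: integrable_norm.
  by case/integrableP.
- by move=> x _; rewrite lee_fin; apply/RleP.
- by case/integrableP : gi.
- move: fg; rewrite /Lebesgue.ae_nonneg.
  apply: (@filterS _ _ (ae_filter_ringOfSetsType mu)) => s fg Ds.
  rewrite lee_fin -RabsE; apply/RleP; apply: fg => //.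
  by have := sD s Ds; rewrite /Lebesgue.half_line /= in_itv /= andbT.
Qed.

Lemma Rint_half_line (f : R -> R) (B : R) :
  (forall n, Rintegrable (Lebesgue.segment (INR n)) f) ->
  (forall n, Rint (Lebesgue.segment (INR n)) (fun s => `|f s|) <= B) ->
  Rintegrable Lebesgue.half_line f /\
  Un_cv (fun n => Rint (Lebesgue.segment (INR n)) f) (Rint Lebesgue.half_line f).
Proof.
move=> fi fB.
have U : Lebesgue.half_line = \bigcup_n Lebesgue.segment (INR n).
  apply/seteqP; split => s; rewrite /Lebesgue.half_line /Lebesgue.segment /= in_itv /=.
    rewrite andbT => s0.
    have [n sn] : exists n, s <= INR n.
      by exists (Num.truncn s).+1; rewrite INRE; apply: ltW; exact: truncnS_gt.
    by exists n => //=; rewrite in_itv /= s0.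
  by move=> [n _] /=; rewrite !in_itv /= => /andP[->].
rewrite U.
have [| | | |h1 h2] := @increasing_union_integral
    (fun n => Lebesgue.segment (INR n) : set mR) f B; last first.
- by split => //; exact: Un_cv_cvg h2.
- exact: fB.
- exact: fi.
- by move=> n; rewrite /Lebesgue.segment; exact: measurable_itv.
- move=> m n mn; rewrite subsetEset /Lebesgue.segment.
  by apply: subset_itvl; rewrite bnd_simp !INRE ler_nat.
Qed.

(** For integrands singular at 0: the segments exhaust []0, t]], and the point 0 is negligible. The
    denominator starts at 2 so that every left end is strictly below [t], as the fundamental theorem
    requires. *)
Lemma Rint_punctured (t : R) (f : R -> R) (B : R) : 0%coqR <' t ->
  (forall n, Rintegrable (interval (t / (n.+2)%:R) t) f) ->
  (forall n, Rint (interval (t / (n.+2)%:R) t) (fun s => `|f s|) <= B) ->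
  Rintegrable (Lebesgue.segment t) f /\
  Un_cv (fun n => Rint (interval (t / (n.+2)%:R) t) f) (Rint (Lebesgue.segment t) f).
Proof.
move=> /RltP t0 fi fB.
have U : (`]0%coqR, t]%classic : set R) = \bigcup_n interval (t / (n.+2)%:R) t.
  apply/seteqP; split => s; rewrite /interval /= in_itv /=.
    move=> /andP[s0 st]; exists (Num.truncn (t / s)) => //=.
    rewrite in_itv /= st andbT ler_pdivrMr // mulrC -ler_pdivrMr //.
    apply: ltW; apply: (lt_le_trans (truncnS_gt _)); by rewrite ler_nat.
  move=> [n _] /=; rewrite !in_itv /= => /andP[h ->]; rewrite andbT.
  by apply: lt_le_trans h; rewrite divr_gt0.
have [| | | |h1 h2] := @increasing_union_integral
    (fun n => interval (t / (n.+2)%:R) t : set mR) f B; last first.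
- rewrite -U in h1 h2.
  have h3 : Rintegrable (Lebesgue.segment t) f.
    have /integrableP[m1 m2] := h1; apply/integrableP; split.
      exact/emeasurable_fun_itv_obnd_cbndP.
    rewrite /Lebesgue.segment -integral_itv_obnd_cbnd //.
    exact: measurableT_comp.
  split => //.
  rewrite /Rint /Lebesgue.segment -Rintegral_itv_obnd_cbnd //; exact: Un_cv_cvg h2.
- exact: fB.
- exact: fi.
- by move=> n; rewrite /interval; exact: measurable_itv.
- move=> m n mn; rewrite subsetEset /interval.
  apply: subset_itvr; rewrite bnd_simp ler_pM2l // lef_pV2 ?posrE // ler_nat //.
Qed.

Lemma Rint_segment0 (f : R -> R) : Rint (Lebesgue.segment 0%coqR) f = 0%coqR.
Proof. by rewrite /Rint /Lebesgue.segment set_itv1 Rintegral_set1. Qed.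

Lemma Rint_half_line_dominated (f g : R -> R) (B : R) :
  (forall n, Rintegrable (Lebesgue.segment (INR n)) f) ->
  (forall n, Rintegrable (Lebesgue.segment (INR n)) g) ->
  (forall n, Rint (Lebesgue.segment (INR n)) g <=' B) ->
  (forall s, 0%coqR <=' g s) ->
  Lebesgue.ae_nonneg (fun s => Rabs (f s) <=' g s) ->
  Rintegrable Lebesgue.half_line f /\
  Un_cv (fun n => Rint (Lebesgue.segment (INR n)) f) (Rint Lebesgue.half_line f).
Proof.
move=> fi gi gB g0 fg; apply: (@Rint_half_line _ B) => // n.
apply: (@le_trans _ _ (Rint (Lebesgue.segment (INR n)) g)); last exact/RleP.
apply: Rint_abs_le => //.
- by rewrite /Lebesgue.segment; exact: measurable_itv.
- rewrite /Lebesgue.segment /Lebesgue.half_line => s /=.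
  by rewrite !in_itv /= andbT => /andP[].
- move: fg; rewrite /Lebesgue.ae_nonneg.
  by apply: (@filterS _ _ (ae_filter_ringOfSetsType mu)) => s fg s0 _; exact: fg.
Qed.

Lemma Rint_segment_improper (t : R) (f g : R -> R) (B : R) : 0%coqR <' t ->
  (forall a, 0%coqR <' a -> a <' t -> Rintegrable (interval a t) f) ->
  (forall a, 0%coqR <' a -> a <' t -> Rintegrable (interval a t) g) ->
  (forall a, 0%coqR <' a -> a <' t -> Rint (interval a t) g <=' B) ->
  (forall s, 0%coqR <=' g s) ->
  (forall s, 0%coqR <' s -> s <=' t -> Rabs (f s) <=' g s) ->
  Rintegrable (Lebesgue.segment t) f /\
  Un_cv (fun n => Rint (interval (Rdiv t (INR n.+2)) t) f)
    (Rint (Lebesgue.segment t) f).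
Proof.
move=> t0 fi gi gB g0 fg.
have t0' : 0 < t by apply/RltP.
have E n : Rdiv t (INR n.+2) = t / (n.+2)%:R by rewrite RdivE INRE.
have a0 n : 0%coqR <' (t / (n.+2)%:R) by apply/RltP; rewrite divr_gt0.
have at_ n : (t / (n.+2)%:R) <' t.
  by apply/RltP; rewrite ltr_pdivrMr // ltr_pMr // ltr1n.
rewrite (_ : (fun n => Rint (interval (Rdiv t (INR n.+2)) t) f) =
   (fun n => Rint (interval (t / (n.+2)%:R) t) f)); last first.
  by apply/funext => n; rewrite E.
apply: (@Rint_punctured _ _ B) => // n; first exact: fi.
apply: (@le_trans _ _ (Rint (interval (t / (n.+2)%:R) t) g)); last by apply/RleP; exact: gB.
apply: Rint_abs_le => //.
- by rewrite /interval; exact: measurable_itv.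
- rewrite /interval /Lebesgue.half_line => s /=; rewrite !in_itv /= andbT => /andP[h _].
  by apply: le_trans h; apply: ltW; apply/RltP.
- exact: fi.
- exact: gi.
- rewrite /Lebesgue.ae_nonneg.
  apply: (@filterS _ _ (ae_filter_ringOfSetsType mu) setT); last first.
    exact: (@filterT _ _ (ae_filter_ringOfSetsType mu)).
  move=> s _ s0; rewrite /interval /= in_itv /= => /andP[h1 h2].
  apply: fg; last exact/RleP.
  by apply/RltP; apply: lt_le_trans h1; apply/RltP.
Qed.

Lemma Rint_FTC (F f : R -> R) (a b : R) : a <' b ->
  (forall x, a <=' x -> x <=' b -> derivable_pt_lim F x (f x)) ->
  (forall x, a <=' x -> x <=' b -> continuity_pt f x) ->
  Rintegrable (interval a b) f /\ Rint (interval a b) f = Rminus (F b) (F a).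
Proof.
move=> /RltP ab dF cf; apply: FTC => // x /RleP ax /RleP xb; [exact: dF|exact: cf].
Qed.

Lemma Rintegrable_segment_le (f : R -> R) (a b : R) : a <=' b ->
  Rintegrable (Lebesgue.segment b) f -> Rintegrable (Lebesgue.segment a) f.
Proof. by move=> /RleP; exact: integrable_segmentS. Qed.

Lemma Rintegrable_mul (p k : R -> R) (b B : R) :
  (forall s, continuity_pt p s) -> (forall s, 0%coqR <=' s -> Rabs (p s) <=' B) ->
  Rintegrable (Lebesgue.segment b) k ->
  Rintegrable (Lebesgue.segment b) (fun s => Rmult (p s) (k s)).
Proof.
move=> cp pB ik; apply: (@integrable_mul_bounded _ _ _ B) => //.
  by rewrite /Lebesgue.segment; exact: measurable_itv.
move=> s; rewrite /Lebesgue.segment /= in_itv /= => /andP[s0 _].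
by rewrite -RabsE; apply/RleP; apply: pB; apply/RleP.
Qed.

Lemma ae_nonneg_imp (P Q : R -> Prop) :
  (forall s, 0%coqR <=' s -> P s -> Q s) ->
  Lebesgue.ae_nonneg P -> Lebesgue.ae_nonneg Q.
Proof.
move=> PQ; rewrite /Lebesgue.ae_nonneg.
apply: (@filterS _ _ (ae_filter_ringOfSetsType mu)) => s hP s0.
by apply: PQ; [exact/RleP|exact: hP].
Qed.

End LebesgueReal.

Import LebesgueReal.

(** Cut [[0, T]] into [n + 1] equal pieces: the increments add up to at most [D * T ^ 2 / (n + 1)],
    for every [n]. *)
Lemma quadratic_increment_constant (f : R -> R) (D T : R) : 0 <= T ->
  (forall a b, 0 <= a -> a <= b -> b <= T -> Rabs (f b - f a) <= D * (b - a) ^ 2) ->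
  f T = f 0.
Proof.
  intros hT h.
  assert (hD : 0 <= D * T ^ 2).
  { pose proof (h 0 T (Rle_refl 0) hT (Rle_refl T)) as h0.
    rewrite Rminus_0_r in h0; apply Rle_trans with (2 := h0), Rabs_pos. }
  assert (hn : forall n : nat, Rabs (f T - f 0) <= D * T ^ 2 / INR (S n)).
  { intros n; pose proof (lt_0_INR (S n) (Nat.lt_0_succ n)) as hN.
    set (d := T / INR (S n)).
    assert (hd : 0 <= d) by (apply Rdiv_le_0_compat; assumption).
    assert (hj : forall j, (j <= S n)%nat ->
              Rabs (f (INR j * d) - f 0) <= INR j * (D * d ^ 2)).
    { induction j as [| j IH]; intros hj.
      - rewrite !Rmult_0_l, Rminus_diag, Rabs_R0; lra.
      - assert (hj' : (j <= S n)%nat) by apply (Nat.le_trans _ _ _ (Nat.le_succ_diag_r j) hj).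
        specialize (IH hj').
        apply le_INR in hj; rewrite S_INR in hj |- *.
        pose proof (pos_INR j).
        assert (e1 : (INR j + 1) * d - INR j * d = d) by ring.
        assert (hs : Rabs (f ((INR j + 1) * d) - f (INR j * d)) <= D * d ^ 2).
        { rewrite <- e1 at 3; apply h; [apply Rmult_le_pos; assumption | lra |].
          apply Rle_trans with (INR (S n) * d).
          - apply Rmult_le_compat_r; assumption.
          - right; unfold d; field; lra. }
        replace (f ((INR j + 1) * d) - f 0)
          with ((f ((INR j + 1) * d) - f (INR j * d)) + (f (INR j * d) - f 0)) by ring.
        apply Rle_trans with (1 := Rabs_triang _ _); lra. }
    specialize (hj (S n) (Nat.le_refl _)).
    replace (INR (S n) * d) with T in hj by (unfold d; field; lra).
    replace (D * T ^ 2 / INR (S n)) with (INR (S n) * (D * d ^ 2))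
      by (unfold d; field; lra).
    exact hj. }
  apply Rminus_diag_uniq.
  destruct (Req_dec (f T - f 0) 0) as [e | hne]; [exact e | exfalso].
  apply Rabs_pos_lt in hne.
  destruct (nfloor_ex (D * T ^ 2 / Rabs (f T - f 0))) as [n [_ h1]].
  { apply Rdiv_le_0_compat; assumption. }
  specialize (hn n); rewrite S_INR in hn.
  pose proof (pos_INR n).
  apply (Rmult_lt_compat_r (Rabs (f T - f 0))) in h1; [| exact hne].
  unfold Rdiv in h1; rewrite Rmult_assoc, Rinv_l, Rmult_1_r in h1 by lra.
  apply (Rmult_le_compat_r (INR n + 1)) in hn; [| lra].
  unfold Rdiv in hn; rewrite Rmult_assoc, Rinv_l, Rmult_1_r in hn by lra.
  lra.
Qed.

Lemma Un_cv_exp_neg (B : R) (u : nat -> R) :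
  (forall n, Rabs (u n) <= B * exp (- INR n)) -> Un_cv u 0.
Proof.
  intros h; apply is_lim_seq_Reals.
  apply (is_lim_seq_le_le (fun n => - (B * exp (- INR n))) u
           (fun n => B * exp (- INR n)) 0).
  - intros n; specialize (h n); apply Rabs_le_between in h; exact h.
  - replace 0 with (- (B * 0)) by ring.
    apply (is_lim_seq_opp _ (Finite (B * 0))), (is_lim_seq_scal_l _ B 0).
    apply (filterlim_comp _ _ _ (fun n => - INR n) exp _ (Rbar_locally m_infty)).
    + apply (is_lim_seq_opp INR p_infty), is_lim_seq_INR.
    + apply is_lim_exp_m.
  - replace 0 with (B * 0) by ring.
    apply (is_lim_seq_scal_l _ B 0).
    apply (filterlim_comp _ _ _ (fun n => - INR n) exp _ (Rbar_locally m_infty)).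
    + apply (is_lim_seq_opp INR p_infty), is_lim_seq_INR.
    + apply is_lim_exp_m.
Qed.

(** * Integration by parts against a locally integrable function *)

Section PrimitiveOfLocallyIntegrable.

Variables (k : R -> R) (M beta : R).
Hypothesis hM : 0 <= M.
Hypothesis hbeta : 0 <= beta.
Hypothesis hk : forall t, 0 <= t -> Rintegrable (Lebesgue.segment t) k.
Hypothesis hbound :
  Lebesgue.ae_nonneg (fun s => Rabs (k s) <= M * exp (beta * s)).

Definition cumulative (t : R) : R := Rint (Lebesgue.segment t) k.

Lemma cumulative_0 : cumulative 0 = 0.
Proof. apply Rint_segment0. Qed.

Lemma ae_bound_segment (b : R) : Lebesgue.ae_nonneg
  (fun s => s <= b -> Rabs (k s) <= M * exp (beta * b)).
Proof.
  refine (ae_nonneg_imp _ _ _ hbound); intros s _ hs hsb.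
  apply Rle_trans with (1 := hs).
  apply Rmult_le_compat_l; [exact hM |].
  apply exp_le_exp, Rmult_le_compat_l; assumption.
Qed.

Lemma bound_segment_nonneg (b : R) : 0 <= M * exp (beta * b).
Proof. apply Rmult_le_pos; [exact hM | apply Rlt_le, exp_pos]. Qed.

Lemma cumulative_lipschitz (a b : R) : 0 <= a -> a <= b ->
  Rabs (cumulative b - cumulative a) <= M * exp (beta * b) * (b - a).
Proof.
  intros ha hab.
  (* The weight 1 compared with [q = 0] reduces the estimate to the increment of [cumulative]. *)
  pose proof (Rint_increment (fun _ => 1) k a b 0 1 1 (M * exp (beta * b)) ha hab) as h.
  cbv beta in h.
  replace (fun s => 1 * k s) with k in h
    by (apply functional_extensionality; intros s; ring).
  rewrite Rmult_0_l, !Rminus_0_r, Rmult_1_l in h.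
  apply h.
  - intros s; apply continuity_pt_const; intros x y; reflexivity.
  - intros s _; rewrite Rabs_R1; lra.
  - apply hk; lra.
  - apply ae_bound_segment.
  - lra.
  - apply bound_segment_nonneg.
  - intros s _ _; rewrite Rabs_R1; lra.
Qed.

Lemma cumulative_growth (s : R) : 0 <= s ->
  Rabs (cumulative s) <= M * (s * exp (beta * s)).
Proof.
  intros hs.
  pose proof (cumulative_lipschitz 0 s (Rle_refl 0) hs) as h.
  rewrite cumulative_0, !Rminus_0_r in h; lra.
Qed.

Lemma cumulative_continuous (s : R) : continuous (fun s => cumulative (Rmax 0 s)) s.
Proof.
  apply continuity_pt_filterlim.
  intros eps heps.
  (* A Lipschitz constant valid up to distance 1 beyond [s]; the summand 1 makes it positive even
     for [M = 0]. *)
  set (L := M * exp (beta * (Rmax 0 s + 1)) + 1).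
  assert (hL : 0 < L)
    by (pose proof (bound_segment_nonneg (Rmax 0 s + 1)); unfold L; lra).
  exists (Rmin 1 (eps / L)); split.
  { apply Rmin_pos; [lra | apply Rdiv_lt_0_compat; assumption]. }
  intros x [_ hx]; simpl in hx |- *; unfold R_dist in *.
  pose proof (Rmin_l 1 (eps / L)); pose proof (Rmin_r 1 (eps / L)).
  assert (hmax : Rabs (Rmax 0 x - Rmax 0 s) <= Rabs (x - s)).
  { unfold Rmax, Rabs; repeat destruct Rle_dec; repeat destruct Rcase_abs; lra. }
  assert (hgen : forall a b, 0 <= a -> a <= b -> b <= Rmax 0 s + 1 ->
            Rabs (cumulative b - cumulative a) <= L * (b - a)).
  { intros a b ha hab hb.
    apply Rle_trans with (1 := cumulative_lipschitz a b ha hab).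
    apply Rmult_le_compat_r; [lra |].
    assert (M * exp (beta * b) <= M * exp (beta * (Rmax 0 s + 1))).
    { apply Rmult_le_compat_l; [exact hM |].
      apply exp_le_exp, Rmult_le_compat_l; assumption. }
    unfold L; lra. }
  pose proof (Rmax_l 0 x); pose proof (Rmax_l 0 s).
  assert (hfin : Rabs (cumulative (Rmax 0 x) - cumulative (Rmax 0 s))
                 <= L * Rabs (Rmax 0 x - Rmax 0 s)).
  { destruct (Rle_dec (Rmax 0 s) (Rmax 0 x)) as [hle | hle].
    - rewrite (Rabs_pos_eq (Rmax 0 x - Rmax 0 s)) by lra.
      apply hgen; try lra.
      rewrite (Rabs_pos_eq (Rmax 0 x - Rmax 0 s)) in hmax by lra; lra.
    - rewrite Rabs_minus_sym, (Rabs_minus_sym (Rmax 0 x)).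
      rewrite (Rabs_pos_eq (Rmax 0 s - Rmax 0 x)) by lra.
      apply hgen; lra. }
  apply Rle_lt_trans with (1 := hfin).
  apply Rle_lt_trans with (L * Rabs (x - s)).
  { apply Rmult_le_compat_l; lra. }
  apply Rlt_le_trans with (L * (eps / L)); [| right; field; lra].
  apply Rmult_lt_compat_l; lra.
Qed.

(** Of the rate [beta + 2] assumed for [p] and its derivative, [beta] offsets the growth of [k], one
    unit absorbs the factor [s] in [cumulative_growth], and one unit is left for convergence. *)
Variables (p p' : R -> R) (B : R).
Hypothesis hp : forall s, is_derive p s (p' s).
Hypothesis hp' : forall s, continuous p' s.
Hypothesis hpB : forall s, 0 <= s -> Rabs (p s) <= B * exp (- (beta + 2) * s).
Hypothesis hpB' : forall s, 0 <= s -> Rabs (p' s) <= B * exp (- (beta + 2) * s).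

Lemma kernel_bound_nonneg : 0 <= B.
Proof.
  specialize (hpB 0 (Rle_refl 0)); rewrite Rmult_0_r, exp_0, Rmult_1_r in hpB.
  apply Rle_trans with (2 := hpB), Rabs_pos.
Qed.

Lemma kernel_bound (q : R -> R) (s : R) :
  (forall s, 0 <= s -> Rabs (q s) <= B * exp (- (beta + 2) * s)) ->
  0 <= s -> Rabs (q s) <= B.
Proof.
  intros hq hs; apply Rle_trans with (1 := hq s hs).
  rewrite <- (Rmult_1_r B) at 2; apply Rmult_le_compat_l; [exact kernel_bound_nonneg |].
  rewrite <- exp_0; apply exp_le_exp; nra.
Qed.

Lemma kernel_continuity_pt (s : R) : continuity_pt p s.
Proof.
  apply continuity_pt_filterlim, (ex_derive_continuous (V := R_NormedModule)).
  eexists; apply hp.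
Qed.

Let integrand (s : R) : R := p' s * cumulative (Rmax 0 s).

Lemma integrand_continuous (s : R) : continuous integrand s.
Proof.
  apply (continuous_mult (K := R_AbsRing)); [apply hp' | apply cumulative_continuous].
Qed.

(* [k] is merely integrable, so there is no fundamental theorem for it: instead,
   the defect [f] of the formula has increments of second order. *)
Lemma parts_segment (T : R) : 0 <= T ->
  Rint (Lebesgue.segment T) (fun s => p s * k s)
  = p T * cumulative T - RInt integrand 0 T.
Proof.
  intros hT.
  set (L := M * exp (beta * T)).
  assert (hL : 0 <= L) by apply bound_segment_nonneg.
  pose proof kernel_bound_nonneg as hB.
  set (f := fun b => Rint (Lebesgue.segment b) (fun s => p s * k s)
                     - p b * cumulative b + RInt integrand 0 b).
  assert (hint : forall g : R -> R, (forall s, continuous g s) ->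
            forall a b, is_RInt g a b (RInt g a b)).
  { intros g hg a b; apply (RInt_correct (V := R_CompleteNormedModule)),
      (ex_RInt_continuous (V := R_CompleteNormedModule)).
    intros z _; apply hg. }
  assert (h : f T = f 0).
  { apply (quadratic_increment_constant f (2 * B * L) T hT).
    intros a b ha hab hbT.
    assert (hLb : M * exp (beta * b) <= L).
    { apply Rmult_le_compat_l; [exact hM |].
      apply exp_le_exp, Rmult_le_compat_l; assumption. }
    assert (hpp : forall s, a <= s -> s <= b -> Rabs (p s - p b) <= B * (b - a)).
    { intros s hs hsb.
      destruct (MVT_gen p s b p') as [c [hc e]].
      - intros x _; apply hp.
      - intros x _; apply kernel_continuity_pt.
      - rewrite Rmin_left, Rmax_right in hc by lra.
        rewrite Rabs_minus_sym, e, Rabs_mult, (Rabs_pos_eq (b - s)) by lra.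
        assert (Rabs (p' c) <= B) by (apply kernel_bound; [exact hpB' | lra]).
        apply Rmult_le_compat; try lra; apply Rabs_pos. }
    assert (hba : 0 <= b - a) by lra.
    pose proof (Rint_increment p k a b (p b) B (B * (b - a)) (M * exp (beta * b))
      ha hab kernel_continuity_pt (fun s hs => kernel_bound p s hpB hs)
      (hk b (Rle_trans _ _ _ ha hab)) (ae_bound_segment b)
      (Rmult_le_pos _ _ hB hba) (bound_segment_nonneg b) hpp) as h1.
    assert (h2 : Rabs (RInt integrand a b - (p b - p a) * cumulative a)
                 <= (b - a) * (B * (L * (b - a)))).
    { assert (hi : is_RInt (fun s => minus (integrand s) (scal (cumulative a) (p' s)))
                a b (minus (RInt integrand a b)
                       (scal (cumulative a) (minus (p b) (p a))))).
      { apply (is_RInt_minus (V := R_NormedModule)).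
        - apply hint, integrand_continuous.
        - apply (is_RInt_scal (V := R_NormedModule)).
          apply (is_RInt_derive (V := R_CompleteNormedModule) p p');
            intros; [apply hp | apply hp']. }
      replace (RInt integrand a b - (p b - p a) * cumulative a)
        with (minus (RInt integrand a b) (scal (cumulative a) (minus (p b) (p a))))
        by (unfold minus, plus, opp, scal; simpl; unfold mult; simpl; ring).
      refine (norm_RInt_le_const (V := R_NormedModule) _ a b _ _ hab _ hi).
      intros s hs.
      assert (hs0 : 0 <= s) by lra.
      replace (minus (integrand s) (scal (cumulative a) (p' s)))
        with (p' s * (cumulative s - cumulative a)).
      2: { unfold integrand; rewrite Rmax_right by exact hs0.
           unfold minus, plus, opp, scal; simpl; unfold mult; simpl; ring. }
      change (Rabs (p' s * (cumulative s - cumulative a)) <= B * (L * (b - a))).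
      rewrite Rabs_mult; apply Rmult_le_compat; try apply Rabs_pos.
      - apply kernel_bound; [exact hpB' | exact hs0].
      - apply Rle_trans with (1 := cumulative_lipschitz a s ha (proj1 hs)).
        apply Rmult_le_compat; [apply bound_segment_nonneg | lra | | lra].
        apply Rle_trans with (2 := hLb).
        apply Rmult_le_compat_l; [exact hM |].
        apply exp_le_exp, Rmult_le_compat_l; lra. }
    assert (hch : RInt integrand 0 b = RInt integrand 0 a + RInt integrand a b).
    { symmetry; apply (RInt_Chasles (V := R_CompleteNormedModule));
        eexists; apply hint, integrand_continuous. }
    (* Summation by parts of [p * cumulative]. One bracket freezes [p] at [b], the other freezes
       [cumulative] at [a]; each is at most [B * L * (b - a) ^ 2], whence the constant
       [2 * B * L]. *)
    assert (e : f b - f a =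
      (Rint (Lebesgue.segment b) (fun s => p s * k s)
         - Rint (Lebesgue.segment a) (fun s => p s * k s)
         - p b * (cumulative b - cumulative a))
      + (RInt integrand a b - (p b - p a) * cumulative a)).
    { unfold f; rewrite hch; ring. }
    rewrite e; apply Rle_trans with (1 := Rabs_triang _ _).
    assert (h3 : B * (b - a) * (M * exp (beta * b)) * (b - a)
                 <= B * (b - a) * L * (b - a)).
    { apply Rmult_le_compat_r; [lra |].
      apply Rmult_le_compat_l; [apply Rmult_le_pos; lra | exact hLb]. }
    replace (2 * B * L * (b - a) ^ 2)
      with (B * (b - a) * L * (b - a) + (b - a) * (B * (L * (b - a)))) by ring.
    apply Rplus_le_compat; [| exact h2].
    apply Rle_trans with (2 := h3); exact h1. }
  unfold f in h.
  rewrite !Rint_segment0, cumulative_0, (RInt_point (V := R_CompleteNormedModule)) in h.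
  change (zero : R) with 0 in h; lra.
Qed.

Lemma parts_half_line :
  Rintegrable Lebesgue.half_line (fun s => p s * k s) /\
  filterlim (fun n => - RInt integrand 0 (INR n)) eventually
    (locally (Rint Lebesgue.half_line (fun s => p s * k s))).
Proof.
  pose proof kernel_bound_nonneg as hB.
  assert (hBM : 0 <= B * M) by (apply Rmult_le_pos; assumption).
  (* An integrable majorant of [p * k] with an elementary primitive. *)
  set (g := fun s => B * M * exp (- s)).
  assert (hgd : forall x, derivable_pt_lim (fun s => - (B * M) * exp (- s)) x (g x)).
  { intros x; apply is_derive_Reals; unfold g; auto_derive; [exact I | ring]. }
  assert (hgc : forall x, continuity_pt g x).
  { intros x; apply continuity_pt_filterlim, (ex_derive_continuous (V := R_NormedModule)).
    unfold g; auto_derive; exact I. }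
  assert (hgi : forall b, 0 < b -> Rintegrable (Lebesgue.segment b) g /\
            Rint (Lebesgue.segment b) g <= B * M).
  { intros b hb.
    destruct (Rint_FTC (fun s => - (B * M) * exp (- s)) g 0 b hb
                (fun x _ _ => hgd x) (fun x _ _ => hgc x)) as [i1 i2].
    change (interval 0 b) with (Lebesgue.segment b) in i1, i2.
    split; [exact i1 |].
    rewrite i2, Ropp_0, exp_0.
    pose proof (exp_pos (- b)); nra. }
  destruct (Rint_half_line_dominated (fun s => p s * k s) g (B * M)) as [h1 h2].
  - intros n; apply (Rintegrable_mul _ _ _ B).
    + apply kernel_continuity_pt.
    + intros s hs; apply (kernel_bound p s hpB hs).
    + apply hk, pos_INR.
  (* For [n = 0] the segment is a point, which the fundamental theorem excludes; integrability is
     inherited from a larger segment. *)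
  - intros n; destruct (pos_INR n) as [hn | <-]; [apply hgi, hn |].
    apply (Rintegrable_segment_le g 0 1 Rle_0_1), hgi, Rlt_0_1.
  - intros n; destruct (pos_INR n) as [hn | <-]; [apply hgi, hn |].
    rewrite Rint_segment0; exact hBM.
  - intros s; apply Rmult_le_pos; [exact hBM | apply Rlt_le, exp_pos].
  - refine (ae_nonneg_imp _ _ _ hbound); intros s hs hks.
    rewrite Rabs_mult.
    apply Rle_trans with (B * exp (- (beta + 2) * s) * (M * exp (beta * s))).
    + apply Rmult_le_compat; try apply Rabs_pos; [apply hpB, hs | exact hks].
    + unfold g.
      replace (B * exp (- (beta + 2) * s) * (M * exp (beta * s)))
        with (B * M * (exp (- (beta + 2) * s) * exp (beta * s))) by ring.
      rewrite <- exp_plus; apply Rmult_le_compat_l; [exact hBM |].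
      apply exp_le_exp; lra.
  - split; [exact h1 |].
    apply is_lim_seq_Reals in h2.
    assert (h3 : is_lim_seq (fun n => p (INR n) * cumulative (INR n)) 0).
    { apply is_lim_seq_Reals, (Un_cv_exp_neg (B * M)); intros n.
      pose proof (pos_INR n) as hn.
      rewrite Rabs_mult.
      apply Rle_trans with (B * exp (- (beta + 2) * INR n)
                            * (M * (INR n * exp (beta * INR n)))).
      - apply Rmult_le_compat; try apply Rabs_pos;
          [apply hpB, hn | apply cumulative_growth, hn].
      - pose proof (le_exp (INR n) hn) as hne.
        replace (B * exp (- (beta + 2) * INR n) * (M * (INR n * exp (beta * INR n))))
          with (B * M * (INR n * (exp (- (beta + 2) * INR n) * exp (beta * INR n))))
          by ring.
        apply Rmult_le_compat_l; [exact hBM |].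
        rewrite <- exp_plus.
        apply Rle_trans with (exp (INR n) * exp (- (beta + 2) * INR n + beta * INR n)).
        + apply Rmult_le_compat_r; [apply Rlt_le, exp_pos | exact hne].
        + rewrite <- exp_plus; right; f_equal; ring. }
    pose proof (is_lim_seq_minus' _ _ _ _ h2 h3) as h4.
    rewrite Rminus_0_r in h4.
    refine (is_lim_seq_ext _ _ _ _ h4); intros n.
    rewrite (parts_segment (INR n) (pos_INR n)); ring.
Qed.

End PrimitiveOfLocallyIntegrable.

Lemma real_gauss2_decay (t l : R) : 0 < t -> exists B, 0 <= B /\
  forall s, 0 <= s -> Rabs (real_gauss2 t s) <= B * exp (- l * s).
Proof.
  intros ht; destruct (dgauss_rapidly_decreasing (RtoC t) ht l) as [B [hB h]].
  exists B; split; [exact hB |].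
  intros s hs; specialize (h s hs).
  rewrite dgauss_RtoC, Cmod_R in h by exact ht; exact h.
Qed.

(** [parts_half_line] with [p] minus the first [s]-derivative of the Gaussian, so that its own minus
    sign cancels. The sum [B1 + B2] is a common bound for [p] and its derivative. *)
Lemma gauss_moment_cumulative (k : R -> R) (M beta t w : R) :
  0 < t -> 0 <= M -> 0 <= beta ->
  (forall t, 0 <= t -> Rintegrable (Lebesgue.segment t) k) ->
  Lebesgue.ae_nonneg (fun s => Rabs (k s) <= M * exp (beta * s)) ->
  half_line_integral R_CompleteNormedModule
    (fun s => real_gauss2 t s * cumulative k (Rmax 0 s)) w ->
  Rint Lebesgue.half_line (fun s => - real_gauss1 t s * k s) = w.
Proof.
  intros ht hM hbeta hk hbound hw.
  destruct (real_gauss1_decay t (beta + 2) ht) as [B1 [hB1 h1]].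
  destruct (real_gauss2_decay t (beta + 2) ht) as [B2 [hB2 h2]].
  destruct (parts_half_line k M beta hM hbeta hk hbound
    (fun s => - real_gauss1 t s) (fun s => - real_gauss2 t s) (B1 + B2))
    as [_ hlim].
  - intros s; apply (is_derive_opp (V := R_NormedModule)), real_gauss1_derive, ht.
  - intros s; apply (continuous_opp (V := R_NormedModule)), real_gauss2_continuous.
  - intros s hs; rewrite Rabs_Ropp; apply Rle_trans with (1 := h1 s hs).
    pose proof (exp_pos (- (beta + 2) * s)); nra.
  - intros s hs; rewrite Rabs_Ropp; apply Rle_trans with (1 := h2 s hs).
    pose proof (exp_pos (- (beta + 2) * s)); nra.
  - apply half_line_integral_filterlim in hw.
    2: { intros s; apply (continuous_mult (K := R_AbsRing)).
         - apply real_gauss2_continuous.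
         - apply (cumulative_continuous k M beta); assumption. }
    assert (hn : filterlim INR eventually (Rbar_locally p_infty))
      by exact is_lim_seq_INR.
    pose proof (filterlim_comp _ _ _ _ _ _ _ _ hn hw) as hw'.
    refine (filterlim_locally_unique (V := R_NormedModule) _ _ _ hlim _).
    refine (filterlim_ext _ _ _ hw'); intros n.
    rewrite <- (RInt_opp (V := R_CompleteNormedModule)).
    + apply (RInt_ext (V := R_CompleteNormedModule)); intros s _.
      assert (e : forall x y : R, - (- x * y) = x * y) by (intros; ring).
      exact (eq_sym (e _ _)).
    + apply (ex_RInt_continuous (V := R_CompleteNormedModule)); intros s _.
      apply (continuous_mult (K := R_AbsRing)).
      * apply (continuous_opp (V := R_NormedModule)), real_gauss2_continuous.
      * apply (cumulative_continuous k M beta); assumption.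
Qed.

(** Recognizes the weight in [K1] as an [s]-derivative of the Gaussian, which is why one integration
    by parts replaces [K] by [Theta K]. *)
Lemma real_gauss1_K1 (t s : R) : 0 < t ->
  s * exp (- (s ^ 2 / (4 * t))) / (2 * sqrt PI * Rpower t (3 / 2))
  = - real_gauss1 t s.
Proof.
  intros ht; unfold real_gauss1, real_gauss.
  replace (3 / 2) with (1 + / 2) by field.
  rewrite Rpower_plus, Rpower_1, Rpower_sqrt by exact ht.
  pose proof (sqrt_lt_R0 t ht); pose proof (sqrt_lt_R0 _ PI_RGT_0).
  field; lra.
Qed.

(** * The kernel K1 as a Gaussian integral of Theta *)

Section ThetaKernel.

Variables (K : R -> C) (M beta : R).
Hypothesis hM : 0 < M.
Hypothesis hbeta : 0 < beta.
Hypothesis hK : L1_loc K.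
Hypothesis hbound :
  Lebesgue.ae_nonneg (fun t => Cmod (K t) <= M * exp (beta * t)).

Let kre (s : R) : R := Re (K s).
Let kim (s : R) : R := Im (K s).

Lemma kre_integrable (t : R) : 0 <= t -> Rintegrable (Lebesgue.segment t) kre.
Proof. intros ht; exact (proj1 (hK t ht)). Qed.

Lemma kim_integrable (t : R) : 0 <= t -> Rintegrable (Lebesgue.segment t) kim.
Proof. intros ht; exact (proj2 (hK t ht)). Qed.

Lemma kre_bound : Lebesgue.ae_nonneg (fun s => Rabs (kre s) <= M * exp (beta * s)).
Proof.
  refine (ae_nonneg_imp _ _ _ hbound); intros s _ h.
  apply Rle_trans with (2 := h), Rabs_Re_le.
Qed.

Lemma kim_bound : Lebesgue.ae_nonneg (fun s => Rabs (kim s) <= M * exp (beta * s)).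
Proof.
  refine (ae_nonneg_imp _ _ _ hbound); intros s _ h.
  apply Rle_trans with (2 := h), Rabs_Im_le.
Qed.

Lemma Theta_components (t : R) : Theta K t = (cumulative kre t, cumulative kim t).
Proof. reflexivity. Qed.

Lemma Theta_0 : Theta K 0 = RtoC 0.
Proof. rewrite Theta_components, !cumulative_0; reflexivity. Qed.

(** [Theta K] made continuous on the whole line, and regarded as a vector-valued function so that
    [transform] applies to it. *)
Definition Theta_ext (s : R) : C_CompleteNormedModule := Theta K (Rmax 0 s).

Lemma Theta_bound (s : R) : 0 <= s ->
  Cmod (Theta K s) <= 2 * M * (s * exp (beta * s)).
Proof.
  intros hs; apply Rle_trans with (1 := Cmod_le_Re_Im _).
  rewrite Theta_components; simpl.
  pose proof (cumulative_growth kre M beta (Rlt_le _ _ hM) (Rlt_le _ _ hbeta)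
    kre_integrable kre_bound s hs).
  pose proof (cumulative_growth kim M beta (Rlt_le _ _ hM) (Rlt_le _ _ hbeta)
    kim_integrable kim_bound s hs).
  lra.
Qed.

Lemma kre_cumulative_continuous (s : R) :
  continuous (fun s => cumulative kre (Rmax 0 s)) s.
Proof.
  apply (cumulative_continuous kre M beta); try lra;
    [exact kre_integrable | exact kre_bound].
Qed.

Lemma kim_cumulative_continuous (s : R) :
  continuous (fun s => cumulative kim (Rmax 0 s)) s.
Proof.
  apply (cumulative_continuous kim M beta); try lra;
    [exact kim_integrable | exact kim_bound].
Qed.

Lemma Theta_ext_continuous (s : R) : continuous Theta_ext s.
Proof.
  change (continuous (fun s => (cumulative kre (Rmax 0 s), cumulative kim (Rmax 0 s)) : C) s).
  apply (continuous_comp_2 (fun s => cumulative kre (Rmax 0 s))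
    (fun s => cumulative kim (Rmax 0 s)) (fun x y => (x, y)));
    [apply kre_cumulative_continuous | apply kim_cumulative_continuous |].
  apply (continuous_ext (fun u : R * R => u)); [intros [x y]; reflexivity |].
  apply continuous_id.
Qed.

(** The linear factor of [Theta_bound] is exchanged for an exponential of arbitrary rate [q], at the
    price [1 / q]. *)
Lemma Theta_ext_growth (q : R) : 0 < q -> exp_growth Theta_ext (2 * M / q) (beta + q).
Proof.
  intros hq; split; [apply Theta_ext_continuous |].
  intros s hs; unfold Theta_ext; rewrite Rmax_right by exact hs.
  change (Cmod (Theta K s) <= 2 * M / q * exp ((beta + q) * s)).
  apply Rle_trans with (1 := Theta_bound s hs).
  replace ((beta + q) * s) with (q * s + beta * s) by ring; rewrite exp_plus.
  assert (hqs : q * s <= exp (q * s)) by (apply le_exp, Rmult_le_pos; lra).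
  replace (2 * M * (s * exp (beta * s)))
    with (2 * M / q * ((q * s) * exp (beta * s))) by (field; lra).
  apply Rmult_le_compat_l; [apply Rdiv_le_0_compat; lra |].
  apply Rmult_le_compat_r; [apply Rlt_le, exp_pos | exact hqs].
Qed.

Lemma Theta_ext_0 : Theta_ext 0 = zero.
Proof.
  unfold Theta_ext; rewrite Rmax_left by lra; exact Theta_0.
Qed.

(** [pr] stands for [Re] or [Im]. These are only real-linear, so the argument goes through the real
    relation [y = pr x]; it applies because the kernel is real at real times. *)
Lemma Rint_real_gauss_component (k : R -> R) (pr : C -> R) (t : R) :
  0 < t ->
  (forall t, 0 <= t -> Rintegrable (Lebesgue.segment t) k) ->
  Lebesgue.ae_nonneg (fun s => Rabs (k s) <= M * exp (beta * s)) ->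
  (pr zero = 0) ->
  (forall x y : C, pr (x + y)%C = pr x + pr y) ->
  (forall (r : R) (x : C), pr (RtoC r * x)%C = r * pr x) ->
  (forall x : C, continuous (U := R_UniformSpace) pr x) ->
  (forall t, 0 <= t -> pr (Theta K t) = cumulative k t) ->
  Rint Lebesgue.half_line (fun s => - real_gauss1 t s * k s)
  = pr (transform (dgauss (RtoC t)) Theta_ext).
Proof.
  intros ht hk hkb h0 hplus hscal hcont hTheta.
  assert (hM0 : 0 <= M) by lra.
  assert (hb0 : 0 <= beta) by lra.
  apply (gauss_moment_cumulative k M beta t _ ht hM0 hb0 hk hkb).
  destruct (real_gauss2_decay t (beta + 2) ht) as [B [hB h2]].
  assert (hc : forall s, continuous (fun s => real_gauss2 t s * cumulative k (Rmax 0 s)) s).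
  { intros s; apply (continuous_mult (K := R_AbsRing)).
    - apply real_gauss2_continuous.
    - apply (cumulative_continuous k M beta); assumption. }
  destruct (half_line_integral_exists R_CompleteNormedModule
    (fun s => real_gauss2 t s * cumulative k (Rmax 0 s)) (B * M) 1) as [w hw].
  - exact hc.
  - lra.
  - intros s hs; rewrite Rmax_right by exact hs.
    change (Rabs (real_gauss2 t s * cumulative k s) <= B * M * exp (- 1 * s)).
    rewrite Rabs_mult.
    apply Rle_trans with (B * exp (- (beta + 2) * s) * (M * (s * exp (beta * s)))).
    + apply Rmult_le_compat; try apply Rabs_pos; [apply h2, hs |].
      apply (cumulative_growth k M beta); assumption.
    + replace (B * exp (- (beta + 2) * s) * (M * (s * exp (beta * s))))
        with (B * M * (s * (exp (- (beta + 2) * s) * exp (beta * s)))) by ring.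
      apply Rmult_le_compat_l; [apply Rmult_le_pos; assumption |].
      rewrite <- exp_plus.
      apply Rle_trans with (exp s * exp (- (beta + 2) * s + beta * s)).
      * apply Rmult_le_compat_r; [apply Rlt_le, exp_pos | apply le_exp, hs].
      * rewrite <- exp_plus; right; f_equal; ring.
  - replace (pr (transform (dgauss (RtoC t)) Theta_ext)) with w; [exact hw |].
    refine (half_line_integral_relation
      (real_CompleteNormedModule C_CompleteNormedModule) R_CompleteNormedModule
      (fun x y => y = pr x) (fun s => scal (dgauss (RtoC t) s) (Theta_ext s))
      (fun s => real_gauss2 t s * cumulative k (Rmax 0 s))
      _ _ _ _ _ _
      (transform_correct C_CompleteNormedModule _ _ _ _
         (dgauss_admissible (RtoC t) ht) (Theta_ext_growth 1 Rlt_0_1)) hw).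
    + repeat split.
      * exact (eq_sym h0).
      * intros x y x' y' -> ->; symmetry; apply hplus.
      * intros r x y ->; symmetry; apply hscal.
      * intros u v x y huv hu hv.
        apply (filterlim_locally_unique (V := R_NormedModule) (F := eventually) v);
          [exact hv |].
        apply filterlim_ext with (fun n => pr (u n)); [intros n; symmetry; apply huv |].
        exact (filterlim_comp _ _ _ _ _ _ _ _ hu (hcont x)).
    + intros s; apply (continuous_kernel C_CompleteNormedModule);
        [apply dgauss_continuous | apply Theta_ext_continuous].
    + exact hc.
    + intros s hs; rewrite dgauss_RtoC by exact ht.
      unfold Theta_ext; rewrite Rmax_right by exact hs.
      rewrite <- hTheta by exact hs.
      symmetry; apply hscal.
Qed.

Lemma K1_transform (t : R) : 0 < t ->
  K1 K t = transform (dgauss (RtoC t)) Theta_ext.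
Proof.
  intros ht.
  assert (hre : Rint Lebesgue.half_line (fun s => - real_gauss1 t s * kre s)
                = Re (transform (dgauss (RtoC t)) Theta_ext)).
  { apply Rint_real_gauss_component; try easy.
    - apply kre_integrable.
    - apply kre_bound.
    - intros r [x y]; simpl; ring.
    - intros x; apply continuous_fst. }
  assert (him : Rint Lebesgue.half_line (fun s => - real_gauss1 t s * kim s)
                = Im (transform (dgauss (RtoC t)) Theta_ext)).
  { apply Rint_real_gauss_component; try easy.
    - apply kim_integrable.
    - apply kim_bound.
    - intros r [x y]; simpl; ring.
    - intros x; apply continuous_snd. }
  transitivity (Re (transform (dgauss (RtoC t)) Theta_ext),
                Im (transform (dgauss (RtoC t)) Theta_ext));
    [| symmetry; apply surjective_pairing].
  rewrite <- hre, <- him.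
  unfold K1, Lebesgue.integralC, Rint.
  f_equal; f_equal; apply functional_extensionality; intros s;
    rewrite real_gauss1_K1 by exact ht; unfold kre, kim;
    destruct (K s); unfold Cmult, RtoC; simpl; ring.
Qed.

End ThetaKernel.

(** * Local integrability of K1 and its primitive *)

Section ThetaK1.

Variables (K : R -> C) (M beta : R).
Hypothesis hM : 0 < M.
Hypothesis hbeta : 0 < beta.
Hypothesis hK : L1_loc K.
Hypothesis hbound :
  Lebesgue.ae_nonneg (fun t => Cmod (K t) <= M * exp (beta * t)).

Let V := C_CompleteNormedModule.
Let c : R -> V := Theta_ext K.

Let c_growth (q : R) : 0 < q -> exp_growth c (2 * M / q) (beta + q) :=
  Theta_ext_growth K M beta hM hbeta hK hbound q.

Let c_0 : c 0 = zero := Theta_ext_0 K.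

Let cs (s : R) : V := (RtoC (s ^ 2) * c s)%C.

(* Keeping [q] free allows the choice [q = 1 / (2 sqrt t)], which turns the powers
   of [s] into the right powers of [t]. *)
Lemma cs_growth (q : R) : 0 < q -> exp_growth cs (2 * M / q ^ 3) (beta + 3 * q).
Proof.
  intros hq; split.
  - intros s.
    apply (continuous_kernel V (fun s => RtoC (s ^ 2)) c).
    + split; intros x; simpl; apply (ex_derive_continuous (V := R_NormedModule));
        auto_derive; exact I.
    + apply (c_growth q hq).
  - intros s hs; change (Cmod (RtoC (s ^ 2) * c s) <= 2 * M / q ^ 3 * exp ((beta + 3 * q) * s)).
    rewrite Cmod_mult, Cmod_R, Rabs_pos_eq by apply pow2_ge_0.
    pose proof (proj2 (c_growth q hq) s hs) as h.
    change (Cmod (c s) <= 2 * M / q * exp ((beta + q) * s)) in h.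
    assert (hqs : q * s <= exp (q * s)) by (apply le_exp, Rmult_le_pos; lra).
    assert (hqs2 : (q * s) ^ 2 <= exp (q * s) ^ 2).
    { apply pow_incr; split; [apply Rmult_le_pos; lra | exact hqs]. }
    replace ((beta + 3 * q) * s) with (q * s + q * s + (beta + q) * s) by ring.
    rewrite !exp_plus.
    replace (2 * M / q ^ 3 * (exp (q * s) * exp (q * s) * exp ((beta + q) * s)))
      with (/ q ^ 2 * exp (q * s) ^ 2 * (2 * M / q * exp ((beta + q) * s)))
      by (field; lra).
    replace (s ^ 2) with (/ q ^ 2 * (q * s) ^ 2) by (field; lra).
    assert (0 < / q ^ 2) by (apply Rinv_0_lt_compat, pow_lt, hq).
    apply Rmult_le_compat; [| apply Cmod_ge_0 | | exact h].
    + apply Rmult_le_pos; [lra | apply pow2_ge_0].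
    + apply Rmult_le_compat_l; lra.
Qed.

Lemma cs_0 : cs 0 = zero.
Proof.
  unfold cs; rewrite c_0.
  exact (Cmult_0_r _).
Qed.

(* [dgauss z s] is [gauss z s] times a polynomial in [s], so [K1] inherits
   continuity and bounds from Gauss transforms. *)
Lemma K1_moments (t : R) : 0 < t ->
  K1 K t = (RtoC (/ (4 * t ^ 2)) * gauss_family V cs t
            - RtoC (/ (2 * t)) * gauss_family V c t)%C.
Proof.
  intros ht.
  rewrite (K1_transform K M beta hM hbeta hK hbound t ht).
  rewrite !gauss_family_pos by exact ht.
  pose proof (c_growth 1 Rlt_0_1) as hc; pose proof (cs_growth 1 Rlt_0_1) as hcs.
  assert (e : forall (a : C) (b : R -> V) (N w : R), exp_growth b N w ->
    (a * transform (gauss (RtoC t)) b)%C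
    = transform (gauss (RtoC t)) (fun s => scal a (b s) : V)).
  { intros a b N w hb; symmetry.
    exact (transform_linear V V (fun x : V => scal a x) _ b N w
      (is_linear_scal_C V a) (gauss_admissible (RtoC t) ht) hb). }
  rewrite (e _ _ _ _ hc), (e _ _ _ _ hcs).
  destruct (exp_growth_linear V V _ _ _ _ (is_linear_scal_C V (RtoC (/ (4 * t ^ 2)))) hcs)
    as [N1 hcs'].
  destruct (exp_growth_linear V V _ _ _ _ (is_linear_scal_C V (RtoC (/ (2 * t)))) hc)
    as [N2 hc'].
  apply transform_unique.
  pose proof (is_RInt_gen_minus (V := real_CompleteNormedModule V) _ _ _ _
    (transform_correct V _ _ _ _ (gauss_admissible (RtoC t) ht) hcs')
    (transform_correct V _ _ _ _ (gauss_admissible (RtoC t) ht) hc')) as h.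
  refine (is_RInt_gen_ext (V := real_CompleteNormedModule V) _ _ _ _ h).
  exists (fun _ => True) (fun _ => True); try apply filter_true.
  intros a b _ _ s _; simpl.
  change ((gauss (RtoC t) s * (RtoC (/ (4 * t ^ 2)) * (RtoC (s ^ 2) * c s))
           - gauss (RtoC t) s * (RtoC (/ (2 * t)) * c s))%C
          = (dgauss (RtoC t) s * c s)%C).
  unfold dgauss.
  rewrite !RtoC_inv, !RtoC_mult by nra.
  replace (RtoC (t ^ 2)) with (RtoC t * RtoC t)%C
    by (rewrite <- RtoC_mult; f_equal; ring).
  field.
  intros h0; apply (f_equal Re) in h0; simpl in h0; lra.
Qed.

Let growth_pos : 0 <= beta + 1.
Proof. lra. Qed.

Let growth_pos3 : 0 <= beta + 3 * 1.
Proof. lra. Qed.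

Lemma gauss_family_c_continuous (t : R) : continuous (gauss_family V c) t.
Proof.
  exact (gauss_family_continuous V c _ _ t growth_pos (c_growth 1 Rlt_0_1) c_0).
Qed.

Lemma gauss_family_cs_continuous (t : R) : continuous (gauss_family V cs) t.
Proof.
  exact (gauss_family_continuous V cs _ _ t growth_pos3 (cs_growth 1 Rlt_0_1) cs_0).
Qed.

(** The choice of [q] makes [decay_rate] equal to [q ^ 2]. The transforms of [cs] and [c] are then
    of order [q^(-3)] and [q^(-1)], that is [t^(3/2)] and [t^(1/2)]; after division by [t ^ 2] and
    [t] both become [t^(-1/2)], with constants 8 and 4. *)
Lemma Cmod_K1_le (t T : R) : 0 < t -> t <= T ->
  Cmod (K1 K t) <= 12 * M * / sqrt PI * exp (4 * T * beta ^ 2 + 10) * / sqrt t.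
Proof.
  intros ht hT.
  pose proof (sqrt_lt_R0 t ht) as hst.
  pose proof (sqrt_sqrt t (Rlt_le _ _ ht)) as ett.
  set (r := sqrt t) in *.
  set (q := / (2 * r)).
  assert (hq : 0 < q) by (apply Rinv_0_lt_compat; lra).
  assert (hpi : 0 < / sqrt PI) by (apply Rinv_0_lt_compat, sqrt_lt_R0, PI_RGT_0).
  assert (ea : decay_rate (RtoC t) = q ^ 2).
  { unfold decay_rate, q; rewrite Cmod_R, Rabs_pos_eq by lra; simpl (Re _).
    rewrite <- ett; field; lra. }
  assert (esa : sqrt (decay_rate (RtoC t)) = q).
  { rewrite ea; apply sqrt_pow2; lra. }
  assert (ez : sqrt (Cmod (RtoC t)) = r) by (rewrite Cmod_R, Rabs_pos_eq by lra; reflexivity).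
  (* For [w <= beta + 3 q] one has [w^2 <= 2 beta^2 + 18 q^2]; dividing by [2 q^2] gives
     [4 t beta^2 + 9], and the remaining 1/2 is rounded up. *)
  set (X := exp (4 * T * beta ^ 2 + 10)).
  assert (hX : 0 < X) by apply exp_pos.
  assert (hw : forall w, 0 <= w -> w <= beta + 3 * q ->
            exp (w ^ 2 / (2 * decay_rate (RtoC t)) + 1 / 2) <= X).
  { intros w hw0 hw; apply exp_le_exp; rewrite ea.
    assert (h1 : w ^ 2 <= 2 * beta ^ 2 + 18 * q ^ 2).
    { apply Rle_trans with ((beta + 3 * q) ^ 2); [apply pow_incr; lra |].
      pose proof (pow2_ge_0 (beta - 3 * q)); nra. }
    assert (h2 : w ^ 2 / (2 * q ^ 2) <= 4 * t * beta ^ 2 + 9).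
    { apply (Rmult_le_reg_r (2 * q ^ 2)); [pose proof (pow_lt q 2 hq); lra |].
      replace (w ^ 2 / (2 * q ^ 2) * (2 * q ^ 2)) with (w ^ 2) by (field; lra).
      replace ((4 * t * beta ^ 2 + 9) * (2 * q ^ 2))
        with (2 * beta ^ 2 + 18 * q ^ 2); [exact h1 |].
      rewrite <- ett; unfold q; field; lra. }
    assert (4 * t * beta ^ 2 <= 4 * T * beta ^ 2)
      by (apply Rmult_le_compat_r; [apply pow2_ge_0 | lra]).
    lra. }
  assert (hnorm : forall (b : R -> V) (N w : R), exp_growth b N w ->
            0 <= w -> w <= beta + 3 * q ->
            Cmod (gauss_family V b t) <= 2 * / sqrt PI * X * N).
  { intros b N w hb hw0 hw1; rewrite gauss_family_pos by exact ht.
    pose proof (gauss_transform_norm V (RtoC t) b N w ht hb) as h.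
    rewrite esa, ez in h.
    change (norm (transform (gauss (RtoC t)) b))
      with (Cmod (transform (gauss (RtoC t)) b)) in h.
    apply Rle_trans with (1 := h).
    apply Rmult_le_compat_r; [exact (exp_growth_nonneg V b N w hb) |].
    replace (/ sqrt PI * / r * / q) with (2 * / sqrt PI)
      by (unfold q; field; repeat split; try lra; apply Rgt_not_eq, sqrt_lt_R0, PI_RGT_0).
    apply Rmult_le_compat_l; [lra | apply hw; assumption]. }
  pose proof (hnorm c _ _ (c_growth q hq) ltac:(lra) ltac:(lra)) as h1.
  pose proof (hnorm cs _ _ (cs_growth q hq) ltac:(lra) ltac:(lra)) as h2.
  rewrite K1_moments by exact ht.
  unfold Cminus; apply Rle_trans with (1 := Cmod_triangle _ _).
  rewrite Cmod_opp, !Cmod_mult, !Cmod_R.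
  assert (h4 : 0 < / (4 * t ^ 2)) by (apply Rinv_0_lt_compat; pose proof (pow_lt t 2 ht); lra).
  assert (h5 : 0 < / (2 * t)) by (apply Rinv_0_lt_compat; lra).
  rewrite !Rabs_pos_eq by lra.
  apply Rle_trans with (/ (4 * t ^ 2) * (2 * / sqrt PI * X * (2 * M / q ^ 3))
                        + / (2 * t) * (2 * / sqrt PI * X * (2 * M / q))).
  - apply Rplus_le_compat; (apply Rmult_le_compat_l; [lra | assumption]).
  - right; fold X; rewrite <- ett; unfold q.
    field; repeat split; try lra; apply Rgt_not_eq, sqrt_lt_R0, PI_RGT_0.
Qed.

(** [K1] is the derivative of the Gauss family of [Theta], but only for positive times. The
    fundamental theorem is used on [[a, t]] and the left end is sent to 0: the majorant of order
    [s^(-1/2)] has bounded integrals, and the family vanishes continuously at 0. *)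
Lemma Theta_K1_component (pr : C -> R) (t : R) : 0 < t ->
  (forall x y : C, pr (x - y)%C = pr x - pr y) ->
  (forall (r : R) (x : C), pr (RtoC r * x)%C = r * pr x) ->
  (forall x, Rabs (pr x) <= Cmod x) ->
  Rintegrable (Lebesgue.segment t) (fun s => pr (K1 K s)) /\
  Rint (Lebesgue.segment t) (fun s => pr (K1 K s)) = pr (gauss_family V c t).
Proof.
  intros ht hminus hscal hle.
  assert (hprc : forall f : R -> V, forall s, continuous f s ->
            continuity_pt (fun s => pr (f s)) s).
  { intros f s hf; apply continuity_pt_filterlim.
    apply (filterlim_locally (U := R_UniformSpace)); intros eps.
    pose proof (proj1 (filterlim_locally_ball_norm (U := CompleteNormedModule.NormedModule _ V) f (f s)) hf eps) as h.
    refine (filter_imp _ _ _ h); intros y hy.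
    change (Cmod (f y - f s) < eps) in hy.
    change (Rabs (pr (f y) - pr (f s)) < eps).
    rewrite <- hminus; apply Rle_lt_trans with (2 := hy), hle. }
  set (D := 12 * M * / sqrt PI * exp (4 * t * beta ^ 2 + 10)).
  assert (hD : 0 < D).
  { unfold D; repeat apply Rmult_lt_0_compat; try lra;
      [apply Rinv_0_lt_compat, sqrt_lt_R0, PI_RGT_0 | apply exp_pos]. }
  assert (hder : forall x, 0 < x ->
            derivable_pt_lim (fun s => pr (gauss_family V c s)) x (pr (K1 K x))).
  { intros x hx; rewrite (K1_transform K M beta hM hbeta hK hbound x hx).
    pose proof (gauss_family_derive V c _ _ x hx (c_growth 1 Rlt_0_1)) as [_ h].
    specialize (h x (fun P hP => hP)).
    intros eps heps.
    (* Half of [eps], since the estimate obtained is weak and the one required is strict. *)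
    destruct (h (mkposreal (eps / 2) ltac:(lra))) as [d hd].
    exists d; intros y hy hyd.
    specialize (hd (x + y)).
    assert (hball : ball x d (x + y)).
    { change (Rabs (x + y - x) < d); replace (x + y - x) with y by ring; exact hyd. }
    specialize (hd hball).
    change (Cmod ((gauss_family V c (x + y) - gauss_family V c x)
                  - RtoC (x + y - x) * transform (dgauss (RtoC x)) c)
            <= eps / 2 * Rabs (x + y - x)) in hd.
    replace (x + y - x) with y in hd by ring.
    pose proof (Rle_trans _ _ _ (hle _) hd) as h1.
    rewrite !hminus, hscal in h1.
    pose proof (Rabs_pos_lt y hy) as hy0.
    assert (e : forall u v r : R, (u - v) / y - r = (u - v - y * r) / y)
      by (intros; field; exact hy).
    rewrite e.
    unfold Rdiv at 1; rewrite Rabs_mult, Rabs_inv.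
    apply Rle_lt_trans with (eps / 2 * Rabs y * / Rabs y).
    - apply Rmult_le_compat_r; [apply Rlt_le, Rinv_0_lt_compat, hy0 | exact h1].
    - rewrite Rmult_assoc, Rinv_r by lra; lra. }
  assert (hcont : forall x, 0 < x -> continuity_pt (fun s => pr (K1 K s)) x).
  { intros x hx.
    apply (continuity_pt_ext_loc (fun s => / (4 * s ^ 2) * pr (gauss_family V cs s)
             - / (2 * s) * pr (gauss_family V c s))).
    - exists (mkposreal x hx); intros y hy.
      change (Rabs (y - x) < x) in hy; apply Rabs_lt_between in hy.
      rewrite K1_moments by lra; rewrite hminus, !hscal; reflexivity.
    - apply continuity_pt_minus;
        [apply (continuity_pt_mult (fun s => / (4 * s ^ 2)))
        | apply (continuity_pt_mult (fun s => / (2 * s)))].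
      + apply continuity_pt_filterlim.
        apply (ex_derive_continuous (V := R_NormedModule) (fun s => / (4 * s ^ 2))).
        auto_derive; nra.
      + apply hprc, gauss_family_cs_continuous.
      + apply continuity_pt_filterlim.
        apply (ex_derive_continuous (V := R_NormedModule) (fun s => / (2 * s))).
        auto_derive; lra.
      + apply hprc, gauss_family_c_continuous. }
  assert (hg : forall a, 0 < a -> a < t ->
     Rintegrable (interval a t) (fun s => D * / sqrt s) /\
     Rint (interval a t) (fun s => D * / sqrt s) <= 2 * D * sqrt t).
  { intros a ha hat.
    destruct (Rint_FTC (fun s => 2 * D * sqrt s) (fun s => D * / sqrt s) a t hat)
      as [i1 i2].
    - intros x hx _; apply is_derive_Reals; pose proof (sqrt_lt_R0 x).
      auto_derive; [lra | field; lra].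
    - intros x hx _; apply continuity_pt_filterlim.
      apply (ex_derive_continuous (V := R_NormedModule) (fun s => D * / sqrt s)).
      pose proof (sqrt_lt_R0 x).
      auto_derive; lra.
    - split; [exact i1 |]; rewrite i2.
      pose proof (sqrt_pos a); nra. }
  assert (hf : forall a, 0 < a -> a < t ->
     Rintegrable (interval a t) (fun s => pr (K1 K s)) /\
     Rint (interval a t) (fun s => pr (K1 K s))
     = pr (gauss_family V c t) - pr (gauss_family V c a)).
  { intros a ha hat; apply (Rint_FTC (fun s => pr (gauss_family V c s))); try assumption.
    - intros x hx _; apply hder; lra.
    - intros x hx _; apply hcont; lra. }
  destruct (Rint_segment_improper t (fun s => pr (K1 K s)) (fun s => D * / sqrt s)
              (2 * D * sqrt t) ht) as [h1 h2].
  - intros a ha hat; apply hf; assumption.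
  - intros a ha hat; apply hg; assumption.
  - intros a ha hat; apply hg; assumption.
  - intros s; apply Rmult_le_pos; [lra |].
    destruct (Rlt_dec 0 s) as [hs | hs].
    + apply Rlt_le, Rinv_0_lt_compat, sqrt_lt_R0, hs.
    (* For [s <= 0] the root and its inverse take the default value 0, so the majorant is
       nonnegative everywhere. *)
    + rewrite sqrt_neg_0, Rinv_0; lra.
  - intros s hs hst; apply Rle_trans with (1 := hle _).
    apply Cmod_K1_le; assumption.
  - split; [exact h1 |].
    apply is_lim_seq_Reals in h2.
    assert (h3 : is_lim_seq (fun n => pr (gauss_family V c t)
                   - pr (gauss_family V c (t / INR (S (S n)))))
                   (pr (gauss_family V c t) - pr (gauss_family V c 0))).
    { apply is_lim_seq_minus'; [apply is_lim_seq_const |].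
      apply (is_lim_seq_continuous (fun s => pr (gauss_family V c s))
               (fun n => t / INR (S (S n))) 0).
      - apply hprc, gauss_family_c_continuous.
      - unfold Rdiv; replace 0 with (t * 0) by ring.
        apply (is_lim_seq_scal_l (fun n => / INR (S (S n))) t 0).
        apply (is_lim_seq_incr_1 (fun n => / INR (S n))),
          (is_lim_seq_incr_1 (fun n => / INR n)).
        apply (is_lim_seq_inv INR p_infty); [apply is_lim_seq_INR | discriminate]. }
    rewrite (gauss_family_nonpos V c 0) in h3 by lra.
    assert (e0 : pr (zero : V) = 0).
    { change (zero : V) with (RtoC 0).
      replace (RtoC 0) with (RtoC 0 * RtoC 0)%C by ring.
      rewrite hscal; ring. }
    rewrite e0, Rminus_0_r in h3.
    assert (h4 : is_lim_seq (fun n => Rint (interval (t / INR (S (S n))) t)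
                   (fun s => pr (K1 K s))) (pr (gauss_family V c t))).
    { refine (is_lim_seq_ext _ _ _ _ h3); intros n; symmetry.
      apply hf.
      - apply Rdiv_lt_0_compat; [exact ht | apply lt_0_INR; lia].
      - apply (Rmult_lt_reg_r (INR (S (S n)))); [apply lt_0_INR; lia |].
        unfold Rdiv; rewrite Rmult_assoc, Rinv_l by (apply not_0_INR; lia).
        rewrite !S_INR; pose proof (pos_INR n); nra. }
    apply is_lim_seq_unique in h2; apply is_lim_seq_unique in h4.
    rewrite h2 in h4; injection h4; auto.
Qed.

Lemma L1_loc_K1 : L1_loc (K1 K).
Proof.
  assert (h : forall t, 0 < t -> Lebesgue.integrableC (Lebesgue.segment t) (K1 K)).
  { intros t ht; split.
    - apply (Theta_K1_component Re t ht).
      + intros [x y] [x' y']; simpl; ring.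
      + intros r [x y]; simpl; ring.
      + apply Rabs_Re_le.
    - apply (Theta_K1_component Im t ht).
      + intros [x y] [x' y']; simpl; ring.
      + intros r [x y]; simpl; ring.
      + apply Rabs_Im_le. }
  (* Restricting from [t + 1] also covers [t = 0]. *)
  intros t ht; destruct (h (t + 1)) as [h1 h2]; [lra |].
  assert (ht1 : t <= t + 1) by lra.
  split; [exact (Rintegrable_segment_le _ _ _ ht1 h1)
         | exact (Rintegrable_segment_le _ _ _ ht1 h2)].
Qed.

Lemma Theta_K1 (t : R) : 0 < t ->
  Theta (K1 K) t = transform (gauss (RtoC t)) (Theta_ext K).
Proof.
  intros ht; refine (eq_trans _ (gauss_family_pos V c t ht)).
  transitivity (Re (gauss_family V c t), Im (gauss_family V c t));
    [| symmetry; apply surjective_pairing].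
  change (Theta (K1 K) t) with
    (Rint (Lebesgue.segment t) (fun s => Re (K1 K s)),
     Rint (Lebesgue.segment t) (fun s => Im (K1 K s))).
  f_equal.
  - apply (Theta_K1_component Re t ht).
    + intros [x y] [x' y']; simpl; ring.
    + intros r [x y]; simpl; ring.
    + apply Rabs_Re_le.
  - apply (Theta_K1_component Im t ht).
    + intros [x y] [x' y']; simpl; ring.
    + intros r [x y]; simpl; ring.
    + apply Rabs_Im_le.
Qed.

End ThetaK1.

(** * The semigroup *)

Lemma transform_plus (E : CompleteNormedModule C_AbsRing) (k : R -> C)
    (c c' : R -> E) (N w N' w' : R) :
  admissible_kernel k -> exp_growth c N w -> exp_growth c' N' w' ->
  transform k (fun s => plus (c s) (c' s)) = plus (transform k c) (transform k c').
Proof.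
  intros hk hc hc'; apply transform_unique.
  pose proof (is_RInt_gen_plus (V := real_CompleteNormedModule E) _ _ _ _
    (transform_correct E k c N w hk hc) (transform_correct E k c' N' w' hk hc')) as h.
  refine (is_RInt_gen_ext (V := real_CompleteNormedModule E) _ _ _ _ h).
  exists (fun _ => True) (fun _ => True); try apply filter_true.
  intros a b _ _ t _; simpl.
  exact (eq_sym (scal_distr_l (V := CompleteNormedModule.ModuleSpace _ E)
                   (k t) (c t) (c' t))).
Qed.

Lemma transform_minus_r (E : CompleteNormedModule C_AbsRing) (k : R -> C)
    (c c' : R -> E) (N w N' w' : R) :
  admissible_kernel k -> exp_growth c N w -> exp_growth c' N' w' ->
  transform k (fun s => minus (c s) (c' s)) = minus (transform k c) (transform k c').
Proof.
  intros hk hc hc'; apply transform_unique.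
  pose proof (is_RInt_gen_minus (V := real_CompleteNormedModule E) _ _ _ _
    (transform_correct E k c N w hk hc) (transform_correct E k c' N' w' hk hc')) as h.
  refine (is_RInt_gen_ext (V := real_CompleteNormedModule E) _ _ _ _ h).
  exists (fun _ => True) (fun _ => True); try apply filter_true.
  intros a b _ _ t _; simpl.
  exact (eq_sym (scal_minus_distr_l (V := CompleteNormedModule.ModuleSpace _ E)
                   (k t) (c t) (c' t))).
Qed.

(** Writes a difference quotient minus the derivative as a Taylor remainder divided by the
    increment. *)
Lemma minus_scal_inv {V : ModuleSpace C_Ring} (a : C) (u v : V) : a <> 0 ->
  minus (scal (/ a)%C u) v = scal (/ a)%C (minus u (scal a v)).
Proof.
  intros ha; rewrite scal_minus_distr_l; f_equal.
  rewrite scal_assoc.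
  change (mult (/ a)%C a) with (/ a * a)%C.
  rewrite Cinv_l by exact ha.
  symmetry; exact (scal_one v).
Qed.

(** * Operator norms and sectors *)

Section OperatorNorm.

Variable E : CompleteNormedModule C_AbsRing.

Lemma opnorm_le (T : E -> E) (B : R) :
  (forall x, norm x <= 1 -> norm (T x) <= B) -> Rbar_le (opnorm T) B.
Proof.
  intros h; apply (proj2 (Lub_Rbar_correct _)).
  intros r [x [hx ->]]; exact (h x hx).
Qed.

Lemma norm_le_opnorm (T : E -> E) (B : R) (x : E) :
  bounded_operator T -> Rbar_le (opnorm T) B -> norm (T x) <= B * norm x.
Proof.
  intros hT hB.
  assert (hunit : forall y, norm y <= 1 -> norm (T y) <= B).
  { intros y hy.
    pose proof (proj1 (Lub_Rbar_correct
      (fun r => exists x : E, norm x <= 1 /\ r = norm (T x))) (norm (T y))) as h.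
    exact (Rbar_le_trans (norm (T y)) _ B (h (ex_intro _ y (conj hy eq_refl))) hB). }
  destruct (Req_dec (norm x) 0) as [h0 | h0].
  - assert (hx : x = zero)
      by exact (norm_eq_zero (V := CompleteNormedModule.NormedModule _ E) x h0).
    assert (hTx : T x = zero)
      by (rewrite hx; exact (linear_zero T hT)).
    rewrite h0, hTx, Rmult_0_r.
    right; exact (norm_zero_E E).
  - assert (hn : 0 < norm x).
    { destruct (norm_ge_0 (V := CompleteNormedModule.NormedModule _ E) x) as [h | h];
        [exact h | exfalso; apply h0; symmetry; exact h]. }
    set (y := scal (RtoC (/ norm x)) x).
    assert (hy : norm y <= 1).
    { apply Rle_trans with (1 := norm_scal_Cmod E _ _).
      rewrite Cmod_R, Rabs_pos_eq by (apply Rlt_le, Rinv_0_lt_compat, hn).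
      right; field; lra. }
    assert (hx : x = scal (RtoC (norm x)) y).
    { unfold y.
      rewrite (scal_assoc (V := CompleteNormedModule.ModuleSpace _ E)).
      change (mult (RtoC (norm x)) (RtoC (/ norm x)))
        with (RtoC (norm x) * RtoC (/ norm x))%C.
      rewrite <- RtoC_mult, Rinv_r by exact h0.
      exact (eq_sym (scal_one (V := CompleteNormedModule.ModuleSpace _ E) x)). }
    rewrite hx at 1.
    rewrite (linear_scal T hT).
    apply Rle_trans with (1 := norm_scal_Cmod E _ _).
    rewrite Cmod_R, Rabs_pos_eq by lra.
    rewrite Rmult_comm; apply Rmult_le_compat_r; [lra | apply hunit, hy].
Qed.

End OperatorNorm.

(** Replaces polar coordinates by the inequality [k * Cmod z <= Re z] of the estimates, with
    [k = cos gamma]. *)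
Lemma sector_halfplane (gamma : R) (z : C) : 0 < gamma <= PI / 2 ->
  sector gamma z -> 0 < Re z /\ cos gamma * Cmod z <= Re z.
Proof.
  intros hg (r & theta & hr & hth & ->); simpl.
  assert (hcos : 0 < cos theta)
    by (apply Rabs_lt_between in hth; apply cos_gt_0; lra).
  assert (hmod : Cmod (r * cos theta, r * sin theta) = r).
  { unfold Cmod; simpl.
    replace (r * cos theta * (r * cos theta * 1) + r * sin theta * (r * sin theta * 1))
      with (r * r * (Rsqr (sin theta) + Rsqr (cos theta))) by (unfold Rsqr; ring).
    rewrite sin2_cos2, Rmult_1_r; apply sqrt_square; lra. }
  rewrite hmod; split; [apply Rmult_lt_0_compat; assumption |].
  rewrite Rmult_comm; apply Rmult_le_compat_l; [lra |].
  destruct (Rle_dec 0 theta) as [h0 | h0].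
  - rewrite Rabs_pos_eq in hth by exact h0.
    left; apply cos_decreasing_1; lra.
  - rewrite Rabs_left in hth by lra.
    rewrite <- (cos_neg theta).
    left; apply cos_decreasing_1; lra.
Qed.

Lemma Cminus_eq_0 (a b : C) : (a - b)%C = 0 -> a = b.
Proof.
  intros h; transitivity ((a - b) + b)%C; [ring | rewrite h; ring].
Qed.

(** * The analytic family obtained from the cosine function *)

Section CosineFamily.

Variable E : CompleteNormedModule C_AbsRing.
Variables (CK : R -> E -> E) (N w : R).
Hypothesis hN : 0 < N.
Hypothesis hw : 0 <= w.
Hypothesis hcont : strongly_continuous CK.
Hypothesis hbound :
  forall t, 0 <= t -> Rbar_le (opnorm (CK t)) (N * exp (w * t)).

(** Constant to the left of 0, so that strong continuity on the half-line becomes continuity on the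
    whole line. *)
Definition orbit (x : E) (s : R) : E := CK (Rmax 0 s) x.

Lemma orbit_growth (x : E) : exp_growth (orbit x) (N * norm x) w.
Proof.
  split.
  - intros s P hP.
    pose proof (proj2 hcont x (Rmax 0 s) (Rmax_l 0 s) P hP) as [d hd].
    exists d; intros y hy; apply hd; [| apply Rmax_l].
    change (Rabs (y - s) < d) in hy; change (Rabs (Rmax 0 y - Rmax 0 s) < d).
    apply Rle_lt_trans with (2 := hy).
    unfold Rmax, Rabs; repeat destruct Rle_dec; repeat destruct Rcase_abs; lra.
  - intros s hs; unfold orbit; rewrite Rmax_right by exact hs.
    pose proof (norm_le_opnorm E (CK s) _ x (proj1 hcont s hs) (hbound s hs)) as h.
    replace (N * norm x * exp (w * s)) with (N * exp (w * s) * norm x) by ring.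
    exact h.
Qed.

Lemma transform_orbit_bounded (k : R -> C) : admissible_kernel k ->
  bounded_operator (fun x => transform k (orbit x)).
Proof.
  intros hk; split.
  - intros x y.
    refine (eq_trans _ (transform_plus E k _ _ _ _ _ _ hk (orbit_growth x) (orbit_growth y))).
    f_equal; apply functional_extensionality; intros s; unfold orbit.
    apply (linear_plus (CK (Rmax 0 s)) (proj1 hcont _ (Rmax_l 0 s))).
  - intros a x.
    refine (eq_trans _ (transform_linear E E (fun y : E => scal a y) k _ _ _
                  (is_linear_scal_C E a) hk (orbit_growth x))).
    f_equal; apply functional_extensionality; intros s; unfold orbit.
    apply (linear_scal (CK (Rmax 0 s)) (proj1 hcont _ (Rmax_l 0 s))).
  - destruct (proj2 hk (1 + w)) as [B [hB h]].
    exists (B * N + 1); split; [pose proof (Rmult_le_pos B N hB (Rlt_le _ _ hN)); lra |].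
    intros x.
    pose proof (transform_norm E k (orbit x) _ w B 1 (proj1 hk) (orbit_growth x)
                  Rlt_0_1 h) as hn.
    apply Rle_trans with (1 := hn).
    pose proof (norm_ge_0 (V := CompleteNormedModule.NormedModule _ E) x) as hx.
    unfold Rdiv; rewrite Rinv_1, Rmult_1_r, <- Rmult_assoc.
    apply Rmult_le_compat_r; [exact hx | lra].
Qed.

Lemma transform_orbit_analytic :
  analytic_on (sector (PI / 2)) (fun z x => transform (gauss z) (orbit x)).
Proof.
  pose proof PI_RGT_0 as hpi.
  assert (hhalf : 0 < PI / 2 <= PI / 2) by lra.
  split.
  - intros z hz; apply transform_orbit_bounded, gauss_admissible.
    apply (sector_halfplane _ _ hhalf hz).
  - intros z hz; destruct (sector_halfplane _ _ hhalf hz) as [hre _].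
    exists (fun x => transform (dgauss z) (orbit x)); split.
    { apply transform_orbit_bounded, dgauss_admissible, hre. }
    intros eps.
    destruct (gauss_transform_taylor E z w hre) as (D & r & hD & hr & h).
    (* On the unit ball the quotient error is at most [D * N * Cmod (z' - z)], hence at most
       [eps / 2], which leaves room for the strict inequality. The ball is then taken of radius
       [d / 2] because neighbourhoods bound the two components separately. *)
    set (d := Rmin r (eps / (2 * (D * N + 1)))).
    assert (hDN : 0 < D * N + 1)
      by (pose proof (Rmult_le_pos D N hD (Rlt_le _ _ hN)); lra).
    assert (hd : 0 < d / 2).
    { assert (0 < d); [| lra].
      apply Rmin_pos; [exact hr |].
      apply Rdiv_lt_0_compat; [apply cond_pos | lra]. }
    exists (mkposreal _ hd); intros z' [hz1 hz2] hne.
    change (Rabs (Re z' - Re z) < d / 2) in hz1.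
    change (Rabs (Im z' - Im z) < d / 2) in hz2.
    assert (hzd : Cmod (z' - z) < d).
    { apply Rle_lt_trans with (1 := Cmod_le_Re_Im _).
      destruct z, z'; unfold Cminus, Cplus, Copp; simpl in *.
      unfold Rminus in *; lra. }
    pose proof (Rmin_l r (eps / (2 * (D * N + 1)))) as m1; fold d in m1.
    pose proof (Rmin_r r (eps / (2 * (D * N + 1)))) as m2; fold d in m2.
    destruct (h z') as [hre' hest]; [lra |].
    assert (hdiff : (z' - z)%C <> 0).
    { intros e; exact (hne (Cminus_eq_0 z' z e)). }
    assert (hmod : 0 < Cmod (z' - z)) by (apply Cmod_gt_0, hdiff).
    apply Rbar_le_lt_trans with (Finite (eps / 2)).
    2: { pose proof (cond_pos eps); simpl; lra. }
    apply opnorm_le; intros x hx.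
    specialize (hest (orbit x) _ (orbit_growth x)).
    set (u := minus (transform (gauss z') (orbit x)) (transform (gauss z) (orbit x))) in *.
    set (v := transform (dgauss z) (orbit x)) in *.
    assert (e : minus (scal (/ (z' - z))%C u) v
                = scal (/ (z' - z))%C (minus u (scal (z' - z)%C v))).
    { exact (minus_scal_inv (V := CompleteNormedModule.ModuleSpace _ E) _ u v hdiff). }
    rewrite e.
    apply Rle_trans with (1 := norm_scal_Cmod E _ _).
    rewrite Cmod_inv by exact hdiff.
    apply Rle_trans with (/ Cmod (z' - z) * (D * Cmod (z' - z) ^ 2 * (N * norm x))).
    { apply Rmult_le_compat_l; [apply Rlt_le, Rinv_0_lt_compat, hmod | exact hest]. }
    replace (/ Cmod (z' - z) * (D * Cmod (z' - z) ^ 2 * (N * norm x)))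
      with (D * N * norm x * Cmod (z' - z)) by (field; lra).
    pose proof (norm_ge_0 (V := CompleteNormedModule.NormedModule _ E) x) as hx0.
    change (0 <= norm x) in hx0.
    pose proof (Rmult_le_pos D N hD (Rlt_le _ _ hN)) as hDN0.
    apply Rle_trans with ((D * N + 1) * (eps / (2 * (D * N + 1)))).
    + apply Rmult_le_compat; [apply Rmult_le_pos; assumption | lra | | lra].
      apply Rle_trans with (D * N * 1); [apply Rmult_le_compat_l; assumption | lra].
    + right; field; lra.
Qed.

Lemma transform_orbit_sector_limit (gamma : R) (x : E) :
  0 < gamma < PI / 2 -> CK 0 x = zero ->
  filterlim (fun z => transform (gauss z) (orbit x))
    (within (sector gamma) (locally (RtoC 0))) (locally (zero : E)).
Proof.
  intros hg h0.
  assert (hg' : 0 < gamma <= PI / 2) by lra.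
  assert (hcos : 0 < cos gamma) by (apply cos_gt_0; lra).
  assert (hx0 : orbit x 0 = zero) by (unfold orbit; rewrite Rmax_left by lra; exact h0).
  apply (filterlim_locally (U := CompleteNormedModule.UniformSpace _ E)); intros eps.
  destruct (gauss_transform_vanishes E (orbit x) _ w (cos gamma) hcos hw
    (orbit_growth x) hx0 eps (cond_pos eps)) as (d & hd & h).
  assert (hd2 : 0 < d / 2) by lra.
  exists (mkposreal _ hd2); intros z [hz1 hz2] hs.
  destruct (sector_halfplane _ _ hg' hs) as [hre hsec].
  change (Rabs (Re z - 0) < d / 2) in hz1.
  change (Rabs (Im z - 0) < d / 2) in hz2.
  rewrite Rminus_0_r in hz1, hz2.
  apply (norm_compat1 (V := CompleteNormedModule.NormedModule _ E)).
  rewrite (minus_zero_E E); apply h; [exact hre | exact hsec |].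
  apply Rle_lt_trans with (1 := Cmod_le_Re_Im z); lra.
Qed.

Lemma transform_orbit_sector_bound (gamma : R) : 0 < gamma < PI / 2 ->
  exists M v : R, 0 < M /\ 0 < v /\ forall z, sector gamma z ->
    Rbar_le (opnorm (fun x => transform (gauss z) (orbit x))) (M * exp (v * Re z)).
Proof.
  intros hg.
  assert (hg' : 0 < gamma <= PI / 2) by lra.
  assert (hcos : 0 < cos gamma) by (apply cos_gt_0; lra).
  set (k := cos gamma) in *.
  pose proof (sqrt_lt_R0 k hcos) as hsk.
  assert (hpi : 0 < / sqrt PI) by (apply Rinv_0_lt_compat, sqrt_lt_R0, PI_RGT_0).
  (* In the sector [|z| <= Re z / k] converts the rate in [|z|] into a rate in [Re z]; the summand 1
     makes it positive even when [w = 0]. *)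
  exists (/ sqrt PI * (2 / sqrt k) * exp (1 / 2) * N), (2 * w ^ 2 / k ^ 2 + 1).
  assert (hM : 0 < / sqrt PI * (2 / sqrt k) * exp (1 / 2) * N).
  { repeat apply Rmult_lt_0_compat; try lra; [apply Rinv_0_lt_compat, hsk | apply exp_pos]. }
  split; [exact hM |].
  assert (hv : 0 <= 2 * w ^ 2 / k ^ 2).
  { apply Rdiv_le_0_compat; [pose proof (pow2_ge_0 w); lra | apply pow_lt, hcos]. }
  split; [lra |].
  intros z hs; destruct (sector_halfplane _ _ hg' hs) as [hre hsec]; fold k in hsec.
  apply opnorm_le; intros x hx.
  apply Rle_trans with (1 := gauss_transform_sector E z (orbit x) _ w k hcos hre hsec
                               (orbit_growth x)).
  assert (hexp : exp (2 * w ^ 2 / k * Cmod z + 1 / 2)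
                 <= exp (1 / 2) * exp ((2 * w ^ 2 / k ^ 2 + 1) * Re z)).
  { rewrite <- exp_plus; apply exp_le_exp.
    replace (2 * w ^ 2 / k * Cmod z) with (2 * w ^ 2 / k ^ 2 * (k * Cmod z))
      by (field; lra).
    assert (2 * w ^ 2 / k ^ 2 * (k * Cmod z) <= 2 * w ^ 2 / k ^ 2 * Re z)
      by (apply Rmult_le_compat_l; assumption).
    lra. }
  replace (/ sqrt PI * (2 / sqrt k) * exp (1 / 2) * N * exp ((2 * w ^ 2 / k ^ 2 + 1) * Re z))
    with (/ sqrt PI * (2 / sqrt k) * (exp (1 / 2) * exp ((2 * w ^ 2 / k ^ 2 + 1) * Re z)) * (N * 1))
    by ring.
  pose proof (norm_ge_0 (V := CompleteNormedModule.NormedModule _ E) x) as hx0.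
  change (0 <= norm x) in hx0.
  assert (h2k : 0 < 2 / sqrt k) by (apply Rdiv_lt_0_compat; lra).
  apply Rmult_le_compat.
  - repeat apply Rmult_le_pos; try lra; apply Rlt_le, exp_pos.
  - apply Rmult_le_pos; lra.
  - apply Rmult_le_compat_l; [apply Rmult_le_pos; lra | exact hexp].
  - apply Rmult_le_compat_l; lra.
Qed.

Lemma gauss_family_is_gauss_transform (t : R) (x : E) : 0 < t ->
  is_gauss_transform CK t x (gauss_family E (orbit x) t).
Proof.
  intros ht; rewrite gauss_family_pos by exact ht.
  pose proof (sqrt_lt_R0 t ht) as hst; pose proof (sqrt_lt_R0 _ PI_RGT_0) as hspi.
  (* Undoes the normalization contained in [gauss], which the Gauss transform of the statement keeps
     outside the integral. *)
  set (r := sqrt PI * sqrt t).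
  assert (hr : 0 < r) by (apply Rmult_lt_0_compat; assumption).
  exists (scal (RtoC r) (transform (gauss (RtoC t)) (orbit x))); split.
  - pose proof (is_RInt_gen_scal (V := real_CompleteNormedModule E) _ r _
      (transform_correct E _ _ _ _ (gauss_admissible (RtoC t) ht) (orbit_growth x))) as h.
    refine (is_RInt_gen_ext (V := real_CompleteNormedModule E) _ _ _ _ h).
    exists (fun a => a = 0) (fun b => 0 < b); [reflexivity | exists 0; auto |].
    intros a b -> hb s; simpl; rewrite Rmin_left, Rmax_right by lra; intros hs.
    rewrite gauss_RtoC by exact ht; unfold orbit; rewrite Rmax_right by lra.
    refine (eq_trans (scal_assoc (V := CompleteNormedModule.ModuleSpace _ E)
                        (RtoC r) (RtoC (real_gauss t s)) (CK s x)) _).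
    change (mult (RtoC r) (RtoC (real_gauss t s))) with (RtoC r * RtoC (real_gauss t s))%C.
    rewrite <- RtoC_mult; f_equal; f_equal.
    unfold r, real_gauss; field_simplify; [reflexivity | lra].
  - refine (eq_sym (eq_trans (scal_assoc (V := CompleteNormedModule.ModuleSpace _ E)
                        (RtoC (1 / sqrt (PI * t))) (RtoC r) _) _)).
    change (mult (RtoC (1 / sqrt (PI * t))) (RtoC r)) with (RtoC (1 / sqrt (PI * t)) * RtoC r)%C.
    rewrite <- RtoC_mult.
    replace (1 / sqrt (PI * t) * r) with 1.
    + exact (scal_one (V := CompleteNormedModule.ModuleSpace _ E) _).
    + rewrite sqrt_mult by (pose proof PI_RGT_0; lra); fold r; field; lra.
Qed.

End CosineFamily.

Section Subgenerator.

Variable E : CompleteNormedModule C_AbsRing.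
Variable A : partial_operator E.
Hypothesis hA_linear : linear_operator A.
Hypothesis hA_closed : closed_operator A.

Lemma app_zero : app A zero = zero.
Proof.
  destruct (proj2 (proj2 hA_linear) (RtoC 0) zero (proj1 hA_linear)) as [_ h].
  rewrite !(scal_RtoC_0 E) in h; exact h.
Qed.

Lemma operator_closed_relation :
  closed_complex_relation E E (fun x y => dom A x /\ app A x = y).
Proof.
  destruct hA_linear as (h0 & hp & hs).
  split; [split; [exact h0 | exact app_zero] |].
  split; [| split].
  - intros x y x' y' [hx <-] [hx' <-]; apply hp; assumption.
  - intros a x y [hx <-]; apply hs, hx.
  - intros u v x y huv hu hv; apply (hA_closed u x y).
    + intros n; apply huv.
    + exact hu.
    + refine (filterlim_ext _ _ _ hv); intros n; symmetry; apply huv.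
Qed.

End Subgenerator.

Lemma exp_growth_minus (E : CompleteNormedModule C_AbsRing) (c c' : R -> E)
    (N w N' w' : R) :
  exp_growth c N w -> exp_growth c' N' w' ->
  exp_growth (fun s => minus (c s) (c' s)) (N + N') (Rmax w w').
Proof.
  intros hc hc'; split.
  - intros s; exact (continuous_minus (V := CompleteNormedModule.NormedModule _ E)
                       c c' s (proj1 hc s) (proj1 hc' s)).
  - intros s hs.
    assert (ht : norm (minus (c s) (c' s)) <= norm (c s) + norm (c' s)).
    { pose proof (norm_triangle (V := CompleteNormedModule.NormedModule _ E)
                    (c s) (opp (c' s))) as h.
      exact (Rle_trans _ _ _ h (Rplus_le_compat_l _ _ _ (Req_le _ _
        (norm_opp (V := CompleteNormedModule.NormedModule _ E) (c' s))))). }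
    apply Rle_trans with (1 := ht).
    pose proof (proj2 hc s hs); pose proof (proj2 hc' s hs).
    assert (h1 : N * exp (w * s) <= N * exp (Rmax w w' * s)).
    { apply Rmult_le_compat_l; [exact (exp_growth_nonneg E c N w hc) |].
      apply exp_le_exp, Rmult_le_compat_r; [exact hs | apply Rmax_l]. }
    assert (h2 : N' * exp (w' * s) <= N' * exp (Rmax w w' * s)).
    { apply Rmult_le_compat_l; [exact (exp_growth_nonneg E c' N' w' hc') |].
      apply exp_le_exp, Rmult_le_compat_r; [exact hs | apply Rmax_r]. }
    lra.
Qed.

Theorem theorem10 (E : CompleteNormedModule C_AbsRing)
    (A : partial_operator E) (Cop : E -> E) (K : R -> C) (CK : R -> E -> E)
    (hA_linear : linear_operator A) (hA_closed : closed_operator A)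
    (hC_bounded : bounded_operator Cop)
    (hC_injective : forall x y : E, Cop x = Cop y -> x = y)
    (hCA : commutes_with Cop A)
    (hK_loc : L1_loc K) (hK_nonzero : ~ zero_L1_loc K)
    (hK_bound : exists M beta : R, 0 < M /\ 0 < beta /\
       Lebesgue.ae_nonneg (fun t => Cmod (K t) <= M * exp (beta * t)))
    (hCK : subgenerator_cosine A K Cop CK)
    (hCK_bound : exponentially_bounded CK) :
  exists S : R -> E -> E,
    (forall (t : R) (x : E), 0 < t -> is_gauss_transform CK t x (S t x)) /\
    subgenerator_semigroup A (K1 K) Cop S /\
    exp_bounded_analytic (PI / 2) S.
Proof.
  destruct hK_bound as (M & beta & hM & hbeta & hK).
  destruct hCK as (_ & hcont & hCKA & hCKC & hcos).
  destruct hCK_bound as (N & w0 & hN & hw0).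
  (* The exponential bound may come with a negative rate; the estimates on primitives and at the
     origin want a nonnegative one. *)
  set (w := Rmax 0 w0).
  assert (hw : 0 <= w) by apply Rmax_l.
  assert (hbound : forall t, 0 <= t -> Rbar_le (opnorm (CK t)) (N * exp (w * t))).
  { intros t ht; apply Rbar_le_trans with (1 := hw0 t ht); simpl.
    apply Rmult_le_compat_l; [lra |].
    apply exp_le_exp, Rmult_le_compat_r; [exact ht | apply Rmax_r]. }
  pose proof (orbit_growth E CK N w hcont hbound) as hgrow.
  pose proof (app_zero E A hA_linear) as hA0.
  pose proof (operator_closed_relation E A hA_linear hA_closed) as hrel.
  (* The cosine equation at time 0: the integral, its image under [A] and [Theta K 0] all vanish. *)
  assert (hCK0 : forall x, CK 0 x = zero).
  { intros x; destruct (hcos 0 x (Rle_refl 0)) as [_ h].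
    assert (hJ : integral (fun s => scal (RtoC (0 - s)) (CK s x)) 0 0 = zero)
      by exact (RInt_point (V := real_CompleteNormedModule E) 0 _).
    rewrite hJ, hA0, Theta_0 in h; symmetry in h.
    rewrite (scal_RtoC_0 E) in h.
    rewrite (minus_zero_E E) in h; exact h. }
  assert (horbit0 : forall x, orbit E CK x 0 = zero)
    by (intros x; unfold orbit; rewrite Rmax_left by lra; apply hCK0).
  set (S := fun (t : R) (x : E) => gauss_family E (orbit E CK x) t).
  assert (hSpos : forall t x, 0 < t -> S t x = transform (gauss (RtoC t)) (orbit E CK x))
    by (intros t x ht; apply gauss_family_pos, ht).
  assert (hS0 : forall x, S 0 x = zero)
    by (intros x; apply gauss_family_nonpos, Rle_refl).
  exists S; split; [| split].
  - intros t x ht.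
    exact (gauss_family_is_gauss_transform E CK N w hcont hbound t x ht).
  - split; [exact (L1_loc_K1 K M beta hM hbeta hK_loc hK) |].
    split; [split |].
    + intros t [ht | <-].
      * assert (e : S t = (fun x => transform (gauss (RtoC t)) (orbit E CK x)))
          by (apply functional_extensionality; intros x; apply hSpos, ht).
        rewrite e; apply (transform_orbit_bounded E CK N w hN hcont hbound).
        apply gauss_admissible, ht.
      * assert (e : S 0 = (fun _ => zero))
          by (apply functional_extensionality; exact hS0).
        rewrite e; exact (is_linear_zero (U := CompleteNormedModule.NormedModule _ E)
                            (V := CompleteNormedModule.NormedModule _ E)).
    + intros x t _.
      apply filterlim_filter_le_1 with (2 := gauss_family_continuous E _ _ w t hw
        (hgrow x) (horbit0 x)).
      apply filter_le_within.
    + split; [| split].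
      * intros t x [ht | <-].
        -- rewrite !hSpos by exact ht.
           rewrite <- (transform_linear E E Cop _ _ _ _ hC_bounded
                         (gauss_admissible (RtoC t) ht) (hgrow x)).
           f_equal; apply functional_extensionality; intros s.
           apply hCKC, Rmax_l.
        -- rewrite !hS0; symmetry; exact (linear_zero Cop hC_bounded).
      * intros t [ht | <-] x hx.
        -- rewrite !hSpos by exact ht.
           (* For each [s] the vectors [CK s x] and [CK s (app A x)] form a point of the graph of
              [A]. *)
           apply (transform_relation E E _ _ _ _ _ _ _ _ hrel
                    (gauss_admissible (RtoC t) ht) (hgrow x) (hgrow (app A x))).
           intros s hs; apply hCKA; [apply Rmax_l | exact hx].
        -- rewrite !hS0; split; [apply hA_linear | exact hA0].
      * intros t x [ht | <-].
        -- pose proof (hgrow x) as hx.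
           set (c := orbit E CK x) in *.
           assert (hx1 : 0 <= w + 1) by lra.
           pose proof (primitive_growth E c _ w hw hx) as hc1.
           pose proof (primitive_growth E _ _ (w + 1) hx1 hc1) as hc2.
           cbv zeta.
           assert (eJ : integral (fun s => S s x) 0 t
                        = transform (gauss (RtoC t)) (primitive E (primitive E c)))
             by exact (integral_gauss_family E c _ w t ht hw hx (horbit0 x)).
           rewrite eJ, (hSpos t x ht).
           pose proof (Theta_ext_growth K M beta hM hbeta hK_loc hK 1 Rlt_0_1) as hth.
           set (y := Cop x).
           assert (hthy : exists N', exp_growth (fun s => scal (Theta_ext K s) y : E)
                                       N' (beta + 1)).
           { exact (exp_growth_linear C_CompleteNormedModule E (fun a => scal a y) _ _ _
                      (is_linear_scal_vector E y) hth). }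
           destruct hthy as [N' hthy].
           pose proof (exp_growth_minus E _ _ _ _ _ _ hx hthy) as hdiff.
           (* The cosine equation puts the second primitive of the orbit and [c(s) - Theta(s) y] on
              the graph of [A] for every [s]; the Gauss transform carries this over to time [t]. *)
           destruct (transform_relation E E _ _ _ _ _ _ _ _ hrel
                    (gauss_admissible (RtoC t) ht) hc2 hdiff) as [hd he].
           { intros s hs.
             rewrite <- (integral_convolution E c s (proj1 hx)).
             assert (ec : integral (fun r => scal (RtoC (s - r)) (c r)) 0 s
                          = integral (fun r => scal (RtoC (s - r)) (CK r x)) 0 s).
             { apply (RInt_ext (V := real_CompleteNormedModule E)).
               intros r hr; rewrite Rmin_left, Rmax_right in hr by exact hs.
               unfold c, orbit; rewrite Rmax_right by lra; reflexivity. }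
             rewrite ec; unfold c, orbit, Theta_ext; rewrite Rmax_right by exact hs.
             exact (hcos s x hs). }
           split; [exact hd |].
           rewrite he.
           rewrite (transform_minus_r E _ _ _ _ _ _ _ (gauss_admissible (RtoC t) ht)
                      hx hthy).
           f_equal.
           rewrite (Theta_K1 K M beta hM hbeta hK_loc hK t ht).
           exact (transform_linear C_CompleteNormedModule E (fun a => scal a y)
                    _ _ _ _ (is_linear_scal_vector E y)
                    (gauss_admissible (RtoC t) ht) hth).
        -- cbv zeta.
           assert (hJ : integral (fun s => S s x) 0 0 = zero)
             by exact (RInt_point (V := real_CompleteNormedModule E) 0 _).
           rewrite hJ, hA0, hS0, Theta_0.
           rewrite (scal_RtoC_0 E).
           split; [apply hA_linear | symmetry; apply (minus_zero_E E)].
  - pose proof PI_RGT_0 as hpi.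
    split; [lra |].
    exists (fun z x => transform (gauss z) (orbit E CK x)); split; [| split; [| split]].
    + exact (transform_orbit_analytic E CK N w hN hcont hbound).
    + intros t x ht; symmetry; apply hSpos, ht.
    + intros gamma x hg.
      exact (transform_orbit_sector_limit E CK N w hw hcont hbound gamma x hg (hCK0 x)).
    + intros gamma hg.
      exact (transform_orbit_sector_bound E CK N w hN hcont hbound gamma hg).
Qed.
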